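(* Let $0<\alpha<1$ and let $f$ be a strongly convex function of order $\alpha$. Then $$\|S_f\|\le 2\alpha,$$ and this inequality is sharp, i.e. the constant $2\alpha$ cannot be replaced by a smaller one valid for all strongly convex functions of order $\alpha$.
   Context: Let $\mathbb{D}=\{z\in\mathbb{C}:|z|<1\}$ and let $\mathscr{A}$ be the class of analytic functions $f$ on $\mathbb{D}$ with $f(0)=0$ and $f'(0)=1$. For $0<\alpha<1$, a function $f\in\mathscr{A}$ is called strongly convex of order $\alpha$ if $\left|\arg\left[1+\frac{zf''(z)}{f'(z)}\right]\right|<\frac{\pi\alpha}{2}$ for all $z\in\mathbb{D}$ (in particular $f'$ has no zeros in $\mathbb{D}$). The Schwarzian derivative of $f$ is $S_f=\left(\frac{f''}{f'}\right)'-\frac12\left(\frac{f''}{f'}\right)^2$ and its norm is $\|S_f\|=\sup_{z\in\mathbb{D}}(1-|z|^2)^2|S_f(z)|$. *)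

(* Defs.v *)
From Stdlib Require Import Reals Lra.
From Coquelicot Require Import Coquelicot.

Open Scope R_scope.

Definition unit_disk (z : C) : Prop := Cmod z < 1.

(* Local power series expansions with complex coefficients. *)
Definition analytic_on (D : C -> Prop) (f : C -> C) : Prop :=
  forall z0 : C, D z0 ->
  exists (r : R) (a : nat -> C),
    0 < r /\
    forall z : C, Cmod (z - z0)%C < r ->
      is_pseries (K := C_AbsRing) (V := C_NormedModule) a (z - z0)%C (f z).

(* Functions are total on [C]; only the values on the open disk matter, since
   all the derivatives below are taken at interior points. *)
Definition class_A (f : C -> C) : Prop :=
  analytic_on unit_disk f /\ f 0%C = 0%C /\ C_derive f 0%C = 1%C.

(* Principal argument, with values in (-PI, PI]; meaningless at 0. *)
Definition Arg (z : C) : R :=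
  if Rle_dec 0 (Im z) then acos (Re z / Cmod z) else - acos (Re z / Cmod z).

(* f'' / f' *)
Definition pre_schwarzian (f : C -> C) (z : C) : C :=
  (C_derive (C_derive f) z / C_derive f z)%C.

(* Division and [Arg] being total, the two nonvanishing conditions make
   explicit that the quotient and the argument have to be defined. *)
Definition strongly_convex (alpha : R) (f : C -> C) : Prop :=
  class_A f /\
  forall z : C, unit_disk z ->
    C_derive f z <> 0%C /\
    (1 + z * pre_schwarzian f z)%C <> 0%C /\
    Rabs (Arg (1 + z * pre_schwarzian f z)%C) < PI * alpha / 2.

Definition schwarzian (f : C -> C) (z : C) : C :=
  (C_derive (pre_schwarzian f) z - / 2 * pre_schwarzian f z ^ 2)%C.

Definition schwarzian_norm (f : C -> C) : Rbar :=
  Lub_Rbar (fun x : R => exists z : C,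
    unit_disk z /\ x = (1 - Cmod z ^ 2) ^ 2 * Cmod (schwarzian f z)).

Lemma Arg_spec (z : C) : z <> 0%C ->
  - PI < Arg z <= PI /\ z = (Cmod z * cos (Arg z), Cmod z * sin (Arg z)).
Proof.
intros Hz.
assert (Hm : 0 < Cmod z) by now apply Cmod_gt_0.
destruct z as [x y].
assert (Hxy : Cmod (x, y) ^ 2 = x ^ 2 + y ^ 2) by apply Cmod2_alt.
set (m := Cmod (x, y)) in *.
assert (Hc : (x / m) ^ 2 + (y / m) ^ 2 = 1).
{ replace ((x / m) ^ 2 + (y / m) ^ 2) with ((x ^ 2 + y ^ 2) / m ^ 2)
    by (field; lra).
  rewrite <- Hxy; field; lra. }
assert (Hb : -1 <= x / m <= 1) by nra.
pose proof (acos_bound (x / m)) as Ha.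
assert (Hs : sin (acos (x / m)) = Rabs (y / m)).
{ rewrite sin_acos by lra. rewrite <- sqrt_Rsqr_abs. f_equal.
  unfold Rsqr; lra. }
pose proof PI_RGT_0 as HPI.
unfold Arg; fold m; simpl Re; simpl Im.
destruct (Rle_dec 0 y) as [Hy | Hy].
- split; [lra |].
  rewrite cos_acos, Hs, Rabs_pos_eq by
    (try lra; unfold Rdiv; apply Rmult_le_pos; auto with real;
     left; now apply Rinv_0_lt_compat).
  f_equal; field; lra.
- assert (Hn : y / m < 0).
  { replace (y / m) with (- (- y * / m)) by (field; lra).
    apply Ropp_lt_gt_0_contravar, Rmult_lt_0_compat;
      [lra | now apply Rinv_0_lt_compat]. }
  split.
  + split; [| lra].
    destruct (Req_dec (acos (x / m)) PI) as [E | E]; [| lra].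
    rewrite E, sin_PI, Rabs_left in Hs by lra. lra.
  + rewrite cos_neg, sin_neg, cos_acos, Hs, Rabs_left by lra.
    f_equal; field; lra.
Qed.

(* Main.v *)
Require Import Defs.
From Stdlib Require Import Reals Lra Lia Factorial.
From Stdlib Require Import Classical_Prop IndefiniteDescription FunctionalExtensionality.
From Coquelicot Require Import Coquelicot.

(** Put [T = f''/f'] and [P = 1 + z T]. Since |arg P| < pi alpha / 2, [L = log P / alpha] maps the disk
    into the strip |Im L| < pi / 2, so [w = tanh (L / 2)] is a self-map of the disk fixing 0, and
    [z^2 S_f = z P' + (1 - P^2) / 2
             = 2 alpha P ((z w' - w) / (1 - w^2) + (sinh L - sinh (alpha L) / alpha) / 2)].
    The first term is bounded by Dieudonné's inequality |z w' - w| <= (|z|^2 - |w|^2) / (1 - |z|^2),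
    the others by their values at the real point [artanh |w|]; an elementary real inequality remains.
    Dieudonné's inequality is Schwarz-Pick for [w / z]. The maximum principle behind it comes from the
    positive Laplacian of [|F|^2 + eps |z|^2], without any integration.

    Equality holds at [z = 0] for [1 + z f''/f' = ((1 + z^2) / (1 - z^2))^alpha]. The power series of
    this function, of [f'] and of [f] are defined by recursion, their growth being controlled by the
    recursions themselves; the linear differential equations they satisfy identify them. *)

(** * Complex derivatives and the mean value inequality *)

(** The function [w] is the Schwarz function with [P = ((1 + w) / (1 - w))^alpha], so that
    [L' = 2 w' / (1 - w^2)], [sinh L = 2 w / (1 - w^2)] and [(1 - P^2) / 2 = - P sinh (alpha L)];
    these relations give the decomposition. The two [sinh] terms are kept together because
    [sinh L - sinh (alpha L) / alpha] has the nonnegative Taylor coefficients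
    [(1 - alpha^(2k)) / (2k+1)!], so that on a circle its modulus is largest at the positive real
    point. Three obstacles shape the rest. The quotient [w / z] and the Schwarz-Pick quotients have
    no value at some point, so the maximum principle must tolerate exceptional points. The factor
    [z^2] leaves the origin out, and continuity has to bring it back. Analyticity asks for an
    expansion about every centre, whereas the extremal function is constructed by its series at 0
    alone; hence the re-expansion of power series, by comparison with the series of moduli. *)

Lemma is_derive_normP {K : AbsRing} {V : NormedModule K} (f : K -> V) (x : K) (l : V) :
  is_derive f x l <->
  forall eps : R, 0 < eps -> exists delta : R, 0 < delta /\
    forall y : K, norm (minus y x) < delta ->
      norm (minus (minus (f y) (f x)) (scal (minus y x) l)) <= eps * norm (minus y x).
Proof.
split.
- intros [_ H] eps Heps.
  specialize (H x (fun P HP => HP) (mkposreal eps Heps)).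
  apply (locally_le_locally_norm (V := AbsRing_NormedModule K)) in H.
  destruct H as [d Hd]. exists d; split; [apply cond_pos|].
  intros y Hy. now apply Hd.
- intros H. split; [apply is_linear_scal_l|].
  intros y Hy.
  apply (is_filter_lim_locally_unique (V := AbsRing_NormedModule K)) in Hy. subst y.
  intros [eps Heps]. destruct (H eps Heps) as [d [Hd Hd']].
  apply (locally_norm_le_locally (V := AbsRing_NormedModule K)).
  exists (mkposreal d Hd). intros y Hy. now apply Hd'.
Qed.

Definition is_cderive (f : C -> C) (z l : C) : Prop :=
  @is_derive C_AbsRing C_NormedModule f z l.

Lemma is_cderiveP (f : C -> C) (z l : C) :
  is_cderive f z l <->
  forall eps : R, 0 < eps -> exists delta : R, 0 < delta /\
    forall h : C, Cmod h < delta ->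
      Cmod (f (z + h)%C - f z - h * l) <= eps * Cmod h.
Proof.
unfold is_cderive. rewrite is_derive_normP. split; intros H eps Heps.
- destruct (H eps Heps) as [d [Hd H']]. exists d; split; [easy|]. intros h Hh.
  assert (K : Cmod (z + h - z) < d -> Cmod (f (z + h)%C - f z - (z + h - z) * l)
               <= eps * Cmod (z + h - z)) by exact (H' (z + h)%C).
  replace (z + h - z)%C with h in K by ring. exact (K Hh).
- destruct (H eps Heps) as [d [Hd H']]. exists d; split; [easy|]. intros y Hy.
  assert (E : (z + (y - z) = y :> C)%C) by ring.
  specialize (H' (y - z)%C Hy). rewrite E in H'. exact H'.
Qed.

(** The product and chain rules are stated for the ring viewed as a module over itself, where balls
    come from the modulus, while [C_NormedModule] has coordinatewise balls. The epsilon-delta form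
    only sees the norm, which is the same in both. *)
Lemma is_cderive_R (f : C -> C) (z l : C) :
  is_cderive f z l <-> @is_derive C_AbsRing (AbsRing_NormedModule C_AbsRing) f z l.
Proof. unfold is_cderive. now rewrite !is_derive_normP. Qed.

Lemma cderive_const (c z : C) : is_cderive (fun _ => c) z 0%C.
Proof. exact (is_derive_const _ _). Qed.

Lemma cderive_id (z : C) : is_cderive (fun w => w) z 1%C.
Proof. apply is_cderive_R. exact (is_derive_id _). Qed.

Lemma cderive_plus (f g : C -> C) (z df dg : C) :
  is_cderive f z df -> is_cderive g z dg ->
  is_cderive (fun w => f w + g w)%C z (df + dg)%C.
Proof. exact (is_derive_plus _ _ _ _ _). Qed.

Lemma cderive_minus (f g : C -> C) (z df dg : C) :
  is_cderive f z df -> is_cderive g z dg ->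
  is_cderive (fun w => f w - g w)%C z (df - dg)%C.
Proof. exact (is_derive_minus _ _ _ _ _). Qed.

Lemma cderive_opp (f : C -> C) (z df : C) :
  is_cderive f z df -> is_cderive (fun w => - f w)%C z (- df)%C.
Proof. exact (is_derive_opp _ _ _). Qed.

Lemma cderive_mult (f g : C -> C) (z df dg : C) :
  is_cderive f z df -> is_cderive g z dg ->
  is_cderive (fun w => f w * g w)%C z (df * g z + f z * dg)%C.
Proof.
rewrite !is_cderive_R. intros Hf Hg.
exact (is_derive_mult _ _ _ _ _ Hf Hg Cmult_comm).
Qed.

Lemma cderive_comp (f g : C -> C) (z df dg : C) :
  is_cderive f (g z) df -> is_cderive g z dg ->
  is_cderive (fun w => f (g w)) z (dg * df)%C.
Proof.
rewrite !is_cderive_R. intros Hf Hg. exact (is_derive_comp _ _ _ _ _ Hf Hg).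
Qed.

Lemma cderive_eq (f : C -> C) (z l l' : C) :
  is_cderive f z l -> l = l' -> is_cderive f z l'.
Proof. now intros H <-. Qed.

Lemma cderive_ext (f g : C -> C) (z l : C) :
  (forall w, f w = g w) -> is_cderive f z l -> is_cderive g z l.
Proof. exact (is_derive_ext _ _ _ _). Qed.

Lemma cderive_ext_loc (f g : C -> C) (z l : C) (r : R) :
  0 < r -> (forall w, Cmod (w - z) < r -> f w = g w) ->
  is_cderive f z l -> is_cderive g z l.
Proof.
intros Hr E. rewrite !is_cderiveP. intros H eps Heps.
destruct (H eps Heps) as [d [Hd H']]. exists (Rmin d r); split; [now apply Rmin_pos|].
intros h Hh.
assert (Hh1 := Rlt_le_trans _ _ _ Hh (Rmin_l d r)).
assert (Hh2 := Rlt_le_trans _ _ _ Hh (Rmin_r d r)).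
rewrite <- !E.
- now apply H'.
- replace (z - z)%C with (RtoC 0) by ring. now rewrite Cmod_0.
- now replace (z + h - z)%C with h by ring.
Qed.

Lemma cderive_lipschitz (f : C -> C) (z l : C) :
  is_cderive f z l -> exists delta : R, 0 < delta /\
    forall h : C, Cmod h < delta -> Cmod (f (z + h)%C - f z) <= (Cmod l + 1) * Cmod h.
Proof.
intros H. rewrite is_cderiveP in H. destruct (H 1 Rlt_0_1) as [d [Hd H']].
exists d; split; [easy|]. intros h Hh. specialize (H' h Hh).
replace (f (z + h)%C - f z)%C with ((f (z + h)%C - f z - h * l) + h * l)%C by ring.
eapply Rle_trans; [apply Cmod_triangle|]. rewrite Cmod_mult. lra.
Qed.

Definition ccont (f : C -> C) (z : C) : Prop :=
  forall eps : R, 0 < eps -> exists delta : R, 0 < delta /\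
    forall h : C, Cmod h < delta -> Cmod (f (z + h)%C - f z) < eps.

Lemma cderive_cont (f : C -> C) (z l : C) : is_cderive f z l -> ccont f z.
Proof.
intros H eps Heps. destruct (cderive_lipschitz _ _ _ H) as [d [Hd H']].
pose proof (Cmod_ge_0 l) as Hl.
exists (Rmin d (eps / (Cmod l + 2))); split.
- apply Rmin_pos; [easy|]. apply Rdiv_lt_0_compat; lra.
- intros h Hh.
  assert (Hh1 := Rlt_le_trans _ _ _ Hh (Rmin_l _ _)).
  assert (Hh2 := Rlt_le_trans _ _ _ Hh (Rmin_r _ _)).
  specialize (H' h Hh1).
  assert (Cmod h * (Cmod l + 2) < eps).
  { apply Rlt_div_r; lra. }
  pose proof (Cmod_ge_0 h). nra.
Qed.

Lemma cderive_inverse (E L : C -> C) (z e : C) (r : R) :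
  0 < r -> (forall w, Cmod (w - z) < r -> E (L w) = w) ->
  ccont L z -> is_cderive E (L z) e -> e <> 0%C ->
  is_cderive L z (/ e)%C.
Proof.
intros Hr HEL HL HE He. rewrite is_cderiveP in *. intros eps Heps.
assert (Hm : 0 < Cmod e) by now apply Cmod_gt_0.
(* With [k = L(z+h) - L z]: |h - k e| <= eta |k|, hence |k| <= 2 |h| / |e|. *)
set (eta := Rmin (Cmod e / 2) (eps * Cmod e * Cmod e / 2)).
assert (Heta : 0 < eta). { apply Rmin_pos; [lra|]. assert (0 < Cmod e * Cmod e) by nra. nra. }
assert (He1 : eta <= Cmod e / 2) by apply Rmin_l.
assert (He2 : eta <= eps * Cmod e * Cmod e / 2) by apply Rmin_r.
destruct (HE eta Heta) as [d [Hd H]].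
destruct (HL d Hd) as [d' [Hd' H']].
exists (Rmin d' r); split; [now apply Rmin_pos|]. intros h Hh.
assert (Hh1 := Rlt_le_trans _ _ _ Hh (Rmin_l _ _)).
assert (Hh2 := Rlt_le_trans _ _ _ Hh (Rmin_r _ _)).
specialize (H' h Hh1). set (k := (L (z + h)%C - L z)%C) in *.
specialize (H k H').
replace (L z + k)%C with (L (z + h)%C) in H by (unfold k; ring).
rewrite !HEL in H;
 [| replace (z - z)%C with (RtoC 0) by ring; now rewrite Cmod_0
  | now replace (z + h - z)%C with h by ring ].
replace (z + h - z - k * e)%C with (h - k * e)%C in H by ring.
replace (k - h * / e)%C with (- ((h - k * e) * / e))%C by (field; exact He).
rewrite Cmod_opp, Cmod_mult, Cmod_inv by exact He.
assert (Hk : Cmod k * Cmod e <= 2 * Cmod h).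
{ rewrite <- Cmod_mult.
  assert (T := Cmod_triangle h (- (h - k * e))). rewrite Cmod_opp in T.
  replace (h + - (h - k * e))%C with (k * e)%C in T by ring.
  assert (Cmod (k * e) = Cmod k * Cmod e) by apply Cmod_mult.
  pose proof (Cmod_ge_0 k). nra. }
apply Rmult_le_reg_r with (Cmod e); [easy|].
rewrite Rmult_assoc, Rinv_l by lra. rewrite Rmult_1_r.
eapply Rle_trans; [apply H|].
pose proof (Cmod_ge_0 k).
eapply Rle_trans; [apply Rmult_le_compat_r; [easy | exact He2]|].
assert (0 <= eps * Cmod e) by nra. nra.
Qed.

Lemma Cmod_minus_rev (a b : C) : Cmod a - Cmod b <= Cmod (a - b).
Proof.
assert (T := Cmod_triangle (a - b) b). replace (a - b + b)%C with a in T by ring. lra.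
Qed.

Lemma Cmod_minus_sym (a b : C) : Cmod (a - b) = Cmod (b - a).
Proof. rewrite <- (Cmod_opp (b - a)). f_equal. ring. Qed.

Lemma cderive_Cinv (z : C) : z <> 0%C -> is_cderive Cinv z (- (/ z * / z))%C.
Proof.
intros Hz. assert (Hm : 0 < Cmod z) by now apply Cmod_gt_0.
rewrite is_cderiveP. intros eps Heps.
exists (Rmin (Cmod z / 2) (eps * Cmod z ^ 3 / 2)); split.
{ apply Rmin_pos; [lra|]. assert (0 < Cmod z ^ 3) by now apply pow_lt. nra. }
intros h Hh.
assert (Hh1 := Rlt_le_trans _ _ _ Hh (Rmin_l _ _)).
assert (Hh2 := Rlt_le_trans _ _ _ Hh (Rmin_r _ _)).
assert (Hzh : Cmod z / 2 < Cmod (z + h)).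
{ assert (T := Cmod_minus_rev z (- h)). rewrite Cmod_opp in T.
  replace (z - - h)%C with (z + h)%C in T by ring. lra. }
assert (Hn : (z + h)%C <> 0%C) by (apply Cmod_gt_0; lra).
replace (/ (z + h) - / z - h * - (/ z * / z))%C with (h * (h / ((z + h) * z * z)))%C
  by (field; split; assumption).
rewrite !Cmod_mult, Cmod_div, !Cmod_mult by (repeat apply Cmult_neq_0; assumption).
rewrite Rmult_comm. apply Rmult_le_compat_r; [apply Cmod_ge_0|].
apply Rle_div_l.
{ repeat apply Rmult_lt_0_compat; lra. }
assert (0 < Cmod z * Cmod z) by nra.
assert (Cmod z / 2 * (Cmod z * Cmod z) <= Cmod (z + h) * Cmod z * Cmod z) by nra.
nra.
Qed.

Lemma cderive_inv (f : C -> C) (z df : C) :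
  is_cderive f z df -> f z <> 0%C ->
  is_cderive (fun w => / f w)%C z (- df * (/ f z * / f z))%C.
Proof.
intros Hf Hz. eapply cderive_eq; [exact (cderive_comp _ _ _ _ _ (cderive_Cinv _ Hz) Hf)|]. cbv beta. ring.
Qed.

Lemma is_deriveP (f : R -> R) (x l : R) :
  is_derive f x l <->
  forall eps : R, 0 < eps -> exists delta : R, 0 < delta /\
    forall h : R, Rabs h < delta -> Rabs (f (x + h) - f x - h * l) <= eps * Rabs h.
Proof.
rewrite is_derive_normP. split; intros H eps Heps; destruct (H eps Heps) as [d [Hd H']];
  exists d; (split; [easy|]).
- intros h Hh. specialize (H' (x + h)).
  assert (K : Rabs (x + h - x) < d -> Rabs (f (x + h) - f x - (x + h - x) * l)
               <= eps * Rabs (x + h - x)) by exact H'.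
  replace (x + h - x) with h in K by ring. exact (K Hh).
- intros y Hy. specialize (H' (y - x) Hy).
  rewrite (Rplus_minus x y) in H'. exact H'.
Qed.

Lemma Im_le_Cmod (c : C) : Rabs (Im c) <= Cmod c.
Proof. exact (Rle_trans _ _ _ (Rmax_r _ _) (Rmax_Cmod c)). Qed.

Lemma path_derive_Re (f : C -> C) (z d l : C) (t : R) :
  is_cderive f (z + t * d)%C l ->
  is_derive (fun s : R => Re (f (z + s * d)%C)) t (Re (l * d)).
Proof.
rewrite is_cderiveP, is_deriveP. intros H eps Heps.
pose proof (Cmod_ge_0 d) as Hd.
destruct (H (eps / (Cmod d + 1))) as [e [He H']]; [apply Rdiv_lt_0_compat; lra|].
exists (e / (Cmod d + 1)); split; [apply Rdiv_lt_0_compat; lra|].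
intros h Hh. assert (Hh' : Rabs h * (Cmod d + 1) < e) by (apply Rlt_div_r; lra).
pose proof (Rabs_pos h) as Hp.
specialize (H' (h * d)%C). rewrite Cmod_mult, Cmod_R in H'.
assert (B : Rabs h * Cmod d < e) by nra. specialize (H' B).
replace (z + t * d + h * d)%C with (z + (t + h)%R * d)%C in H' by (rewrite RtoC_plus; ring).
set (a := f _) in H' at 1. set (b := f _) in H'. fold a b.
replace (Re a - Re b - h * Re (l * d)) with (Re (a - b - h * d * l)).
2:{ destruct a, b, d, l; simpl; ring. }
eapply Rle_trans; [apply re_le_Cmod|]. eapply Rle_trans; [apply H'|].
apply Rle_trans with (eps / (Cmod d + 1) * (Rabs h * (Cmod d + 1))).
- apply Rmult_le_compat_l; [left; apply Rdiv_lt_0_compat; lra|]. nra.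
- right. field. lra.
Qed.

Lemma path_derive_Im (f : C -> C) (z d l : C) (t : R) :
  is_cderive f (z + t * d)%C l ->
  is_derive (fun s : R => Im (f (z + s * d)%C)) t (Im (l * d)).
Proof.
intros H.
assert (H' : is_cderive (fun w => - Ci * f w)%C (z + t * d)%C (- Ci * l)%C).
{ eapply cderive_eq; [exact (cderive_mult _ _ _ _ _ (cderive_const _ _) H)|]. cbv beta. ring. }
apply path_derive_Re in H'.
replace (Im (l * d)) with (Re (- Ci * l * d)) by (destruct l, d; simpl; ring).
eapply is_derive_ext; [|exact H'].
intros s. simpl. destruct (f _); simpl; ring.
Qed.

Lemma decreasing_from_derive (f f' : R -> R) (a b : R) :
  a <= b -> (forall t, a <= t <= b -> is_derive f t (f' t)) ->
  (forall t, a <= t <= b -> f' t <= 0) -> f b <= f a.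
Proof.
intros Hab Hf Hn.
destruct (MVT_gen f a b f') as [c [Hc E]].
- rewrite Rmin_left, Rmax_right by easy. intros x Hx. apply Hf; lra.
- rewrite Rmin_left, Rmax_right by easy. intros x Hx.
  apply continuity_pt_filterlim. apply (ex_derive_continuous f x). exists (f' x). now apply Hf.
- rewrite Rmin_left, Rmax_right in Hc by easy.
  specialize (Hn c Hc). nra.
Qed.

(** Complex-valued functions have no mean value theorem, so everything is projected on the chord
    [D = f 1 - f 0]: [Re (conj D f) - |D| m] is nonincreasing. The derivative of the majorant [m]
    may vary along the path, which later yields exact bounds by [exp], [sinh], [ln] and real power
    series. *)
Lemma mean_value_inequality_path (f f' : R -> C) (m m' : R -> R) :
  (forall t : R, 0 <= t <= 1 -> is_derive (fun s => Re (f s)) t (Re (f' t))) ->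
  (forall t : R, 0 <= t <= 1 -> is_derive (fun s => Im (f s)) t (Im (f' t))) ->
  (forall t : R, 0 <= t <= 1 -> is_derive m t (m' t)) ->
  (forall t : R, 0 <= t <= 1 -> Cmod (f' t) <= m' t) ->
  Cmod (f 1 - f 0) <= m 1 - m 0.
Proof.
intros HR HI Hm Hle. set (D := (f 1 - f 0)%C).
assert (M : m 0 <= m 1).
{ assert (T : - m 1 <= - m 0); [|lra].
  apply (decreasing_from_derive (fun t => - m t) (fun t => - m' t)); [lra| |].
  - intros t Ht. exact (is_derive_opp _ _ _ (Hm t Ht)).
  - intros t Ht. pose proof (Hle t Ht). pose proof (Cmod_ge_0 (f' t)). lra. }
destruct (Req_dec (Cmod D) 0) as [Z | Z]; [lra|].
assert (P : 0 < Cmod D) by (pose proof (Cmod_ge_0 D); lra).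
assert (K : Re D * Re (f 1) + Im D * Im (f 1) - Cmod D * m 1 <=
            Re D * Re (f 0) + Im D * Im (f 0) - Cmod D * m 0).
{ apply (decreasing_from_derive
    (fun t => Re D * Re (f t) + Im D * Im (f t) - Cmod D * m t)
    (fun t => Re D * Re (f' t) + Im D * Im (f' t) - Cmod D * m' t)); [lra| |].
  - intros t Ht. apply (is_derive_minus (V := R_NormedModule)).
    + apply (is_derive_plus (V := R_NormedModule)); apply is_derive_scal; auto.
    + apply is_derive_scal. now apply Hm.
  - intros t Ht. pose proof (Hle t Ht) as B.
    pose proof (re_le_Cmod (Cconj D * f' t)) as B'.
    rewrite Cmod_mult, Cmod_conj in B'.
    apply Rabs_le_between in B'.
    assert (Cmod D * Cmod (f' t) <= Cmod D * m' t) by (apply Rmult_le_compat_l; lra).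
    replace (Re (Cconj D * f' t)) with (Re D * Re (f' t) + Im D * Im (f' t)) in B'
      by (destruct D, (f' t); simpl; ring).
    lra. }
assert (E : Re D * Re (f 1) + Im D * Im (f 1) - (Re D * Re (f 0) + Im D * Im (f 0)) = Cmod D ^ 2).
{ rewrite Cmod2_alt. unfold D. destruct (f 1), (f 0); simpl; ring. }
apply Rmult_le_reg_l with (Cmod D); [easy|]. nra.
Qed.

Lemma mean_value_inequality (f f' : C -> C) (m m' : R -> R) (z d : C) :
  (forall t : R, 0 <= t <= 1 -> is_cderive f (z + t * d)%C (f' (z + t * d)%C)) ->
  (forall t : R, 0 <= t <= 1 -> is_derive m t (m' t)) ->
  (forall t : R, 0 <= t <= 1 -> Cmod (f' (z + t * d)%C * d) <= m' t) ->
  Cmod (f (z + d)%C - f z) <= m 1 - m 0.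
Proof.
intros Hf Hm Hle.
pose proof (mean_value_inequality_path (fun t => f (z + t * d)%C)
  (fun t => f' (z + t * d)%C * d)%C m m') as K. cbv beta in K.
replace (z + 1 * d)%C with (z + d)%C in K by ring.
replace (z + 0 * d)%C with z in K by ring.
apply K; auto; intros t Ht.
- apply path_derive_Re. auto.
- apply path_derive_Im. auto.
Qed.

Lemma cderive_zero_const (f : C -> C) (z d : C) :
  (forall t : R, 0 <= t <= 1 -> is_cderive f (z + t * d)%C 0%C) -> f (z + d)%C = f z.
Proof.
intros H.
assert (B := mean_value_inequality f (fun _ => 0%C) (fun _ => 0) (fun _ => 0) z d H).
apply Ceq_minus, Cmod_eq_0. apply Rle_antisym; [|apply Cmod_ge_0].
rewrite Rminus_0_r in B. apply B.
- intros t _. exact (is_derive_const _ _).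
- intros t _. rewrite Cmult_0_l, Cmod_0. lra.
Qed.

(** * Complex exponential and logarithm *)

Definition cexp (z : C) : C := (exp (Re z) * cos (Im z), exp (Re z) * sin (Im z)).

Lemma cexp_plus (a b : C) : cexp (a + b) = (cexp a * cexp b)%C.
Proof.
destruct a as [a1 a2], b as [b1 b2]. unfold cexp, Cmult, Cplus; simpl.
rewrite exp_plus, cos_plus, sin_plus. f_equal; ring.
Qed.

Lemma cexp_0 : cexp 0%C = 1%C.
Proof. unfold cexp; simpl. rewrite exp_0, cos_0, sin_0. unfold RtoC. f_equal; ring. Qed.

Lemma Cmod_cexp (z : C) : Cmod (cexp z) = exp (Re z).
Proof.
pose proof (exp_pos (Re z)) as P.
apply Rsqr_inj; [apply Cmod_ge_0 | lra |].
rewrite !Rsqr_pow2, Cmod2_alt. unfold cexp; simpl.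
pose proof (sin2_cos2 (Im z)) as Q. unfold Rsqr in Q.
transitivity (exp (Re z) ^ 2 * (sin (Im z) * sin (Im z) + cos (Im z) * cos (Im z))); [simpl; ring|].
rewrite Q. simpl; ring.
Qed.

Lemma cexp_neq_0 (z : C) : cexp z <> 0%C.
Proof. apply Cmod_gt_0. rewrite Cmod_cexp. apply exp_pos. Qed.

Lemma cexp_opp (z : C) : cexp (- z) = (/ cexp z)%C.
Proof.
assert (E : (cexp (- z) * cexp z)%C = 1%C).
{ rewrite <- cexp_plus. replace (- z + z)%C with (RtoC 0) by ring. apply cexp_0. }
replace (cexp (- z)) with ((cexp (- z) * cexp z) / cexp z)%C by (field; apply cexp_neq_0).
rewrite E. field. apply cexp_neq_0.
Qed.

(** Derivatives along rays come from real calculus on the coordinates; the complex differentiability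
    of [cexp] is deduced from them afterwards. *)
Lemma cexp_path (d : C) (t : R) :
  is_derive (fun s : R => Re (cexp (s * d))) t (Re (d * cexp (t * d))) /\
  is_derive (fun s : R => Im (cexp (s * d))) t (Im (d * cexp (t * d))).
Proof.
destruct d as [x y]; unfold cexp; simpl. split; auto_derive; auto; unfold Rminus; ring.
Qed.

Lemma Re_le_Cmod (z : C) : Re z <= Cmod z.
Proof. pose proof (re_le_Cmod z) as H. apply Rabs_le_between in H. lra. Qed.

Lemma cexp_le (d : C) (t : R) : 0 <= t -> Cmod (cexp (t * d)) <= exp (t * Cmod d).
Proof.
intros Ht. rewrite Cmod_cexp. rewrite re_scal_l.
assert (t * Re d <= t * Cmod d) by (apply Rmult_le_compat_l; [easy | apply Re_le_Cmod]).
destruct (Rle_lt_or_eq_dec _ _ H) as [L | E]; [left; now apply exp_increasing | rewrite E; lra].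
Qed.

Lemma cexp_sub_1_le (d : C) (t : R) : 0 <= t -> Cmod (cexp (t * d) - 1) <= exp (t * Cmod d) - 1.
Proof.
intros Ht.
pose proof (mean_value_inequality_path (fun s => cexp (s * (t * d)))
  (fun s => (t * d) * cexp (s * (t * d)))%C (fun s => exp (s * (t * Cmod d)))
  (fun s => t * Cmod d * exp (s * (t * Cmod d)))) as K. cbv beta in K.
rewrite Cmult_1_l, Cmult_0_l, cexp_0, Rmult_1_l, Rmult_0_l, exp_0 in K.
apply K; intros s Hs.
- apply cexp_path.
- apply cexp_path.
- auto_derive; auto. ring.
- rewrite Cmod_mult. rewrite Cmod_mult, Cmod_R, Rabs_pos_eq by easy.
  apply Rmult_le_compat_l; [apply Rmult_le_pos; [easy | apply Cmod_ge_0]|].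
  rewrite Cmult_assoc, <- RtoC_mult, <- Rmult_assoc. apply cexp_le. nra.
Qed.

(** The mean value inequality along [s h] turns the bound for one exponential remainder into the
    next: each is dominated by the same remainder of the real [exp] at [|h|]. The differentiability
    of [cexp] thus reduces to that of [exp] at 0. *)
Lemma cexp_sub_1_sub_le (h : C) : Cmod (cexp h - 1 - h) <= exp (Cmod h) - 1 - Cmod h.
Proof.
pose proof (mean_value_inequality_path (fun s => cexp (s * h) - 1 - s * h)%C
  (fun s => h * (cexp (s * h) - 1))%C (fun s => exp (s * Cmod h) - 1 - s * Cmod h)
  (fun s => Cmod h * (exp (s * Cmod h) - 1))) as K. cbv beta in K.
rewrite Cmult_1_l, Cmult_0_l, cexp_0, Rmult_1_l, Rmult_0_l, exp_0 in K.
replace (1 - 1 - 0)%C with (RtoC 0) in K by ring.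
replace (cexp h - 1 - h - 0)%C with (cexp h - 1 - h)%C in K by ring.
replace (1 - 1 - 0) with 0 in K by ring. rewrite Rminus_0_r in K.
apply K; intros s Hs.
- destruct (cexp_path h s) as [H _].
  apply is_derive_ext with (fun s : R => Re (cexp (s * h)) - (1 + s * Re h)).
  { intros r. destruct h; simpl. ring. }
  replace (Re (h * (cexp (s * h) - 1))) with (Re (h * cexp (s * h)) - Re h)
    by (destruct h, (cexp _); simpl; ring).
  apply (is_derive_minus (V := R_NormedModule)); [exact H|]. auto_derive; auto. ring.
- destruct (cexp_path h s) as [_ H].
  apply is_derive_ext with (fun s : R => Im (cexp (s * h)) - s * Im h).
  { intros r. destruct h; simpl. ring. }
  replace (Im (h * (cexp (s * h) - 1))) with (Im (h * cexp (s * h)) - Im h)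
    by (destruct h, (cexp _); simpl; ring).
  apply (is_derive_minus (V := R_NormedModule)); [exact H|]. auto_derive; auto. ring.
- auto_derive; auto. ring.
- rewrite Cmod_mult. apply Rmult_le_compat_l; [apply Cmod_ge_0|]. apply cexp_sub_1_le; easy.
Qed.

Lemma cderive_cexp (z : C) : is_cderive cexp z (cexp z).
Proof.
rewrite is_cderiveP. intros eps Heps.
pose proof (exp_pos (Re z)) as P.
assert (He : is_derive exp 0 (exp 0)) by apply is_derive_exp. rewrite exp_0 in He.
rewrite is_deriveP in He.
destruct (He (eps / exp (Re z))) as [d [Hd H]]; [now apply Rdiv_lt_0_compat|].
exists d; split; [easy|]. intros h Hh.
rewrite cexp_plus.
replace (cexp z * cexp h - cexp z - h * cexp z)%C with (cexp z * (cexp h - 1 - h))%C by ring.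
rewrite Cmod_mult, Cmod_cexp.
pose proof (Cmod_ge_0 h) as Hp.
specialize (H (Cmod h)). rewrite Rabs_pos_eq in H by easy. specialize (H Hh).
rewrite exp_0, Rplus_0_l, Rmult_1_r in H.
pose proof (cexp_sub_1_sub_le h) as B.
apply Rabs_le_between in H.
replace (eps * Cmod h) with (exp (Re z) * (eps / exp (Re z) * Cmod h)) by (field; lra).
apply Rmult_le_compat_l; lra.
Qed.

(** * Principal logarithm on the right half-plane *)

Definition clog (z : C) : C := (ln (Cmod z), Arg z).

Lemma cexp_clog (z : C) : z <> 0%C -> cexp (clog z) = z.
Proof.
intros Hz. destruct (Arg_spec z Hz) as [_ E]. unfold cexp, clog; simpl.
rewrite exp_ln by now apply Cmod_gt_0. now rewrite <- E.
Qed.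

(** On the right half-plane the case distinction in [Arg] disappears, and the continuity of [clog]
    can be read off from that of [atan]. *)
Lemma Arg_atan (z : C) : 0 < Re z -> Arg z = atan (Im z / Re z).
Proof.
intros Hz.
assert (Hz0 : z <> 0%C). { intros ->. simpl in Hz. lra. }
destruct (Arg_spec z Hz0) as [[H1 H2] E].
assert (Hm : 0 < Cmod z) by now apply Cmod_gt_0.
assert (Er : Re z = Cmod z * cos (Arg z)) by now rewrite E at 1.
assert (Ei : Im z = Cmod z * sin (Arg z)) by now rewrite E at 1.
assert (Hc : 0 < cos (Arg z)) by nra.
assert (HA : - PI / 2 < Arg z < PI / 2).
{ pose proof PI_RGT_0. split; apply Rnot_le_lt; intros L.
  - assert (cos (Arg z) <= 0); [|lra]. rewrite <- cos_neg. apply cos_le_0; lra.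
  - assert (cos (Arg z) <= 0); [|lra]. apply cos_le_0; lra. }
rewrite <- (atan_tan (Arg z)) by lra. f_equal. unfold tan.
rewrite Er, Ei. field. lra.
Qed.

Lemma Arg_bound (z : C) : 0 < Re z -> - PI / 2 < Arg z < PI / 2.
Proof. intros Hz. rewrite Arg_atan by easy. apply atan_bound. Qed.

Lemma clog_1 : clog 1%C = 0%C.
Proof.
unfold clog. rewrite Cmod_1, ln_1, Arg_atan by (simpl; lra). simpl.
unfold Rdiv. rewrite Rmult_0_l, atan_0. reflexivity.
Qed.

Lemma Re_cexp_pos (l : C) : - PI / 2 < Im l < PI / 2 -> 0 < Re (cexp l).
Proof.
intros H. unfold cexp; simpl. apply Rmult_lt_0_compat; [apply exp_pos|]. apply cos_gt_0; lra.
Qed.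

Lemma clog_cexp (l : C) : - PI / 2 < Im l < PI / 2 -> clog (cexp l) = l.
Proof.
intros H. unfold clog. rewrite Cmod_cexp, ln_exp, Arg_atan by now apply Re_cexp_pos.
unfold cexp; simpl.
replace (exp (Re l) * sin (Im l) / (exp (Re l) * cos (Im l))) with (tan (Im l)).
2:{ unfold tan. assert (0 < cos (Im l)) by (apply cos_gt_0; lra).
    pose proof (exp_pos (Re l)). field. lra. }
rewrite atan_tan by lra. now destruct l.
Qed.

Lemma continuous_eps (f : R -> R) (x : R) : continuity_pt f x ->
  forall eps, 0 < eps -> exists d, 0 < d /\ forall y, Rabs (y - x) < d -> Rabs (f y - f x) < eps.
Proof.
intros H eps Heps. destruct (H eps Heps) as [d [Hd K]]. exists d; split; [easy|].
intros y Hy. destruct (Req_dec x y) as [<- | N].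
- rewrite Rminus_diag, Rabs_R0. easy.
- apply K. repeat split; easy.
Qed.

Lemma Cmod_le_Rabs (z : C) : Cmod z <= Rabs (Re z) + Rabs (Im z).
Proof.
pose proof (Rabs_pos (Re z)). pose proof (Rabs_pos (Im z)).
apply Rsqr_incr_0; [|apply Cmod_ge_0|lra].
rewrite !Rsqr_pow2, Cmod2_alt, <- (pow2_abs (Re z)), <- (pow2_abs (Im z)). nra.
Qed.

Lemma ccont_clog (z : C) : 0 < Re z -> ccont clog z.
Proof.
intros Hz eps Heps.
assert (Hm : 0 < Cmod z). { pose proof (Re_le_Cmod z). lra. }
assert (C1 : continuity_pt ln (Cmod z)).
{ apply derivable_continuous_pt. exists (/ Cmod z). now apply derivable_pt_lim_ln. }
destruct (continuous_eps _ _ C1 (eps / 2)) as [d1 [Hd1 K1]]; [lra|].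
assert (C2 : continuity_pt atan (Im z / Re z)).
{ apply derivable_continuous_pt, derivable_pt_atan. }
destruct (continuous_eps _ _ C2 (eps / 2)) as [d2 [Hd2 K2]]; [lra|].
(* For [z = x + iy]: |(y+k)/(x+h) - y/x| = |kx - hy| / (x (x+h)) <= 4 |z| |h + ik| / x^2. *)
set (d3 := d2 * (Re z * Re z) / (4 * Cmod z)).
assert (Hd3 : 0 < d3). { apply Rdiv_lt_0_compat; [|lra]. apply Rmult_lt_0_compat; nra. }
exists (Rmin d1 (Rmin (Re z / 2) d3)); split.
{ repeat apply Rmin_pos; lra. }
intros h Hh.
assert (Hh1 := Rlt_le_trans _ _ _ Hh (Rmin_l _ _)).
assert (Hh' := Rlt_le_trans _ _ _ Hh (Rmin_r _ _)).
assert (Hh2 := Rlt_le_trans _ _ _ Hh' (Rmin_l _ _)).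
assert (Hh3 := Rlt_le_trans _ _ _ Hh' (Rmin_r _ _)).
pose proof (re_le_Cmod h) as R1. pose proof (Im_le_Cmod h) as I1.
pose proof (Rabs_def2 _ _ (Rle_lt_trans _ _ _ R1 Hh2)) as R2.
assert (Rp : Re z / 2 < Re (z + h)) by (rewrite re_plus; lra).
eapply Rle_lt_trans; [apply Cmod_le_Rabs|].
change (Re (clog (z + h) - clog z)) with (ln (Cmod (z + h)) - ln (Cmod z)).
change (Im (clog (z + h) - clog z)) with (Arg (z + h) - Arg z).
rewrite !Arg_atan by lra.
replace eps with (eps / 2 + eps / 2) by field.
apply Rplus_lt_compat.
- apply K1. eapply Rle_lt_trans; [|exact Hh1].
  apply Rabs_le_between. split.
  + pose proof (Cmod_minus_rev z (- h)) as T. rewrite Cmod_opp in T.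
    replace (z - - h)%C with (z + h)%C in T by ring. lra.
  + pose proof (Cmod_triangle z h). lra.
- apply K2. rewrite re_plus, im_plus. rewrite re_plus in Rp.
  replace ((Im z + Im h) / (Re z + Re h) - Im z / Re z)
    with ((Im h * Re z - Re h * Im z) / (Re z * (Re z + Re h))) by (field; lra).
  unfold Rdiv. rewrite Rabs_mult. rewrite (Rabs_pos_eq (/ _)).
  2:{ left. apply Rinv_0_lt_compat. nra. }
  apply Rlt_div_l; [nra|].
  assert (N : Rabs (Im h * Re z - Re h * Im z) <= 2 * (Cmod h * Cmod z)).
  { eapply Rle_trans; [apply Rabs_triang|]. rewrite Rabs_Ropp, !Rabs_mult.
    pose proof (re_le_Cmod z). pose proof (Im_le_Cmod z).
    assert (Rabs (Im h) * Rabs (Re z) <= Cmod h * Cmod z)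
      by (apply Rmult_le_compat; auto using Rabs_pos).
    assert (Rabs (Re h) * Rabs (Im z) <= Cmod h * Cmod z)
      by (apply Rmult_le_compat; auto using Rabs_pos).
    lra. }
  eapply Rle_lt_trans; [apply N|].
  assert (Q : Cmod h * (4 * Cmod z) < d2 * (Re z * Re z)).
  { apply Rlt_div_r; [lra|]. exact Hh3. }
  assert (d2 * (Re z * (Re z / 2)) <= d2 * (Re z * (Re z + Re h))).
  { apply Rmult_le_compat_l; [lra|]. apply Rmult_le_compat_l; lra. }
  nra.
Qed.

Lemma cderive_clog (z : C) : 0 < Re z -> is_cderive clog z (/ z)%C.
Proof.
intros Hz.
assert (Hz0 : z <> 0%C). { intros ->. simpl in Hz. lra. }
(* The disk of radius [Re z] about [z] avoids 0, which is all that [cexp_clog] asks. *)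
eapply (cderive_inverse cexp clog z z (Re z)); auto.
- intros w Hw. apply cexp_clog. intros ->. rewrite Cmod_minus_sym in Hw.
  replace (z - 0)%C with z in Hw by ring. pose proof (Re_le_Cmod z). lra.
- now apply ccont_clog.
- rewrite <- (cexp_clog z Hz0) at 2. apply cderive_cexp.
Qed.

(** * Holomorphic functions and the maximum principle *)

(** Differentiability [n] times, with unspecified derivatives, instead of analyticity: the maximum
    principle uses two derivatives, and products, quotients, exponentials and logarithms stay in the
    class by the rules of differentiation, without any power series. *)
Fixpoint holo (n : nat) (D : C -> Prop) (F : C -> C) : Prop :=
  match n with
  | O => True
  | S m => exists F' : C -> C, (forall z, D z -> is_cderive F z (F' z)) /\ holo m D F'
  end.

Lemma holo_weaken (n : nat) (D : C -> Prop) (F : C -> C) : holo (S n) D F -> holo n D F.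
Proof.
revert F. induction n as [|n IH]; [easy|]. intros F [F' [H H']].
exists F'; split; [easy|]. now apply IH.
Qed.

Lemma holo_subset (n : nat) (D D' : C -> Prop) (F : C -> C) :
  (forall z, D' z -> D z) -> holo n D F -> holo n D' F.
Proof.
intros HD. revert F. induction n as [|n IH]; [easy|]. intros F [F' [H H']].
exists F'; split; auto.
Qed.

Lemma holo_const (n : nat) (D : C -> Prop) (c : C) : holo n D (fun _ => c).
Proof.
revert c. induction n as [|n IH]; [easy|]. intros c.
exists (fun _ => 0%C); split; [|apply IH]. intros z _. apply cderive_const.
Qed.

Lemma holo_id (n : nat) (D : C -> Prop) : holo n D (fun z => z).
Proof.
destruct n as [|n]; [easy|].
exists (fun _ => 1%C); split; [|apply holo_const]. intros z _. apply cderive_id.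
Qed.

Lemma holo_plus (n : nat) (D : C -> Prop) (F G : C -> C) :
  holo n D F -> holo n D G -> holo n D (fun z => F z + G z)%C.
Proof.
revert F G. induction n as [|n IH]; [easy|]. intros F G [F' [HF HF']] [G' [HG HG']].
exists (fun z => F' z + G' z)%C; split; [|now apply IH].
intros z Hz. apply cderive_plus; auto.
Qed.

Lemma holo_opp (n : nat) (D : C -> Prop) (F : C -> C) :
  holo n D F -> holo n D (fun z => - F z)%C.
Proof.
revert F. induction n as [|n IH]; [easy|]. intros F [F' [HF HF']].
exists (fun z => - F' z)%C; split; [|now apply IH].
intros z Hz. apply cderive_opp; auto.
Qed.

Lemma holo_minus (n : nat) (D : C -> Prop) (F G : C -> C) :
  holo n D F -> holo n D G -> holo n D (fun z => F z - G z)%C.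
Proof. intros HF HG. apply holo_plus; [easy|]. now apply holo_opp. Qed.

Lemma holo_mult (n : nat) (D : C -> Prop) (F G : C -> C) :
  holo n D F -> holo n D G -> holo n D (fun z => F z * G z)%C.
Proof.
revert F G. induction n as [|n IH]; [easy|]. intros F G HF HG.
pose proof (holo_weaken _ _ _ HF) as WF. pose proof (holo_weaken _ _ _ HG) as WG.
destruct HF as [F' [HF HF']], HG as [G' [HG HG']].
exists (fun z => F' z * G z + F z * G' z)%C; split.
- intros z Hz. apply cderive_mult; auto.
- apply holo_plus; apply IH; assumption.
Qed.

Lemma holo_pow (n k : nat) (D : C -> Prop) (F : C -> C) :
  holo n D F -> holo n D (fun z => F z ^ k)%C.
Proof.
intros H. induction k as [|k IH]; [exact (holo_const n D 1%C)|]. exact (holo_mult n D F _ H IH).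
Qed.

Lemma holo_inv (n : nat) (D : C -> Prop) (F : C -> C) :
  (forall z, D z -> F z <> 0%C) -> holo n D F -> holo n D (fun z => / F z)%C.
Proof.
intros Hn. induction n as [|n IH]; [easy|]. intros HF.
pose proof (IH (holo_weaken _ _ _ HF)) as WI.
destruct HF as [F' [HF HF']].
exists (fun z => - F' z * (/ F z * / F z))%C; split.
- intros z Hz. apply cderive_inv; auto.
- apply holo_mult; [now apply holo_opp | now apply holo_mult].
Qed.

Lemma holo_div (n : nat) (D : C -> Prop) (F G : C -> C) :
  (forall z, D z -> G z <> 0%C) -> holo n D F -> holo n D G ->
  holo n D (fun z => F z / G z)%C.
Proof. intros Hn HF HG. apply holo_mult; [easy|]. now apply holo_inv. Qed.

Lemma holo_cexp (n : nat) (D : C -> Prop) (F : C -> C) :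
  holo n D F -> holo n D (fun z => cexp (F z)).
Proof.
induction n as [|n IH]; [easy|]. intros HF.
pose proof (IH (holo_weaken _ _ _ HF)) as WI.
destruct HF as [F' [HF HF']].
exists (fun z => F' z * cexp (F z))%C; split.
- intros z Hz. apply cderive_comp; [apply cderive_cexp | auto].
- now apply holo_mult.
Qed.

Lemma holo_clog (n : nat) (D : C -> Prop) (F : C -> C) :
  (forall z, D z -> 0 < Re (F z)) -> holo n D F -> holo n D (fun z => clog (F z)).
Proof.
intros Hp. destruct n as [|n]; [easy|]. intros HF.
pose proof (holo_weaken _ _ _ HF) as WF.
destruct HF as [F' [HF HF']].
exists (fun z => F' z * / F z)%C; split.
- intros z Hz. apply cderive_comp; [apply cderive_clog; auto | auto].
- apply holo_mult; [easy|]. apply holo_inv; [|easy].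
  intros z Hz E. specialize (Hp z Hz). rewrite E in Hp. simpl in Hp. lra.
Qed.

Lemma holo_cont (D : C -> Prop) (F : C -> C) (z : C) : holo 1 D F -> D z -> ccont F z.
Proof. intros [F' [H _]] Hz. exact (cderive_cont _ _ _ (H z Hz)). Qed.

(** * Maxima of continuous functions on a closed disk *)

Definition rcont (u : C -> R) (z : C) : Prop :=
  forall eps : R, 0 < eps -> exists delta : R, 0 < delta /\
    forall w : C, Cmod (w - z) < delta -> Rabs (u w - u z) < eps.

(** The number [d] attached to a point serves both as a radius and as the bound [/ d]. Compactness
    of the square places every point near a tagged one whose [d] exceeds a common positive number,
    and its inverse bounds [u]. Points outside the disk receive radii so small that their condition
    is void. *)
Lemma closed_disk_bounded (u : C -> R) (rho : R) :
  (forall z, Cmod z <= rho -> rcont u z) ->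
  exists M : R, forall z, Cmod z <= rho -> u z <= M.
Proof.
intros Hu.
assert (Hd : forall z : C, exists d : posreal,
  forall w, Cmod (w - z) < 2 * d -> Cmod w <= rho -> u w <= / d).
{ intros z. destruct (Rle_lt_dec (Cmod z) rho) as [Hz | Hz].
  - destruct (Hu z Hz 1 Rlt_0_1) as [e [He H]].
    pose proof (Rabs_pos (u z)) as P.
    assert (P1 : 0 < / (Rabs (u z) + 1)) by (apply Rinv_0_lt_compat; lra).
    assert (Q : 0 < Rmin (e / 2) (/ (Rabs (u z) + 1))) by (apply Rmin_pos; lra).
    exists (mkposreal _ Q). intros w Hw _. simpl in *.
    assert (B := H w). specialize (B ltac:(pose proof (Rmin_l (e / 2) (/ (Rabs (u z) + 1))); lra)).
    apply Rabs_def2 in B.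
    assert (u w <= Rabs (u z) + 1) by (pose proof (Rle_abs (u z)); lra).
    eapply Rle_trans; [eassumption|].
    rewrite <- (Rinv_inv (Rabs (u z) + 1)) at 1. apply Rinv_le_contravar; [exact Q | apply Rmin_r].
  - assert (Q : 0 < (Cmod z - rho) / 2) by lra.
    exists (mkposreal _ Q). intros w Hw Hw'. simpl in *.
    pose proof (Cmod_minus_rev z w). rewrite Cmod_minus_sym in Hw. lra. }
destruct (functional_choice (fun z d => forall w, Cmod (w - z) < 2 * pos d -> Cmod w <= rho -> u w <= / d) Hd) as [dl Hdl].
destruct (compactness_value_2d (- rho) rho (- rho) rho (fun x y => dl (x, y))) as [d H].
exists (/ d). intros [x y] Hz. apply Rnot_lt_le. intros C0.
apply (H x y).
- pose proof (re_le_Cmod (x, y)) as B. simpl in B. apply Rabs_le_between. lra.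
- pose proof (Im_le_Cmod (x, y)) as B. simpl in B. apply Rabs_le_between. lra.
- intros (a & b & _ & _ & Ha & Hb & Hab).
  apply Rlt_not_le in C0. apply C0.
  apply Rle_trans with (/ dl (a, b)).
  + apply (Hdl (a, b) (x, y)); [|easy].
    eapply Rle_lt_trans; [apply Cmod_le_Rabs|]. simpl.
    unfold Rminus in Ha, Hb. lra.
  + apply Rinv_le_contravar; [apply cond_pos | easy].
Qed.

Lemma closed_disk_max (u : C -> R) (rho : R) : 0 <= rho ->
  (forall z, Cmod z <= rho -> rcont u z) ->
  exists z0, Cmod z0 <= rho /\ forall z, Cmod z <= rho -> u z <= u z0.
Proof.
intros Hrho Hu.
destruct (closed_disk_bounded u rho Hu) as [M0 HM0].
destruct (completeness (fun x => exists z, Cmod z <= rho /\ x = u z)) as [M [Hub Hlub]].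
{ exists M0. intros x [z [Hz ->]]. auto. }
{ exists (u 0%C), 0%C. rewrite Cmod_0. auto. }
destruct (classic (exists z0, Cmod z0 <= rho /\ u z0 = M)) as [[z0 [H0 E]] | N].
{ exists z0; split; [easy|]. intros z Hz. rewrite E. apply Hub. now exists z. }
exfalso.
assert (L : forall z, Cmod z <= rho -> u z < M).
{ intros z Hz. destruct (Rle_lt_or_eq_dec (u z) M) as [A | A]; [|easy|].
  - apply Hub. now exists z.
  - exfalso. apply N. now exists z. }
(* If the supremum is not attained, [1 / (M - u)] is continuous, and a bound [B] for it keeps [u]
   below [M - 1 / B], against the choice of [M]. *)
destruct (closed_disk_bounded (fun z => / (M - u z)) rho) as [B HB].
{ intros z Hz eps Heps. specialize (L z Hz) as Lz. set (a := M - u z).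
  assert (Ha : 0 < a) by (unfold a; lra).
  destruct (Hu z Hz (Rmin (a / 2) (eps * (a * a) / 2))) as [d [Hd K]].
  { apply Rmin_pos; [lra|]. assert (0 < a * a) by nra. nra. }
  exists d; split; [easy|]. intros w Hw. specialize (K w Hw).
  assert (K1 := Rlt_le_trans _ _ _ K (Rmin_l _ _)).
  assert (K2 := Rlt_le_trans _ _ _ K (Rmin_r _ _)).
  pose proof (Rabs_def2 _ _ K1) as K3.
  assert (Hb : a / 2 < M - u w) by (unfold a in *; lra).
  replace (/ (M - u w) - / a) with ((u w - u z) / ((M - u w) * a))
    by (unfold a in *; field; lra).
  unfold Rdiv. rewrite Rabs_mult, (Rabs_pos_eq (/ _)) by (left; apply Rinv_0_lt_compat; nra).
  apply Rlt_div_l; [nra|]. eapply Rlt_le_trans; [apply K2|].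
  assert (a / 2 * a <= (M - u w) * a) by nra. nra. }
assert (HB0 : 0 < B).
{ eapply Rlt_le_trans; [|apply (HB 0%C); rewrite Cmod_0; easy].
  apply Rinv_0_lt_compat. assert (u 0%C < M) by (apply L; rewrite Cmod_0; easy). lra. }
assert (M <= M - / B).
{ apply Hlub. intros x [z [Hz ->]]. specialize (L z Hz). specialize (HB z Hz).
  assert (/ B <= M - u z).
  { rewrite <- (Rinv_inv (M - u z)). apply Rinv_le_contravar; [|easy].
    apply Rinv_0_lt_compat. lra. }
  lra. }
assert (0 < / B) by now apply Rinv_0_lt_compat. lra.
Qed.

(** The sign of [f' 0] selects the side: if [l > 0], moving to the right when [f' 0 >= 0] and to the
    left otherwise raises [f] by at least [l / 4 * t^2]. *)
Lemma second_derivative_max (f f' : R -> R) (l r : R) : 0 < r ->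
  (forall t, Rabs t < r -> is_derive f t (f' t)) -> is_derive f' 0 l ->
  (forall t, Rabs t < r -> f t <= f 0) -> l <= 0.
Proof.
intros Hr Hf Hf' Hmax. apply Rnot_lt_le. intros Hl.
rewrite is_deriveP in Hf'. destruct (Hf' (l / 2)) as [d [Hd H]]; [lra|].
set (t := Rmin d r / 2).
assert (Ht : 0 < t) by (unfold t; pose proof (Rmin_pos _ _ Hd Hr); lra).
assert (Ht1 : t < d) by (unfold t in *; pose proof (Rmin_l d r); lra).
assert (Ht2 : t < r) by (unfold t in *; pose proof (Rmin_r d r); lra).
assert (B : forall s, Rabs s <= t -> Rabs (f' s - f' 0 - s * l) <= l / 2 * Rabs s).
{ intros s Hs. specialize (H s). rewrite Rplus_0_l in H. apply H. lra. }
destruct (Rle_lt_dec 0 (f' 0)) as [S0 | S0].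
- assert (K : l / 4 * t ^ 2 - f t <= l / 4 * 0 ^ 2 - f 0).
  { apply (decreasing_from_derive (fun s => l / 4 * s ^ 2 - f s) (fun s => l / 2 * s - f' s)); [lra| |].
    - intros s Hs. apply (is_derive_minus (V := R_NormedModule)).
      + auto_derive; auto. field.
      + apply Hf. rewrite Rabs_pos_eq; lra.
    - intros s Hs. specialize (B s). rewrite Rabs_pos_eq in B by lra.
      specialize (B ltac:(lra)). apply Rabs_le_between in B. lra. }
  specialize (Hmax t). rewrite Rabs_pos_eq in Hmax by lra. specialize (Hmax Ht2).
  assert (0 < t ^ 2) by now apply pow_lt. nra.
- assert (K : f 0 - l / 4 * 0 ^ 2 <= f (- t) - l / 4 * (- t) ^ 2).
  { apply (decreasing_from_derive (fun s => f s - l / 4 * s ^ 2) (fun s => f' s - l / 2 * s)); [lra| |].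
    - intros s Hs. apply (is_derive_minus (V := R_NormedModule)).
      + apply Hf. rewrite Rabs_left1; lra.
      + auto_derive; auto. field.
    - intros s Hs. specialize (B s). rewrite Rabs_left1 in B by lra.
      specialize (B ltac:(lra)). apply Rabs_le_between in B. lra. }
  specialize (Hmax (- t)). rewrite Rabs_Ropp, Rabs_pos_eq in Hmax by lra. specialize (Hmax Ht2).
  assert (0 < t ^ 2) by now apply pow_lt. nra.
Qed.

Lemma is_derive_eq (f : R -> R) (x l l' : R) : is_derive f x l -> l = l' -> is_derive f x l'.
Proof. now intros H <-. Qed.

Lemma is_derive_prod (f g : R -> R) (x df dg : R) :
  is_derive f x df -> is_derive g x dg ->
  is_derive (fun t => f t * g t) x (df * g x + f x * dg).
Proof. intros Hf Hg. exact (is_derive_mult f g x df dg Hf Hg Rmult_comm). Qed.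

(** Half the second derivative of [|F|^2 + eps |z|^2] at a maximum, in the unit direction [d]. Only
    the middle term depends on [d], and it changes sign from [d = 1] to [d = i]: adding these two
    directions produces the Laplacian. *)
Lemma second_variation_max (F F' : C -> C) (F2 z d : C) (eps r : R) :
  0 < r -> Cmod d = 1 ->
  (forall w, Cmod (w - z) < r -> is_cderive F w (F' w)) -> is_cderive F' z F2 ->
  (forall w, Cmod (w - z) < r ->
     Cmod (F w) ^ 2 + eps * Cmod w ^ 2 <= Cmod (F z) ^ 2 + eps * Cmod z ^ 2) ->
  Cmod (F' z) ^ 2 + Re (Cconj (F z) * F2 * (d * d)) + eps <= 0.
Proof.
intros Hr Hd HF HF' Hmax.
assert (Pt : forall t : R, Cmod (z + t * d - z) = Rabs t).
{ intros t. replace (z + t * d - z)%C with (t * d)%C by ring.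
  rewrite Cmod_mult, Hd, Cmod_R. ring. }
assert (Z0 : (z + 0 * d)%C = z) by ring.
assert (K : 2 * (Cmod (F' z) ^ 2 + Re (Cconj (F z) * F2 * (d * d)) + eps) <= 0); [|lra].
apply (second_derivative_max
  (fun t => Re (F (z + t * d)%C) * Re (F (z + t * d)%C) + Im (F (z + t * d)%C) * Im (F (z + t * d)%C)
      + eps * (Re (z + t * d) * Re (z + t * d) + Im (z + t * d) * Im (z + t * d)))
  (fun t => 2 * (Re (F (z + t * d)%C) * Re (F' (z + t * d)%C * d)
                 + Im (F (z + t * d)%C) * Im (F' (z + t * d)%C * d))
      + 2 * eps * (Re (z + t * d) * Re (1 * d) + Im (z + t * d) * Im (1 * d))) _ r); auto.
- intros t Ht. rewrite <- Pt in Ht.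
  pose proof (path_derive_Re _ _ _ _ _ (HF _ Ht)) as A.
  pose proof (path_derive_Im _ _ _ _ _ (HF _ Ht)) as B.
  pose proof (path_derive_Re _ _ d _ _ (cderive_id (z + t * d)%C)) as A'.
  pose proof (path_derive_Im _ _ d _ _ (cderive_id (z + t * d)%C)) as B'.
  eapply is_derive_eq.
  + apply (is_derive_plus (V := R_NormedModule)).
    * apply (is_derive_plus (V := R_NormedModule)); apply is_derive_prod; eassumption.
    * apply is_derive_scal. apply (is_derive_plus (V := R_NormedModule)); apply is_derive_prod; eassumption.
  + cbv beta. unfold plus; simpl. ring.
- assert (H0 : is_cderive F (z + 0 * d)%C (F' z)).
  { rewrite Z0. apply HF. replace (z - z)%C with (RtoC 0) by ring. now rewrite Cmod_0. }
  pose proof (path_derive_Re _ _ _ _ _ H0) as A.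
  pose proof (path_derive_Im _ _ _ _ _ H0) as B.
  assert (H1 : is_cderive (fun w => F' w * d)%C (z + 0 * d)%C (F2 * d)%C).
  { rewrite Z0. eapply cderive_eq; [exact (cderive_mult _ _ _ _ _ HF' (cderive_const d z))|].
    cbv beta. ring. }
  pose proof (path_derive_Re _ _ _ _ _ H1) as A1.
  pose proof (path_derive_Im _ _ _ _ _ H1) as B1.
  pose proof (path_derive_Re _ _ d _ _ (cderive_id (z + 0 * d)%C)) as A'.
  pose proof (path_derive_Im _ _ d _ _ (cderive_id (z + 0 * d)%C)) as B'.
  eapply is_derive_eq.
  + apply (is_derive_plus (V := R_NormedModule)).
    * apply is_derive_scal. apply (is_derive_plus (V := R_NormedModule)); apply is_derive_prod; eassumption.
    * apply is_derive_scal. apply (is_derive_plus (V := R_NormedModule)); apply is_derive_prod;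
        first [eassumption | apply (is_derive_const (V := R_NormedModule))].
  + cbv beta. rewrite Z0. unfold plus, zero; simpl.
    assert (D2 : fst d ^ 2 + snd d ^ 2 = 1) by (pose proof (Cmod2_alt d) as D2; rewrite Hd in D2; unfold Re, Im in D2; lra).
    rewrite Rmult_1_r.
    assert (N : Cmod (F' z) * Cmod (F' z) = fst (F' z) ^ 2 + snd (F' z) ^ 2).
    { pose proof (Cmod2_alt (F' z)) as N. unfold Re, Im in N. lra. }
    rewrite N.
    replace (fst (F' z) ^ 2 + snd (F' z) ^ 2)
      with ((fst (F' z) ^ 2 + snd (F' z) ^ 2) * (fst d ^ 2 + snd d ^ 2)) by (rewrite D2; ring).
    replace eps with (eps * (fst d ^ 2 + snd d ^ 2)) at 2 by (rewrite D2; ring).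
    unfold Re, Im. simpl. ring.
- intros t Ht. rewrite <- Pt in Ht. specialize (Hmax _ Ht).
  rewrite !Cmod2_alt in Hmax. rewrite Z0. unfold Re, Im in *. lra.
Qed.

(** Serves to let auxiliary radii and factors below 1 tend to 1. Differentiability replaces
    continuity because [auto_derive] proves it. *)
Lemma Rle_at_1 (f : R -> R) (a : R) : a < 1 -> ex_derive f 1 ->
  (forall x, a < x < 1 -> f x <= 0) -> f 1 <= 0.
Proof.
intros Ha Hf H. apply Rnot_lt_le. intros P.
assert (Hc : continuity_pt f 1).
{ apply continuity_pt_filterlim. now apply (ex_derive_continuous f 1). }
destruct (continuous_eps f 1 Hc (f 1) P) as [d [Hd K]].
set (x := Rmax ((a + 1) / 2) (1 - d / 2)).
assert (a < x) by (unfold x; pose proof (Rmax_l ((a + 1) / 2) (1 - d / 2)); lra).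
assert (1 - d / 2 <= x) by apply Rmax_r.
assert (x < 1) by (unfold x; apply Rmax_lub_lt; lra).
specialize (H x ltac:(lra)). specialize (K x).
assert (B : Rabs (x - 1) < d) by (rewrite Rabs_left; lra).
specialize (K B). apply Rabs_def2 in K. lra.
Qed.

Lemma ccont_rcont (F : C -> C) (z : C) (eps : R) :
  ccont F z -> rcont (fun w => Cmod (F w) ^ 2 + eps * Cmod w ^ 2) z.
Proof.
intros HF e He.
assert (S : forall (a b M d : R), 0 <= a -> 0 <= b -> b <= M -> Rabs (a - b) < d -> d <= 1 ->
  Rabs (a ^ 2 - b ^ 2) <= d * (2 * M + 1)).
{ intros a b M d Ha Hb HM Hd Hd1. replace (a ^ 2 - b ^ 2) with ((a - b) * (a + b)) by ring.
  rewrite Rabs_mult. pose proof (Rabs_def2 _ _ Hd). pose proof (Rabs_pos (a - b)).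
  rewrite (Rabs_pos_eq (a + b)) by lra. apply Rmult_le_compat; lra. }
set (M := Cmod (F z) + Cmod z + 1).
pose proof (Cmod_ge_0 (F z)). pose proof (Cmod_ge_0 z). pose proof (Rabs_pos eps).
set (k := (2 * M + 1) * (1 + Rabs eps) + 1).
assert (Hk : 0 < k) by (unfold k, M; nra).
set (d := Rmin 1 (e / k)).
assert (Hd : 0 < d) by (apply Rmin_pos; [lra | now apply Rdiv_lt_0_compat]).
assert (Hd1 : d <= 1) by apply Rmin_l.
assert (Hdk : d * k <= e).
{ apply Rle_div_r; [easy|]. apply Rmin_r. }
destruct (HF d Hd) as [d' [Hd' K]].
exists (Rmin d d'); split; [now apply Rmin_pos|]. intros w Hw.
assert (Hw1 := Rlt_le_trans _ _ _ Hw (Rmin_l _ _)).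
assert (Hw2 := Rlt_le_trans _ _ _ Hw (Rmin_r _ _)).
specialize (K (w - z)%C Hw2). replace (z + (w - z))%C with w in K by ring.
assert (T : forall a b, Cmod (a - b) < d -> Rabs (Cmod a - Cmod b) < d).
{ intros a b Hab. pose proof (Cmod_minus_rev a b). pose proof (Cmod_minus_rev b a).
  rewrite Cmod_minus_sym in H3. apply Rabs_def1; lra. }
pose proof (S _ _ M d (Cmod_ge_0 (F w)) (Cmod_ge_0 (F z)) ltac:(unfold M; lra) (T _ _ K) Hd1) as S1.
pose proof (S _ _ M d (Cmod_ge_0 w) (Cmod_ge_0 z) ltac:(unfold M; lra) (T _ _ Hw1) Hd1) as S2.
replace (Cmod (F w) ^ 2 + eps * Cmod w ^ 2 - (Cmod (F z) ^ 2 + eps * Cmod z ^ 2))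
  with ((Cmod (F w) ^ 2 - Cmod (F z) ^ 2) + eps * (Cmod w ^ 2 - Cmod z ^ 2)) by ring.
eapply Rle_lt_trans; [apply Rabs_triang|]. rewrite Rabs_mult.
assert (Rabs eps * Rabs (Cmod w ^ 2 - Cmod z ^ 2) <= Rabs eps * (d * (2 * M + 1)))
  by (apply Rmult_le_compat_l; lra).
unfold k in Hdk. nra.
Qed.

(* [|F|^2 + eps |z|^2] has positive Laplacian wherever [F] is holomorphic. *)
Lemma maximum_principle (F : C -> C) (rho B : R) : 0 < rho ->
  (forall z, Cmod z <= rho -> ccont F z) ->
  (forall z, Cmod z < rho -> F z <> 0%C ->
     exists (F' : C -> C) (F2 : C) (r : R), 0 < r /\
       (forall w, Cmod (w - z) < r -> is_cderive F w (F' w)) /\ is_cderive F' z F2) ->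
  (forall z, Cmod z = rho -> Cmod (F z) <= B) ->
  forall z, Cmod z <= rho -> Cmod (F z) <= B.
Proof.
intros Hrho Hc Hd HB z Hz.
assert (HB0 : 0 <= B).
{ eapply Rle_trans; [|apply (HB rho)]; [apply Cmod_ge_0|]. rewrite Cmod_R. apply Rabs_pos_eq; lra. }
assert (K : forall eps, 0 < eps -> Cmod (F z) ^ 2 <= B ^ 2 + eps * rho ^ 2).
{ intros eps Heps.
  destruct (closed_disk_max (fun w => Cmod (F w) ^ 2 + eps * Cmod w ^ 2) rho) as [z0 [Hz0 Hmax]].
  { lra. }
  { intros w Hw. apply ccont_rcont. auto. }
  assert (E0 : Cmod z0 ^ 2 <= rho ^ 2) by (apply pow_incr; split; [apply Cmod_ge_0 | easy]).
  assert (E1 : Cmod (F z0) <= B).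
  { destruct (Rle_lt_or_eq_dec _ _ Hz0) as [L | E]; [|now apply HB].
    destruct (Ceq_dec (F z0) 0%C) as [E | N]; [rewrite E, Cmod_0; easy|].
    exfalso. destruct (Hd z0 L N) as (F' & F2 & r & Hr & HF & HF').
    set (s := Rmin r (rho - Cmod z0)).
    assert (Hs : 0 < s) by (apply Rmin_pos; lra).
    assert (HsF : forall w, Cmod (w - z0) < s -> is_cderive F w (F' w)).
    { intros w Hw. apply HF. eapply Rlt_le_trans; [apply Hw | apply Rmin_l]. }
    assert (Hsm : forall w, Cmod (w - z0) < s ->
      Cmod (F w) ^ 2 + eps * Cmod w ^ 2 <= Cmod (F z0) ^ 2 + eps * Cmod z0 ^ 2).
    { intros w Hw. apply Hmax. pose proof (Rlt_le_trans _ _ _ Hw (Rmin_r _ _)).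
      pose proof (Cmod_minus_rev w z0). lra. }
    pose proof (second_variation_max F F' F2 z0 1%C eps s Hs Cmod_1 HsF HF' Hsm) as V1.
    pose proof (second_variation_max F F' F2 z0 Ci eps s Hs Cmod_Ci HsF HF' Hsm) as V2.
    assert (E : Re (Cconj (F z0) * F2 * (1 * 1)) + Re (Cconj (F z0) * F2 * (Ci * Ci)) = 0).
    { destruct (F z0), F2. simpl. ring. }
    pose proof (pow2_ge_0 (Cmod (F' z0))). lra. }
  specialize (Hmax z Hz). simpl in Hmax.
  assert (Cmod (F z0) ^ 2 <= B ^ 2) by (apply pow_incr; split; [apply Cmod_ge_0 | easy]).
  pose proof (pow2_ge_0 (Cmod z)). simpl in *. nra. }
apply Rnot_lt_le. intros L0.
assert (L : B ^ 2 < Cmod (F z) ^ 2) by nra.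
assert (R2 : 0 < rho ^ 2) by now apply pow_lt.
specialize (K ((Cmod (F z) ^ 2 - B ^ 2) / (2 * rho ^ 2))).
assert (0 < (Cmod (F z) ^ 2 - B ^ 2) / (2 * rho ^ 2)) by (apply Rdiv_lt_0_compat; lra).
specialize (K H).
replace ((Cmod (F z) ^ 2 - B ^ 2) / (2 * rho ^ 2) * rho ^ 2) with ((Cmod (F z) ^ 2 - B ^ 2) / 2) in K
  by (field; lra).
lra.
Qed.

(** Large powers absorb the constants: if [x / B = 1 + a] with [a > 0], Bernoulli's inequality makes
    [(1 + a)^n] exceed [K / c]. *)
Lemma le_of_pow_le (x B c K : R) : 0 < B -> 0 < c ->
  (forall n, x ^ n * c <= B ^ n * K) -> x <= B.
Proof.
intros HB Hc H. apply Rnot_lt_le. intros L.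
set (a := x / B - 1).
assert (Ha : 0 < a). { unfold a. apply Rlt_0_minus. apply Rlt_div_r; lra. }
destruct (INR_unbounded (K / (c * a))) as [n Hn].
specialize (H n).
assert (Bn : 0 < B ^ n) by now apply pow_lt.
replace x with (B * (1 + a)) in H by (unfold a; field; lra).
rewrite Rpow_mult_distr, Rmult_assoc in H.
apply Rmult_le_reg_l in H; [|easy].
pose proof (poly n a Ha) as P.
apply Rlt_div_l in Hn; [|nra]. nra.
Qed.

(* Applying the maximum principle to [H^n q], which extends continuously by [0] to the zeros of
   [q], and letting [n] tend to infinity shows that the bounded function [H] obeys it too. *)
Lemma maximum_principle_except (H q : C -> C) (M K B rho : R) :
  0 < rho < 1 -> 0 < B ->
  (forall z, Cmod z < 1 -> Cmod (H z) <= M) ->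
  holo 2 (fun _ => True) q ->
  (forall z, Cmod z <= rho -> Cmod (q z) <= K) ->
  holo 2 (fun z => Cmod z < 1 /\ q z <> 0%C) H ->
  (forall z, Cmod z = rho -> Cmod (H z) <= B) ->
  forall z, Cmod z <= rho -> q z <> 0%C -> Cmod (H z) <= B.
Proof.
intros Hrho HB HM Hq HK HH Hbd z Hz Hqz.
apply le_of_pow_le with (Cmod (q z)) K; [easy | now apply Cmod_gt_0|].
intros n. rewrite <- Cmod_pow, <- Cmod_mult.
assert (HF : holo 2 (fun z => Cmod z < 1 /\ q z <> 0%C) (fun z => H z ^ n * q z)%C).
{ apply holo_mult; [now apply holo_pow|]. now apply holo_subset with (fun _ => True). }
assert (Cq : forall w, ccont q w).
{ intros w. apply holo_cont with (fun _ => True); [now apply holo_weaken | easy]. }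
assert (HM0 : 0 <= M).
{ eapply Rle_trans; [|apply (HM 0%C)]; [apply Cmod_ge_0 | rewrite Cmod_0; lra]. }
apply (maximum_principle (fun z => H z ^ n * q z)%C rho (B ^ n * K)); [easy | | | | easy].
- intros w Hw. destruct (Ceq_dec (q w) 0%C) as [E | N].
  + intros eps Heps.
    assert (Hp : 0 < M ^ n + 1) by (pose proof (pow_le M n HM0); lra).
    destruct (Cq w (eps / (M ^ n + 1))) as [d [Hd D]]; [now apply Rdiv_lt_0_compat|].
    exists (Rmin d (1 - rho)); split; [apply Rmin_pos; lra|].
    intros h Hh.
    assert (Hh1 := Rlt_le_trans _ _ _ Hh (Rmin_l _ _)).
    assert (Hh2 := Rlt_le_trans _ _ _ Hh (Rmin_r _ _)).
    specialize (D h Hh1). rewrite E in D |- *.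
    replace (q (w + h)%C - 0)%C with (q (w + h)%C) in D by ring.
    replace (H (w + h)%C ^ n * q (w + h)%C - H w ^ n * 0)%C with (H (w + h)%C ^ n * q (w + h)%C)%C by ring.
    rewrite Cmod_mult, Cmod_pow.
    assert (Cmod (w + h) < 1) by (pose proof (Cmod_triangle w h); lra).
    assert (Cmod (H (w + h)%C) ^ n <= M ^ n) by (apply pow_incr; split; [apply Cmod_ge_0 | auto]).
    apply Rlt_div_r in D; [|lra].
    pose proof (Cmod_ge_0 (q (w + h)%C)). nra.
  + apply holo_cont with (fun z => Cmod z < 1 /\ q z <> 0%C); [now apply holo_weaken|].
    split; [lra | easy].
- intros w Hw Hn. destruct HF as [F' [HF1 [F'' [HF2 _]]]].
  assert (N : q w <> 0%C). { intros E. apply Hn. rewrite E. ring. }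
  assert (Nm : 0 < Cmod (q w)) by now apply Cmod_gt_0.
  destruct (Cq w (Cmod (q w)) Nm) as [d [Hd D]].
  exists F', (F'' w), (Rmin d (1 - rho)); split; [apply Rmin_pos; lra|]; split.
  + intros v Hv. apply HF1.
    assert (Hv1 := Rlt_le_trans _ _ _ Hv (Rmin_l _ _)).
    assert (Hv2 := Rlt_le_trans _ _ _ Hv (Rmin_r _ _)). split.
    * pose proof (Cmod_minus_rev v w). lra.
    * intros E. specialize (D _ Hv1). replace (w + (v - w))%C with v in D by ring.
      rewrite E in D. replace (0 - q w)%C with (- q w)%C in D by ring. rewrite Cmod_opp in D. lra.
  + apply HF2. split; [lra | easy].
- intros w Hw. rewrite Cmod_mult, Cmod_pow.
  apply Rmult_le_compat; [apply pow_le, Cmod_ge_0 | apply Cmod_ge_0 | |].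
  + apply pow_incr. split; [apply Cmod_ge_0 | auto].
  + apply HK. lra.
Qed.

(* The bound covers the junk value of the quotient at [z0], where it is a division by zero. *)
Lemma quotient_bounded (N : C -> C) (z0 l : C) (b : R) :
  is_cderive N z0 l -> N z0 = 0%C ->
  (forall z, Cmod z < 1 -> z <> z0 -> Cmod (N z) <= b) ->
  exists M, 0 <= M /\ forall z, Cmod z < 1 -> Cmod (N z / (z - z0)) <= M.
Proof.
intros Hl H0 Hb. destruct (cderive_lipschitz _ _ _ Hl) as [d [Hd D]].
pose proof (Cmod_ge_0 l). pose proof (Cmod_ge_0 (N z0 / (z0 - z0))).
assert (Q : 0 <= Rabs b / d) by (apply Rdiv_le_0_compat; [apply Rabs_pos | easy]).
exists (Cmod (N z0 / (z0 - z0)) + (Cmod l + 1) + Rabs b / d). split; [lra|]. intros z Hz.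
destruct (Ceq_dec z z0) as [-> | Ne]; [lra|].
assert (Nz : (z - z0)%C <> 0%C) by now apply Cminus_eq_contra.
assert (P : 0 < Cmod (z - z0)) by now apply Cmod_gt_0.
rewrite Cmod_div by easy.
destruct (Rlt_le_dec (Cmod (z - z0)) d) as [L | L].
- specialize (D _ L). replace (z0 + (z - z0))%C with z in D by ring. rewrite H0 in D.
  replace (N z - 0)%C with (N z) in D by ring.
  apply Rle_trans with (Cmod l + 1); [|lra]. apply Rle_div_l; easy.
- apply Rle_trans with (Rabs b / d); [|lra].
  apply Rmult_le_compat; [apply Cmod_ge_0 | left; now apply Rinv_0_lt_compat | |].
  + pose proof (Rle_abs b). specialize (Hb z Hz Ne). lra.
  + now apply Rinv_le_contravar.
Qed.

Lemma schwarz_lemma (w : C -> C) :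
  holo 2 unit_disk w -> w 0%C = 0%C -> (forall z, unit_disk z -> Cmod (w z) < 1) ->
  forall z, unit_disk z -> Cmod (w z) <= Cmod z.
Proof.
unfold unit_disk. intros Hw H0 H1 z Hz.
destruct (Ceq_dec z 0%C) as [-> | Nz]; [rewrite H0; lra|].
assert (P : 0 < Cmod z) by now apply Cmod_gt_0.
pose proof Hw as [w' [Hw' _]].
destruct (quotient_bounded w 0%C (w' 0%C) 1) as [M [_ HM]]; auto.
{ apply Hw'. rewrite Cmod_0. lra. }
{ intros v Hv _. left. auto. }
assert (K : Cmod (w z) * 1 - Cmod z <= 0); [|lra].
apply (Rle_at_1 (fun rho => Cmod (w z) * rho - Cmod z) (Cmod z)); [easy | |].
{ now auto_derive. }
intros rho Hrho.
(* On [|v| = rho] the quotient is at most [1 / rho], and [rho] tends to 1 at the end. The divisor is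
   written [z - 0] to fit [quotient_bounded]. *)
assert (B : Cmod (w z / (z - 0)) <= / rho).
{ apply (maximum_principle_except (fun z => w z / (z - 0))%C (fun z => z - 0)%C M 1 (/ rho) rho).
  - lra.
  - apply Rinv_0_lt_compat; lra.
  - exact HM.
  - apply holo_minus; [apply holo_id | apply holo_const].
  - intros v Hv. replace (v - 0)%C with v by ring. lra.
  - apply holo_div.
    + now intros v [_ Hv].
    + apply holo_subset with (fun z => Cmod z < 1); [now intros v [Hv _] | easy].
    + apply holo_minus; [apply holo_id | apply holo_const].
  - intros v Hv. replace (v - 0)%C with v by ring.
    assert (v <> 0%C) by (apply Cmod_gt_0; lra). rewrite Cmod_div, Hv by easy.
    rewrite <- (Rmult_1_l (/ rho)). apply Rmult_le_compat_r.
    + left. apply Rinv_0_lt_compat; lra.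
    + left. apply H1. lra.
  - lra.
  - now replace (z - 0)%C with z by ring. }
replace (z - 0)%C with z in B by ring. rewrite Cmod_div in B by easy.
apply Rle_div_l in B; [|easy].
apply Rmult_le_compat_r with (r := rho) in B; [|lra].
replace (/ rho * Cmod z * rho) with (Cmod z) in B by (field; lra). lra.
Qed.

(** * Schwarz-Pick and Dieudonné inequalities *)

Lemma Cmod_mobius_le (a b : C) : Cmod a <= 1 -> Cmod b <= 1 ->
  Cmod (b - a) <= Cmod (1 - Cconj a * b).
Proof.
intros Ha Hb.
apply Rsqr_incr_0; [|apply Cmod_ge_0|apply Cmod_ge_0]. rewrite !Rsqr_pow2.
assert (A2 : Cmod a ^ 2 <= 1) by (pose proof (Cmod_ge_0 a); nra).
assert (B2 : Cmod b ^ 2 <= 1) by (pose proof (Cmod_ge_0 b); nra).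
assert (E : Cmod (1 - Cconj a * b) ^ 2 - Cmod (b - a) ^ 2 = (1 - Cmod a ^ 2) * (1 - Cmod b ^ 2)).
{ rewrite !Cmod2_alt. destruct a, b; simpl; ring. }
nra.
Qed.

(** On the circle [rho^2] equals [z * conj z]. This says that the Blaschke factor of the disk of
    radius [rho] has constant modulus on the boundary. *)
Lemma Cmod_blaschke (z z0 : C) (rho : R) : Cmod z = rho ->
  Cmod (rho ^ 2 - Cconj z0 * z) = rho * Cmod (z - z0).
Proof.
intros <-. rewrite <- RtoC_pow, Cmod2_conj.
replace (z * Cconj z - Cconj z0 * z)%C with (z * Cconj (z - z0))%C.
2:{ rewrite Cminus_conj. ring. }
now rewrite Cmod_mult, Cmod_conj.
Qed.

(** The function to come is a multiple of [w / z], hence the puncture at 0. The bound [kappa < 1]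
    keeps the denominators [1 - conj (g z0) g z] away from 0. The maximum principle is applied to
    the Schwarz-Pick quotient on the disk of radius [rho], with exceptional points 0 and [z0], the
    zeros of [v * (v - z0)]. The cross-multiplied form also makes sense at [z = z0]. *)
Lemma schwarz_pick_punctured (g : C -> C) (kappa : R) (z0 : C) (rho : R) :
  kappa < 1 ->
  holo 2 (fun z => unit_disk z /\ z <> 0%C) g ->
  (forall z, unit_disk z -> z <> 0%C -> Cmod (g z) <= kappa) ->
  z0 <> 0%C -> Cmod z0 < rho < 1 ->
  forall z, Cmod z <= rho -> z <> 0%C ->
  Cmod (g z - g z0) * Cmod (rho ^ 2 - Cconj z0 * z) <=
    rho * (Cmod (z - z0) * Cmod (1 - Cconj (g z0) * g z)).
Proof.
unfold unit_disk. intros Hk Hg Hgk Hz0 Hrho z Hz Hzn.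
destruct (Ceq_dec z z0) as [-> | Nz].
{ replace (g z0 - g z0)%C with (RtoC 0) by ring. replace (z0 - z0)%C with (RtoC 0) by ring.
  rewrite Cmod_0. lra. }
pose proof (Cmod_ge_0 z0) as Pz0.
assert (Hg0 : Cmod (g z0) <= kappa) by (apply Hgk; [lra | easy]).
assert (Den : forall v, Cmod v < 1 -> v <> 0%C -> 1 - kappa <= Cmod (1 - Cconj (g z0) * g v)).
{ intros v Hv Nv. specialize (Hgk v Hv Nv).
  pose proof (Cmod_minus_rev 1 (Cconj (g z0) * g v)) as T.
  rewrite Cmod_1, Cmod_mult, Cmod_conj in T.
  pose proof (Cmod_ge_0 (g z0)). pose proof (Cmod_ge_0 (g v)). nra. }
assert (DenN : forall v, Cmod v < 1 -> v <> 0%C -> (1 - Cconj (g z0) * g v)%C <> 0%C).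
{ intros v Hv Nv. apply Cmod_gt_0. specialize (Den v Hv Nv). lra. }
(* The factor [1 / (v - z0)] of the Schwarz-Pick quotient is left out, so that [N] vanishes at [z0]
   and [quotient_bounded] applies to it. *)
set (N := fun v => ((g v - g z0) / (1 - Cconj (g z0) * g v) * (rho ^ 2 - Cconj z0 * v))%C).
assert (HN : holo 2 (fun v => Cmod v < 1 /\ v <> 0%C) N).
{ unfold N. apply holo_mult; [apply holo_div|].
  - intros v [Hv Nv]. auto.
  - apply holo_minus; [easy | apply holo_const].
  - apply holo_minus; [apply holo_const | apply holo_mult; [apply holo_const | easy]].
  - apply holo_minus; [apply holo_const | apply holo_mult; [apply holo_const | apply holo_id]]. }
pose proof HN as [N' [HN' _]].
assert (BN : forall v, Cmod v < 1 -> v <> 0%C -> Cmod (N v) <= 2).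
{ intros v Hv Nv. unfold N. rewrite Cmod_mult, Cmod_div by auto.
  assert (Cmod (g v - g z0) / Cmod (1 - Cconj (g z0) * g v) <= 1).
  { apply Rle_div_l; [specialize (Den v Hv Nv); lra|]. rewrite Rmult_1_l.
    apply Cmod_mobius_le; [lra|]. specialize (Hgk v Hv Nv). lra. }
  assert (Cmod (rho ^ 2 - Cconj z0 * v) <= 2).
  { unfold Cminus. eapply Rle_trans; [apply Cmod_triangle|].
    rewrite Cmod_opp, Cmod_mult, Cmod_conj, Cmod_pow, Cmod_R, Rabs_pos_eq by lra.
    pose proof (Cmod_ge_0 v). nra. }
  assert (0 <= Cmod (g v - g z0) / Cmod (1 - Cconj (g z0) * g v)).
  { apply Rdiv_le_0_compat; [apply Cmod_ge_0|]. specialize (Den v Hv Nv); lra. }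
  pose proof (Cmod_ge_0 (rho ^ 2 - Cconj z0 * v)). nra. }
(* The value [g 0] is arbitrary, so [N 0] escapes the bound 2 and enters through the maximum. *)
destruct (quotient_bounded N z0 (N' z0) (Rmax 2 (Cmod (N 0%C)))) as [M [HM0 HM]].
{ apply HN'. split; [lra | easy]. }
{ unfold N. replace (g z0 - g z0)%C with (RtoC 0) by ring. unfold Cdiv. ring. }
{ intros v Hv _. destruct (Ceq_dec v 0%C) as [-> | Nv]; [apply Rmax_r|].
  eapply Rle_trans; [apply BN; auto | apply Rmax_l]. }
assert (Nzz : (z - z0)%C <> 0%C) by now apply Cminus_eq_contra.
assert (K : Cmod (N z / (z - z0)) <= rho).
{ apply (maximum_principle_except (fun v => N v / (v - z0))%C (fun v => v * (v - z0))%C M 2 rho rho).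
  - lra.
  - lra.
  - exact HM.
  - apply holo_mult; [apply holo_id | apply holo_minus; [apply holo_id | apply holo_const]].
  - intros v Hv. rewrite Cmod_mult.
    assert (Cmod (v - z0) <= 2). { unfold Cminus. eapply Rle_trans; [apply Cmod_triangle|]. rewrite Cmod_opp. lra. }
    pose proof (Cmod_ge_0 v). pose proof (Cmod_ge_0 (v - z0)). nra.
  - apply holo_div.
    + intros v [_ Hv] E. apply Hv. rewrite E. ring.
    + apply holo_subset with (fun v => Cmod v < 1 /\ v <> 0%C); [|easy].
      intros v [Hv Hv']. split; [easy|]. intros E. apply Hv'. rewrite E. ring.
    + apply holo_minus; [apply holo_id | apply holo_const].
  - intros v Hv.
    assert (Nv : v <> 0%C) by (apply Cmod_gt_0; lra).
    assert (Nv0 : (v - z0)%C <> 0%C).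
    { apply Cminus_eq_contra. intros E. rewrite E in Hv. lra. }
    assert (Hv1 : Cmod v < 1) by lra.
    unfold N. rewrite Cmod_div, Cmod_mult, Cmod_div, Cmod_blaschke by auto.
    assert (P : 0 < Cmod (v - z0)) by now apply Cmod_gt_0.
    assert (Q : 0 < Cmod (1 - Cconj (g z0) * g v)) by (specialize (Den v Hv1 Nv); lra).
    replace (Cmod (g v - g z0) / Cmod (1 - Cconj (g z0) * g v) * (rho * Cmod (v - z0)) / Cmod (v - z0))
      with (rho * (Cmod (g v - g z0) / Cmod (1 - Cconj (g z0) * g v))) by (field; lra).
    rewrite <- (Rmult_1_r rho) at 2. apply Rmult_le_compat_l; [lra|].
    apply Rle_div_l; [easy|]. rewrite Rmult_1_l. apply Cmod_mobius_le; [lra|].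
    specialize (Hgk v Hv1 Nv). lra.
  - easy.
  - now apply Cmult_neq_0. }
assert (Hz1 : Cmod z < 1) by lra.
assert (P : 0 < Cmod (z - z0)) by now apply Cmod_gt_0.
assert (Q : 0 < Cmod (1 - Cconj (g z0) * g z)) by (specialize (Den z Hz1 Hzn); lra).
unfold N in K. rewrite Cmod_div, Cmod_mult, Cmod_div in K by auto.
apply Rle_div_l in K; [|easy].
apply Rmult_le_compat_r with (r := Cmod (1 - Cconj (g z0) * g z)) in K; [|lra].
replace (Cmod (g z - g z0) / Cmod (1 - Cconj (g z0) * g z) * Cmod (rho ^ 2 - Cconj z0 * z) *
   Cmod (1 - Cconj (g z0) * g z)) with (Cmod (g z - g z0) * Cmod (rho ^ 2 - Cconj z0 * z)) in K
  by (field; lra).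
lra.
Qed.

(** The two-point inequality is used at [z0 + t] with a small real [t], which turns difference
    quotients into [l]; then [rho] tends to 1. *)
Lemma schwarz_pick_derivative (g : C -> C) (kappa : R) (z0 l : C) :
  kappa < 1 ->
  holo 2 (fun z => unit_disk z /\ z <> 0%C) g ->
  (forall z, unit_disk z -> z <> 0%C -> Cmod (g z) <= kappa) ->
  z0 <> 0%C -> unit_disk z0 -> is_cderive g z0 l ->
  Cmod l * (1 - Cmod z0 ^ 2) <= 1 - Cmod (g z0) ^ 2.
Proof.
unfold unit_disk. intros Hk Hg Hgk Hn Hz0 Hl.
pose proof (Cmod_ge_0 z0) as P0. pose proof (Cmod_ge_0 l) as Pl.
assert (Pz : 0 < Cmod z0) by now apply Cmod_gt_0.
assert (Hg0 : Cmod (g z0) <= kappa) by auto.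
pose proof (Cmod_ge_0 (g z0)) as Pg.
apply Rminus_le.
replace (Cmod l * (1 - Cmod z0 ^ 2)) with (Cmod l * (1 ^ 2 - Cmod z0 ^ 2)) by ring.
apply (Rle_at_1 (fun rho => Cmod l * (rho ^ 2 - Cmod z0 ^ 2) - (1 - Cmod (g z0) ^ 2)) (Cmod z0));
  [easy | now auto_derive |].
intros rho Hrho. apply Rle_minus.
set (Q := rho ^ 2 - Cmod z0 ^ 2).
assert (HQ : 0 < Q <= 1) by (unfold Q; nra).
apply le_epsilon. intros eta Heta.
(* The errors below add up to at most [2 |l| t + e Q], which is less than [eta] since [t <= e / 2]
   and [Q <= 1]. *)
set (e := Rmin (eta / (2 * Cmod l + 2)) (Rmin Q (rho - Cmod z0))).
assert (He : 0 < e).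
{ unfold e. repeat apply Rmin_pos; try lra. apply Rdiv_lt_0_compat; lra. }
assert (He1 : e * (2 * Cmod l + 2) <= eta).
{ apply Rle_div_r; [lra|]. apply Rmin_l. }
assert (He2 : e <= Q) by (unfold e; eapply Rle_trans; [apply Rmin_r | apply Rmin_l]).
assert (He3 : e <= rho - Cmod z0) by (unfold e; eapply Rle_trans; [apply Rmin_r | apply Rmin_r]).
destruct (proj1 (is_cderiveP _ _ _) Hl e He) as [d [Hd D]].
(* Staying below [|z0|] keeps [z0 + t] off the puncture; staying below [e <= rho - |z0|] keeps it in
   the disk of radius [rho]. *)
set (t := Rmin (Rmin d e) (Cmod z0) / 2).
assert (Ht : 0 < t). { unfold t. apply Rdiv_lt_0_compat; [|lra]. apply Rmin_pos; [now apply Rmin_pos | exact Pz]. }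
assert (Ht' : t <= Rmin (Rmin d e) (Cmod z0) / 2) by apply Rle_refl.
pose proof (Rmin_l (Rmin d e) (Cmod z0)). pose proof (Rmin_r (Rmin d e) (Cmod z0)).
pose proof (Rmin_l d e). pose proof (Rmin_r d e).
assert (Mt : Cmod t = t) by (rewrite Cmod_R; apply Rabs_pos_eq; lra).
specialize (D t). rewrite Mt in D. specialize (D ltac:(lra)).
pose proof (schwarz_pick_punctured g kappa z0 rho Hk Hg Hgk Hn ltac:(lra) (z0 + t)%C) as K.
assert (K1 : Cmod (z0 + t) <= rho) by (pose proof (Cmod_triangle z0 t); lra).
assert (K2 : (z0 + t)%C <> 0%C).
{ apply Cmod_gt_0. pose proof (Cmod_minus_rev z0 (- t)) as T. rewrite Cmod_opp, Mt in T.
  replace (z0 - - t)%C with (z0 + t)%C in T by ring. lra. }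
specialize (K K1 K2). replace (z0 + t - z0)%C with (RtoC t) in K by ring. rewrite Mt in K.
set (G := (g (z0 + t)%C - g z0)%C) in *.
assert (G1 : (Cmod l - e) * t <= Cmod G).
{ pose proof (Cmod_minus_rev (t * l) (t * l - G)) as T.
  replace (t * l - (t * l - G))%C with G in T by ring.
  rewrite (Cmod_minus_sym (t * l) G), Cmod_mult, Mt in T. lra. }
assert (G2 : Cmod G <= (Cmod l + e) * t).
{ pose proof (Cmod_triangle (G - t * l) (t * l)) as T.
  replace (G - t * l + t * l)%C with G in T by ring. rewrite Cmod_mult, Mt in T. lra. }
assert (B1 : Q - t <= Cmod (rho ^ 2 - Cconj z0 * (z0 + t))).
{ pose proof (Cmod_minus_rev (rho ^ 2 - Cconj z0 * z0) (Cconj z0 * t)) as T.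
  replace (rho ^ 2 - Cconj z0 * z0 - Cconj z0 * t)%C with (rho ^ 2 - Cconj z0 * (z0 + t))%C in T by ring.
  rewrite Cmod_mult, Cmod_conj, Mt in T.
  replace (rho ^ 2 - Cconj z0 * z0)%C with (RtoC Q) in T.
  2:{ unfold Q. rewrite RtoC_minus, Cmod2_conj, RtoC_pow. ring. }
  rewrite Cmod_R, Rabs_pos_eq in T by lra. nra. }
assert (B2 : Cmod (1 - Cconj (g z0) * g (z0 + t)%C) <= 1 - Cmod (g z0) ^ 2 + Cmod G).
{ replace (1 - Cconj (g z0) * g (z0 + t)%C)%C
    with ((1 - Cconj (g z0) * g z0) + - (Cconj (g z0) * G))%C by (unfold G; ring).
  eapply Rle_trans; [apply Cmod_triangle|]. rewrite Cmod_opp, (Cmod_mult (Cconj (g z0)) G), Cmod_conj.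
  replace (1 - Cconj (g z0) * g z0)%C with (RtoC (1 - Cmod (g z0) ^ 2)).
  2:{ rewrite RtoC_minus, Cmod2_conj. ring. }
  rewrite Cmod_R, Rabs_pos_eq by nra. pose proof (Cmod_ge_0 G). nra. }
pose proof (Cmod_ge_0 G) as PG.
assert (S1 : (Cmod l - e) * t * (Q - t) <= t * (1 - Cmod (g z0) ^ 2 + (Cmod l + e) * t)).
{ apply Rle_trans with (Cmod G * (Q - t)); [apply Rmult_le_compat_r; lra|].
  apply Rle_trans with (Cmod G * Cmod (rho ^ 2 - Cconj z0 * (z0 + t))); [apply Rmult_le_compat_l; lra|].
  eapply Rle_trans; [apply K|].
  pose proof (Cmod_ge_0 (1 - Cconj (g z0) * g (z0 + t)%C)) as PB.
  assert (t * Cmod (1 - Cconj (g z0) * g (z0 + t)%C) <= t * (1 - Cmod (g z0) ^ 2 + (Cmod l + e) * t))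
    by (apply Rmult_le_compat_l; lra).
  assert (0 <= t * Cmod (1 - Cconj (g z0) * g (z0 + t)%C)) by (apply Rmult_le_pos; lra).
  nra. }
assert (S2 : (Cmod l - e) * (Q - t) <= 1 - Cmod (g z0) ^ 2 + (Cmod l + e) * t)
  by (apply Rmult_le_reg_l with t; lra).
assert (t <= e / 2) by lra.
assert (Cmod l * t <= Cmod l * (e / 2)) by (apply Rmult_le_compat_l; lra).
assert (e * t <= e * (Q / 2)) by (apply Rmult_le_compat_l; lra).
nra.
Qed.

(** The derivative of [w / z] is [(z w' - w) / z^2], and the inequality of Schwarz-Pick for it is
    multiplied by [|z|^2]. The Schwarz lemma only gives [|w / z| <= 1], with equality for rotations;
    the factor [s < 1] supplies the strict bound and tends to 1. *)
Lemma dieudonne_lemma (w w' : C -> C) (z : C) :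
  holo 2 unit_disk w -> w 0%C = 0%C -> (forall z, unit_disk z -> Cmod (w z) < 1) ->
  unit_disk z -> z <> 0%C -> is_cderive w z (w' z) ->
  Cmod (z * w' z - w z) * (1 - Cmod z ^ 2) <= Cmod z ^ 2 - Cmod (w z) ^ 2.
Proof.
unfold unit_disk. intros Hw H0 H1 Hz Nz Hw'.
assert (P : 0 < Cmod z) by now apply Cmod_gt_0.
assert (K : 1 * (Cmod (z * w' z - w z) * (1 - Cmod z ^ 2)) - (Cmod z ^ 2 - 1 ^ 2 * Cmod (w z) ^ 2) <= 0);
  [|lra].
apply (Rle_at_1 (fun s => s * (Cmod (z * w' z - w z) * (1 - Cmod z ^ 2)) -
  (Cmod z ^ 2 - s ^ 2 * Cmod (w z) ^ 2)) 0); [lra | now auto_derive |].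
intros s Hs.
assert (Ms : Cmod s = s) by (rewrite Cmod_R; apply Rabs_pos_eq; lra).
pose proof (schwarz_pick_derivative (fun v => s * (w v / v))%C s z
  (s * (w' z / z - w z / (z * z)))%C) as K.
cbv beta in K. rewrite !Cmod_mult, Ms, Cmod_div in K by easy.
replace (w' z / z - w z / (z * z))%C with ((z * w' z - w z) / (z * z))%C in K by (field; easy).
rewrite Cmod_div, Cmod_mult in K by now apply Cmult_neq_0.
assert (K' : s * (Cmod (z * w' z - w z) / (Cmod z * Cmod z)) * (1 - Cmod z ^ 2) <=
     1 - (s * (Cmod (w z) / Cmod z)) ^ 2).
{ apply K; try easy.
  - apply holo_mult; [apply holo_const|]. apply holo_div.
    + now intros v [_ Hv].
    + apply holo_subset with unit_disk; [now intros v [Hv _] | easy].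
    + apply holo_id.
  - intros v Hv Nv. assert (0 < Cmod v) by now apply Cmod_gt_0.
    rewrite Cmod_mult, Ms, Cmod_div by easy.
    pose proof (schwarz_lemma w Hw H0 H1 v Hv).
    rewrite <- (Rmult_1_r s) at 2. apply Rmult_le_compat_l; [lra|]. apply Rle_div_l; lra.
  - eapply cderive_eq.
    + apply cderive_mult; [apply cderive_const|].
      apply (cderive_mult w (fun v => / v)%C); [exact Hw'|].
      apply cderive_Cinv; easy.
    + cbv beta; field; easy. }
apply Rmult_le_compat_r with (r := Cmod z * Cmod z) in K'; [|nra].
replace (s * (Cmod (z * w' z - w z) / (Cmod z * Cmod z)) * (1 - Cmod z ^ 2) * (Cmod z * Cmod z))
  with (s * (Cmod (z * w' z - w z) * (1 - Cmod z ^ 2))) in K' by (field; lra).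
replace ((1 - (s * (Cmod (w z) / Cmod z)) ^ 2) * (Cmod z * Cmod z))
  with (Cmod z ^ 2 - s ^ 2 * Cmod (w z) ^ 2) in K' by (field; lra).
lra.
Qed.

(** * Estimates for the sector mapping *)

Lemma is_derive_sinh (c t : R) : is_derive (fun s => sinh (c * s)) t (c * cosh (c * t)).
Proof. unfold sinh, cosh. auto_derive; auto. field. Qed.

Lemma exp_le (a b : R) : a <= b -> exp a <= exp b.
Proof. intros [H | ->]; [left; now apply exp_increasing | apply Rle_refl]. Qed.

Lemma sinh_pos (t : R) : 0 <= t -> 0 <= sinh t.
Proof. intros H. unfold sinh. pose proof (exp_le (- t) t ltac:(lra)). lra. Qed.

Lemma cosh_sub_cosh (a b : R) : cosh b - cosh a = 2 * sinh ((b + a) / 2) * sinh ((b - a) / 2).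
Proof.
set (p := (b + a) / 2). set (q := (b - a) / 2).
replace b with (p + q) by (unfold p, q; field).
replace a with (p + - q) by (unfold p, q; field).
unfold sinh, cosh.
replace (- (p + q)) with (- p + - q) by ring.
replace (- (p + - q)) with (- p + q) by ring.
rewrite !exp_plus. field.
Qed.

Lemma cosh_le (a b : R) : Rabs a <= b -> cosh a <= cosh b.
Proof.
intros H. apply Rabs_le_between in H. pose proof (cosh_sub_cosh a b) as E.
pose proof (sinh_pos ((b + a) / 2) ltac:(lra)). pose proof (sinh_pos ((b - a) / 2) ltac:(lra)). nra.
Qed.

(** Both sides agree at 0. Since [exp (- t) <= exp (- alpha t) = cosh (alpha t) - sinh (alpha t)],
    the derivative of left minus right is at most [(alpha - 1) sinh (alpha t) <= 0]. *)
Lemma cosh_le_exp_plus_sinh (alpha T : R) : 0 < alpha < 1 -> 0 <= T ->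
  cosh (alpha * T) <= exp (- T) + sinh (alpha * T) / alpha.
Proof.
intros Ha HT.
assert (K : cosh (alpha * T) - exp (- T) - / alpha * sinh (alpha * T) <=
  cosh (alpha * 0) - exp (- 0) - / alpha * sinh (alpha * 0)).
{ apply (decreasing_from_derive (fun t => cosh (alpha * t) - exp (- t) - / alpha * sinh (alpha * t))
    (fun t => alpha * sinh (alpha * t) + exp (- t) - cosh (alpha * t))); [lra| |].
  - intros t Ht. unfold sinh, cosh. auto_derive; auto. field. lra.
  - intros t Ht. unfold sinh, cosh.
    pose proof (exp_le (- t) (- (alpha * t)) ltac:(nra)).
    pose proof (exp_le (- (alpha * t)) (alpha * t) ltac:(nra)). nra. }
unfold sinh, cosh in *. rewrite Rmult_0_r, Ropp_0, exp_0 in K. unfold Rdiv in *. nra.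
Qed.

(* With [1 + x = b], [1 - x = a] and [E = exp (alpha T)] the claim reduces to [0 <= (b - E a)^2]. *)
Lemma sector_inequality (alpha s x T : R) : 0 < alpha < 1 -> 0 <= s < 1 -> 0 <= x <= 1 ->
  T = ln ((1 + s) / (1 - s)) ->
  (1 - x) * (x - s ^ 2) * (exp (alpha * T) / (1 - s ^ 2)) +
  (1 - x) ^ 2 * (exp (alpha * T) * ((sinh T - sinh (alpha * T) / alpha) / 2)) <= x.
Proof.
intros Ha Hs Hx HT.
assert (Q : 1 <= (1 + s) / (1 - s)) by (apply Rle_div_r; lra).
assert (HT0 : 0 <= T). { rewrite HT, <- ln_1. apply ln_le; lra. }
assert (ET : exp T = (1 + s) / (1 - s)) by (rewrite HT, exp_ln; lra).
assert (EmT : exp (- T) = (1 - s) / (1 + s)) by (rewrite exp_Ropp, ET; field; lra).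
pose proof (cosh_le_exp_plus_sinh alpha T Ha HT0) as K.
set (u := exp (- T) + sinh (alpha * T) / alpha) in *.
set (E := exp (alpha * T)) in *.
assert (PE : 0 < E) by apply exp_pos.
replace ((1 - x) * (x - s ^ 2) * (E / (1 - s ^ 2)) +
  (1 - x) ^ 2 * (E * ((sinh T - sinh (alpha * T) / alpha) / 2)))
  with (E / 2 * ((1 - x ^ 2) - u * (1 - x) ^ 2)).
2:{ unfold u. unfold sinh at 2. rewrite EmT, ET. field. split; [lra|]. split; [lra|].
    split; [lra|]. nra. }
assert (K2 : E ^ 2 + 1 <= 2 * E * u).
{ unfold cosh in K. rewrite exp_Ropp in K. fold E in K.
  apply Rmult_le_compat_l with (r := 2 * E) in K; [|lra].
  replace (2 * E * ((E + / E) / 2)) with (E ^ 2 + 1) in K by (field; lra). lra. }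
pose proof (pow2_ge_0 ((1 + x) - E * (1 - x))).
pose proof (pow2_ge_0 (1 - x)). nra.
Qed.

(** * Complex hyperbolic functions and their real majorants *)

Definition csinh (z : C) : C := ((cexp z - cexp (- z)) / 2)%C.
Definition ccosh (z : C) : C := ((cexp z + cexp (- z)) / 2)%C.

Lemma RtoC_2_neq_0 : RtoC 2 <> 0%C.
Proof. intros E. apply RtoC_inj in E. lra. Qed.

Lemma cderive_cexp_opp (z : C) : is_cderive (fun w => cexp (- w)) z (- cexp (- z))%C.
Proof.
eapply cderive_eq.
- apply (cderive_comp cexp (fun w => - w)%C); [apply cderive_cexp|].
  apply cderive_opp, cderive_id.
- ring.
Qed.

Lemma cderive_csinh (z : C) : is_cderive csinh z (ccosh z).
Proof.
eapply cderive_eq.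
- apply (cderive_mult (fun w => cexp w - cexp (- w))%C (fun _ => / 2)%C).
  + apply cderive_minus; [apply cderive_cexp | apply cderive_cexp_opp].
  + apply cderive_const.
- unfold ccosh. field.
Qed.

Lemma Cmod_ccosh_le (z : C) : Cmod (ccosh z) <= cosh (Cmod z).
Proof.
apply Rle_trans with (cosh (Re z)); [|apply cosh_le, re_le_Cmod].
unfold ccosh, cosh. rewrite Cmod_div, Cmod_R, Rabs_pos_eq by (try exact RtoC_2_neq_0; lra).
apply Rmult_le_compat_r; [lra|].
eapply Rle_trans; [apply Cmod_triangle|]. rewrite !Cmod_cexp, re_opp. lra.
Qed.

Lemma csinh_0 : csinh 0%C = 0%C.
Proof. unfold csinh. rewrite Copp_0. field. Qed.

Lemma Cmod_csinh_le (z : C) : Cmod (csinh z) <= sinh (Cmod z).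
Proof.
pose proof (mean_value_inequality csinh ccosh (fun t => sinh (Cmod z * t))
  (fun t => Cmod z * cosh (Cmod z * t)) 0%C z) as K. cbv beta in K.
rewrite csinh_0, Rmult_1_r, Rmult_0_r, sinh_0, Rminus_0_r in K.
replace (csinh (0 + z) - 0)%C with (csinh z) in K by (rewrite Cplus_0_l; ring).
apply K; intros t Ht.
- apply cderive_csinh.
- apply is_derive_sinh.
- rewrite Cplus_0_l, Cmod_mult, Rmult_comm.
  apply Rmult_le_compat_l; [apply Cmod_ge_0|].
  eapply Rle_trans; [apply Cmod_ccosh_le|]. rewrite Cmod_mult, Cmod_R, Rabs_pos_eq by easy.
  rewrite Rmult_comm. apply Rle_refl.
Qed.

Lemma ccosh_sub_ccosh (a b : C) :
  (ccosh b - ccosh a)%C = (2 * csinh ((b + a) / 2) * csinh ((b - a) / 2))%C.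
Proof.
unfold csinh, ccosh.
replace (cexp b) with (cexp ((b + a) / 2) * cexp ((b - a) / 2))%C
  by (rewrite <- cexp_plus; f_equal; field).
replace (cexp (- b)) with (cexp (- ((b + a) / 2)) * cexp (- ((b - a) / 2)))%C
  by (rewrite <- cexp_plus; f_equal; field).
replace (cexp a) with (cexp ((b + a) / 2) * cexp (- ((b - a) / 2)))%C
  by (rewrite <- cexp_plus; f_equal; field).
replace (cexp (- a)) with (cexp (- ((b + a) / 2)) * cexp ((b - a) / 2))%C
  by (rewrite <- cexp_plus; f_equal; field).
field.
Qed.

(** Bounding the two terms separately would lose their cancellation. The derivative
    [ccosh z - ccosh (alpha z)] factors into two values of [csinh] at nonnegative real multiples of
    [z], and each is dominated by [sinh] of its modulus; integrating gives the bound at [|z|]. The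
    second half is monotonicity of the real majorant. *)
Lemma Cmod_csinh_sub_le (alpha T : R) (z : C) : 0 < alpha < 1 -> Cmod z <= T ->
  Cmod (csinh z - csinh (alpha * z) / alpha) <= sinh T - sinh (alpha * T) / alpha.
Proof.
intros Ha HT. pose proof (Cmod_ge_0 z) as Pz.
assert (Na : RtoC alpha <> 0%C) by (intros E; apply RtoC_inj in E; lra).
apply Rle_trans with (sinh (Cmod z) - sinh (alpha * Cmod z) / alpha).
- pose proof (mean_value_inequality (fun w => csinh w - csinh (alpha * w) / alpha)%C
    (fun w => ccosh w - ccosh (alpha * w))%C
    (fun t => sinh (Cmod z * t) - / alpha * sinh (alpha * Cmod z * t))
    (fun t => Cmod z * (cosh (Cmod z * t) - cosh (alpha * Cmod z * t))) 0%C z) as K. cbv beta in K.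
  rewrite Cmult_0_r, csinh_0, !Rmult_1_r, !Rmult_0_r, sinh_0, Cplus_0_l in K.
  replace (csinh z - csinh (alpha * z) / alpha - (0 - 0 / alpha))%C
    with (csinh z - csinh (alpha * z) / alpha)%C in K by (field; exact Na).
  replace (sinh (Cmod z) - / alpha * sinh (alpha * Cmod z) - (0 - / alpha * 0))
    with (sinh (Cmod z) - sinh (alpha * Cmod z) / alpha) in K by (field; lra).
  apply K; intros t Ht.
  + rewrite Cplus_0_l. apply cderive_minus; [apply cderive_csinh|].
    eapply cderive_eq.
    * apply (cderive_mult (fun w => csinh (alpha * w)) (fun _ => / alpha)%C); [|apply cderive_const].
      apply (cderive_comp csinh (fun w => alpha * w)%C); [apply cderive_csinh|].
      apply cderive_mult; [apply cderive_const | apply cderive_id].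
    * cbv beta. field. exact Na.
  + eapply is_derive_eq.
    * apply (is_derive_minus (V := R_NormedModule)); [apply is_derive_sinh|].
      apply is_derive_scal. apply is_derive_sinh.
    * unfold minus, plus, opp; simpl. field. lra.
  + rewrite Cplus_0_l, Cmod_mult, Rmult_comm. apply Rmult_le_compat_l; [easy|].
    rewrite ccosh_sub_ccosh, cosh_sub_cosh, !Cmod_mult, Cmod_R, Rabs_pos_eq by lra.
    replace ((t * z + alpha * (t * z)) / 2)%C with ((t * (1 + alpha) / 2)%R * z)%C.
    2:{ rewrite RtoC_div, RtoC_mult, RtoC_plus by lra. field. }
    replace ((t * z - alpha * (t * z)) / 2)%C with ((t * (1 - alpha) / 2)%R * z)%C.
    2:{ rewrite RtoC_div, RtoC_mult, RtoC_minus by lra. field. }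
    assert (P1 : 0 <= t * (1 + alpha) / 2) by nra.
    assert (P2 : 0 <= t * (1 - alpha) / 2) by nra.
    rewrite !Rmult_assoc. apply Rmult_le_compat_l; [lra|].
    apply Rmult_le_compat; try apply Cmod_ge_0; (eapply Rle_trans; [apply Cmod_csinh_le|]);
      rewrite Cmod_mult, Cmod_R, Rabs_pos_eq by lra; right; f_equal; field.
- assert (K : - (sinh (1 * T) - / alpha * sinh (alpha * T)) <=
              - (sinh (1 * Cmod z) - / alpha * sinh (alpha * Cmod z))).
  { apply (decreasing_from_derive (fun t => - (sinh (1 * t) - / alpha * sinh (alpha * t)))
      (fun t => - (cosh (1 * t) - cosh (alpha * t)))); [easy| |].
    - intros t Ht. apply (is_derive_opp (V := R_NormedModule)). eapply is_derive_eq.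
      + apply (is_derive_minus (V := R_NormedModule)); [apply is_derive_sinh|].
        apply is_derive_scal. apply is_derive_sinh.
      + unfold minus, plus, opp; simpl. field. lra.
    - intros t Ht. pose proof (cosh_le (alpha * t) (1 * t)) as B.
      rewrite Rabs_pos_eq in B by nra. specialize (B ltac:(nra)). lra. }
  rewrite !Rmult_1_l in K. unfold Rdiv. lra.
Qed.

Lemma Re_cayley_pos (z : C) : Cmod z < 1 -> 0 < Re ((1 + z) / (1 - z)).
Proof.
intros Hz.
assert (N : (1 - z)%C <> 0%C).
{ apply Cmod_gt_0. pose proof (Cmod_minus_rev 1 z) as T. rewrite Cmod_1 in T. lra. }
assert (P : 0 < Cmod (1 - z) ^ 2) by (apply pow_lt; now apply Cmod_gt_0).
assert (E : Re ((1 + z) / (1 - z)) = (1 - Cmod z ^ 2) / Cmod (1 - z) ^ 2).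
{ rewrite !Cmod2_alt in *. destruct z as [x y]. simpl in *. field. lra. }
rewrite E. apply Rdiv_lt_0_compat; [|easy]. pose proof (Cmod_ge_0 z). nra.
Qed.

Lemma cderive_clog_cayley (z : C) : Cmod z < 1 ->
  is_cderive (fun w => clog ((1 + w) / (1 - w))) z (2 / (1 - z * z))%C.
Proof.
intros Hz.
assert (N : (1 - z)%C <> 0%C).
{ apply Cmod_gt_0. pose proof (Cmod_minus_rev 1 z) as T. rewrite Cmod_1 in T. lra. }
assert (N' : (1 + z)%C <> 0%C).
{ apply Cmod_gt_0. pose proof (Cmod_minus_rev 1 (- z)) as T. rewrite Cmod_1, Cmod_opp in T.
  replace (1 - - z)%C with (1 + z)%C in T by ring. lra. }
eapply cderive_eq.
- apply (cderive_comp clog (fun w => (1 + w) / (1 - w))%C).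
  + apply cderive_clog. now apply Re_cayley_pos.
  + apply (cderive_mult (fun w => 1 + w)%C (fun w => / (1 - w))%C).
    * apply cderive_plus; [apply cderive_const | apply cderive_id].
    * apply (cderive_inv (fun w => 1 - w)%C); [|easy].
      apply cderive_minus; [apply cderive_const | apply cderive_id].
- cbv beta. field. repeat split; try easy.
  replace (1 - z * z)%C with ((1 - z) * (1 + z))%C by ring. now apply Cmult_neq_0.
Qed.

(** The derivative [2 / (1 - w^2)] is at most [2 / (1 - |w|^2)] in modulus, and the right-hand side
    is the integral of that bound along the radius. *)
Lemma Cmod_clog_cayley_le (z : C) : Cmod z < 1 ->
  Cmod (clog ((1 + z) / (1 - z))) <= ln ((1 + Cmod z) / (1 - Cmod z)).
Proof.
intros Hz. pose proof (Cmod_ge_0 z) as Pz.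
pose proof (mean_value_inequality (fun w => clog ((1 + w) / (1 - w)))
  (fun w => 2 / (1 - w * w))%C (fun t => ln ((1 + Cmod z * t) / (1 - Cmod z * t)))
  (fun t => 2 * Cmod z / (1 - (Cmod z * t) ^ 2)) 0%C z) as K. cbv beta in K.
rewrite Cplus_0_l, Rmult_0_r, Rmult_1_r in K.
replace ((1 + 0) / (1 - 0))%C with (RtoC 1) in K by (field; intros E; apply RtoC_inj in E; lra).
replace ((1 + 0) / (1 - 0)) with 1 in K by field.
rewrite clog_1, ln_1, Rminus_0_r in K.
replace (clog ((1 + z) / (1 - z)) - 0)%C with (clog ((1 + z) / (1 - z))) in K by ring.
apply K; intros t Ht.
- rewrite Cplus_0_l. apply cderive_clog_cayley.
  rewrite Cmod_mult, Cmod_R, Rabs_pos_eq by easy. nra.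
- assert (0 <= Cmod z * t < 1) by nra.
  auto_derive.
  + split; [lra|]. split; [|easy]. apply Rdiv_lt_0_compat; lra.
  + field. repeat split; try nra; lra.
- rewrite Cplus_0_l.
  assert (M : Cmod (t * z * (t * z)) = (Cmod z * t) ^ 2).
  { rewrite !Cmod_mult, Cmod_R, Rabs_pos_eq by easy. ring. }
  assert (H : 0 <= Cmod z * t < 1) by nra.
  pose proof (Cmod_minus_rev 1 (t * z * (t * z))) as B. rewrite Cmod_1, M in B.
  assert (B' : 0 < 1 - (Cmod z * t) ^ 2) by nra.
  assert (N : (1 - t * z * (t * z))%C <> 0%C) by (apply Cmod_gt_0; lra).
  rewrite Cmod_mult, Cmod_div, Cmod_R, Rabs_pos_eq by (try easy; lra).
  unfold Rdiv. rewrite Rmult_assoc, (Rmult_comm (/ _)), <- Rmult_assoc.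
  apply Rmult_le_compat_l; [lra|]. apply Rinv_le_contravar; lra.
Qed.

(** * The upper bound *)

Lemma Re_pos_of_Arg (z : C) : z <> 0%C -> Rabs (Arg z) < PI / 2 -> 0 < Re z.
Proof.
intros Hz HA. destruct (Arg_spec z Hz) as [_ E]. rewrite E. simpl.
apply Rabs_def2 in HA.
apply Rmult_lt_0_compat; [now apply Cmod_gt_0 | apply cos_gt_0; lra].
Qed.

Lemma cexp_plus_1_neq_0 (l : C) : - PI / 2 < Im l < PI / 2 -> (cexp l + 1)%C <> 0%C.
Proof.
intros H E. apply Re_cexp_pos in H. apply (f_equal Re) in E. rewrite re_plus in E. simpl in E.
unfold cexp in *. simpl in *. lra.
Qed.

Definition tanh_half (l : C) : C := ((cexp l - 1) / (cexp l + 1))%C.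

Lemma Cmod_tanh_half_lt (l : C) : - PI / 2 < Im l < PI / 2 -> Cmod (tanh_half l) < 1.
Proof.
intros H. pose proof (cexp_plus_1_neq_0 l H) as N. pose proof (Re_cexp_pos l H) as P.
unfold tanh_half. rewrite Cmod_div by easy. apply Rlt_div_l; [now apply Cmod_gt_0|].
rewrite Rmult_1_l. apply Rsqr_incrst_0; [|apply Cmod_ge_0|apply Cmod_ge_0].
rewrite !Rsqr_pow2, !Cmod2_alt. destruct (cexp l) as [x y]. simpl in *. nra.
Qed.

Lemma cayley_tanh_half (l : C) : - PI / 2 < Im l < PI / 2 ->
  ((1 + tanh_half l) / (1 - tanh_half l))%C = cexp l.
Proof.
intros H. pose proof (cexp_plus_1_neq_0 l H) as N. unfold tanh_half. field.
split; [easy|].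
replace (cexp l + 1 - (cexp l - 1))%C with (RtoC 2) by ring. exact RtoC_2_neq_0.
Qed.

Lemma Cmod_le_artanh (l : C) : - PI / 2 < Im l < PI / 2 ->
  Cmod l <= ln ((1 + Cmod (tanh_half l)) / (1 - Cmod (tanh_half l))).
Proof.
intros H. rewrite <- (clog_cexp l H) at 1. rewrite <- cayley_tanh_half by easy.
apply Cmod_clog_cayley_le. now apply Cmod_tanh_half_lt.
Qed.

Lemma schwarzian_decomposition (alpha : R) (z T T' L L' w w' : C) : 0 < alpha < 1 ->
  - PI / 2 < Im L < PI / 2 ->
  (1 + z * T)%C = cexp (alpha * L) -> (T + z * T')%C = (alpha * L' * (1 + z * T))%C ->
  w = tanh_half L -> w' = (L' * (2 * cexp L / ((cexp L + 1) * (cexp L + 1))))%C ->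
  (z * z * (T' - / 2 * T ^ 2))%C =
  (2 * alpha * cexp (alpha * L) *
    ((z * w' - w) / (1 - w * w) + (csinh L - csinh (alpha * L) / alpha) / 2))%C.
Proof.
intros Ha HL HP HP' -> ->.
pose proof (cexp_plus_1_neq_0 L HL) as N. pose proof (cexp_neq_0 L) as N1.
pose proof (cexp_neq_0 (alpha * L)) as N2.
assert (Na : RtoC alpha <> 0%C) by (intros E; apply RtoC_inj in E; lra).
unfold csinh, tanh_half. rewrite !cexp_opp.
(* With [P = 1 + z T] this reads [z P' + (1 - P^2) / 2], so that [T] and [T'] can be eliminated;
   what remains is rational in [cexp L] and [cexp (alpha L)]. *)
replace (z * z * (T' - / 2 * T ^ 2))%C
  with (z * (T + z * T') + (1 - (1 + z * T) * (1 + z * T)) / 2)%C by field.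
rewrite HP', HP. field. repeat split; try easy.
replace ((cexp L + 1) * (cexp L + 1) - (cexp L - 1) * (cexp L - 1))%C with (4 * cexp L)%C by ring.
apply Cmult_neq_0; [|easy]. intros E. apply RtoC_inj in E. lra.
Qed.

Lemma schwarzian_bound_nonzero (alpha : R) (T T' : C -> C) : 0 < alpha < 1 ->
  holo 2 unit_disk T -> (forall z, unit_disk z -> is_cderive T z (T' z)) ->
  (forall z, unit_disk z -> (1 + z * T z)%C <> 0%C) ->
  (forall z, unit_disk z -> Rabs (Arg (1 + z * T z)) < PI * alpha / 2) ->
  forall z, unit_disk z -> z <> 0%C ->
  (1 - Cmod z ^ 2) ^ 2 * Cmod (T' z - / 2 * T z ^ 2) <= 2 * alpha.
Proof.
intros Ha HT HT' HN HA z Hz Nz. pose proof PI_RGT_0 as HPI.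
set (P := fun v => (1 + v * T v)%C).
assert (HP : holo 2 unit_disk P).
{ apply holo_plus; [apply holo_const | apply holo_mult; [apply holo_id | easy]]. }
(* As [alpha < 1], the sector lies in the right half-plane, where the principal logarithm is
   holomorphic. *)
assert (RP : forall v, unit_disk v -> 0 < Re (P v)).
{ intros v Hv. apply Re_pos_of_Arg; [now apply HN|]. specialize (HA v Hv). unfold P. nra. }
assert (Na : RtoC alpha <> 0%C) by (intros E; apply RtoC_inj in E; lra).
set (L := fun v => (clog (P v) * / alpha)%C).
assert (HL : holo 2 unit_disk L) by (apply holo_mult; [now apply holo_clog | apply holo_const]).
assert (IL : forall v, unit_disk v -> - PI / 2 < Im (L v) < PI / 2).
{ intros v Hv. unfold L. rewrite <- RtoC_inv, im_scal_r by lra.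
  change (Im (clog (P v))) with (Arg (P v)).
  specialize (HA v Hv). fold (P v) in HA. apply Rabs_def2 in HA.
  split; [apply Rlt_div_r with (c := alpha) | apply Rlt_div_l]; try lra. }
assert (EL : forall v, (alpha * L v)%C = clog (P v)) by (intros v; unfold L; field; exact Na).
set (w := fun v => tanh_half (L v)).
assert (Hw : holo 2 unit_disk w).
{ apply holo_div.
  - intros v Hv. apply cexp_plus_1_neq_0. auto.
  - apply holo_minus; [now apply holo_cexp | apply holo_const].
  - apply holo_plus; [now apply holo_cexp | apply holo_const]. }
assert (Hw0 : w 0%C = 0%C).
{ unfold w, L, P. rewrite Cmult_0_l, Cplus_0_r, clog_1, Cmult_0_l. unfold tanh_half.
  rewrite cexp_0. unfold Cdiv. ring. }
assert (Hw1 : forall v, unit_disk v -> Cmod (w v) < 1).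
{ intros v Hv. apply Cmod_tanh_half_lt. auto. }
set (L' := ((T z + z * T' z) * / P z * / alpha)%C).
assert (NP : P z <> 0%C) by now apply HN.
assert (DL : is_cderive L z L').
{ eapply cderive_eq.
  - apply (cderive_mult (fun v => clog (P v)) (fun _ => / alpha)%C); [|apply cderive_const].
    apply cderive_comp; [apply cderive_clog; auto|].
    apply cderive_plus; [apply cderive_const|].
    apply cderive_mult; [apply cderive_id | auto].
  - unfold L'. cbv beta. ring. }
set (w' := (L' * (2 * cexp (L z) / ((cexp (L z) + 1) * (cexp (L z) + 1))))%C).
assert (NE : (cexp (L z) + 1)%C <> 0%C) by (apply cexp_plus_1_neq_0; auto).
assert (Dw : is_cderive w z w').
{ assert (DE : is_cderive (fun v => cexp (L v)) z (L' * cexp (L z))%C)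
    by (apply cderive_comp; [apply cderive_cexp | exact DL]).
  eapply cderive_eq.
  - apply (cderive_mult (fun v => cexp (L v) - 1)%C (fun v => / (cexp (L v) + 1))%C).
    + apply cderive_minus; [exact DE | apply cderive_const].
    + apply (cderive_inv (fun v => cexp (L v) + 1)%C); [|easy].
      apply cderive_plus; [exact DE | apply cderive_const].
  - unfold w'. cbv beta. field. easy. }
pose proof (dieudonne_lemma w (fun _ => w') z Hw Hw0 Hw1 Hz Nz Dw) as DD. cbv beta in DD.
pose proof (schwarzian_decomposition alpha z (T z) (T' z) (L z) L' (w z) w' Ha (IL z Hz)) as E.
specialize (E ltac:(rewrite EL, cexp_clog by easy; reflexivity)).
specialize (E ltac:(unfold L', P; field; split; [exact Na | exact NP]) eq_refl eq_refl).
apply (f_equal Cmod) in E. rewrite !Cmod_mult in E.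
set (S := Cmod (T' z - / 2 * T z ^ 2)) in *.
set (s := Cmod (w z)) in *. set (x := Cmod z ^ 2) in *.
assert (Hs : 0 <= s < 1) by (split; [apply Cmod_ge_0 | now apply Hw1]).
assert (Pz : 0 < Cmod z) by now apply Cmod_gt_0.
unfold unit_disk in Hz.
assert (Hx : 0 < x < 1) by (unfold x; nra).
set (T0 := ln ((1 + s) / (1 - s))).
assert (LT : Cmod (L z) <= T0) by (apply Cmod_le_artanh; auto).
rewrite !Cmod_R, !Rabs_pos_eq in E by lra.
assert (BE : Cmod (cexp (alpha * L z)) <= exp (alpha * T0)).
{ rewrite Cmod_cexp, re_scal_l. apply exp_le. apply Rmult_le_compat_l; [lra|].
  pose proof (Re_le_Cmod (L z)). lra. }
assert (ND : 1 - s ^ 2 <= Cmod (1 - w z * w z)).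
{ pose proof (Cmod_minus_rev 1 (w z * w z)) as B. rewrite Cmod_1, Cmod_mult in B. fold s in B. lra. }
assert (Ps : 0 < 1 - s ^ 2) by nra.
assert (B1 : Cmod ((z * w' - w z) / (1 - w z * w z)) <= (x - s ^ 2) / (1 - x) / (1 - s ^ 2)).
{ rewrite Cmod_div by (apply Cmod_gt_0; lra).
  apply Rmult_le_compat; [apply Cmod_ge_0 | left; apply Rinv_0_lt_compat; lra | |].
  - apply Rle_div_r; [lra|]. exact DD.
  - apply Rinv_le_contravar; lra. }
assert (B2 : Cmod ((csinh (L z) - csinh (alpha * L z) / alpha) / 2) <=
   (sinh T0 - sinh (alpha * T0) / alpha) / 2).
{ rewrite Cmod_div, Cmod_R, Rabs_pos_eq by (try exact RtoC_2_neq_0; lra).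
  apply Rmult_le_compat_r; [lra|]. now apply Cmod_csinh_sub_le. }
pose proof (sector_inequality alpha s x T0 Ha Hs ltac:(lra) eq_refl) as Q.
set (E0 := exp (alpha * T0)) in *. set (D0 := (sinh T0 - sinh (alpha * T0) / alpha) / 2) in *.
assert (B3 : x * S <= 2 * alpha * (E0 * ((x - s ^ 2) / (1 - x) / (1 - s ^ 2) + D0))).
{ replace (x * S) with (Cmod z * Cmod z * S) by (unfold x; ring). rewrite E, !Rmult_assoc.
  apply Rmult_le_compat_l; [lra|]. apply Rmult_le_compat_l; [lra|].
  apply Rmult_le_compat; [apply Cmod_ge_0 | apply Cmod_ge_0 | easy |].
  eapply Rle_trans; [apply Cmod_triangle|]. lra. }
apply Rmult_le_reg_l with x; [lra|].
apply Rle_trans with ((1 - x) ^ 2 * (2 * alpha * (E0 * ((x - s ^ 2) / (1 - x) / (1 - s ^ 2) + D0)))).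
{ replace (x * ((1 - x) ^ 2 * S)) with ((1 - x) ^ 2 * (x * S)) by ring.
  apply Rmult_le_compat_l; [apply pow2_ge_0 | easy]. }
(* This is [2 alpha] times the left side of [sector_inequality]; its bound [x] cancels the factor
   [x = |z|^2] that came with the decomposition. *)
replace ((1 - x) ^ 2 * (2 * alpha * (E0 * ((x - s ^ 2) / (1 - x) / (1 - s ^ 2) + D0))))
  with (2 * alpha * ((1 - x) * (x - s ^ 2) * (E0 / (1 - s ^ 2)) + (1 - x) ^ 2 * (E0 * D0)))
  by (field; lra).
rewrite (Rmult_comm x). apply Rmult_le_compat_l; lra.
Qed.

(** At the origin the decomposition reads [0 = 0]; the bound is carried there from small positive
    reals [h] by continuity of [T' - T^2 / 2]. *)
Lemma schwarzian_bound (alpha : R) (T T' : C -> C) : 0 < alpha < 1 ->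
  holo 2 unit_disk T -> (forall z, unit_disk z -> is_cderive T z (T' z)) -> ccont T' 0%C ->
  (forall z, unit_disk z -> (1 + z * T z)%C <> 0%C) ->
  (forall z, unit_disk z -> Rabs (Arg (1 + z * T z)) < PI * alpha / 2) ->
  forall z, unit_disk z ->
  (1 - Cmod z ^ 2) ^ 2 * Cmod (T' z - / 2 * T z ^ 2) <= 2 * alpha.
Proof.
intros Ha HT HT' HT'0 HN HA z Hz.
destruct (Ceq_dec z 0%C) as [-> | Nz]; [|now apply schwarzian_bound_nonzero].
set (S := fun v => (T' v - / 2 * T v ^ 2)%C). change (T' 0 - / 2 * T 0 ^ 2)%C with (S 0%C).
assert (HS : forall eps, 0 < eps -> exists d, 0 < d /\ forall h, Cmod h < d -> Cmod (S h - S 0%C) < eps).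
{ intros eps Heps.
  assert (HQ : ccont (fun v => / 2 * T v ^ 2)%C 0%C).
  { apply (holo_cont unit_disk); [|exact Hz]. apply holo_mult; [apply holo_const|].
    apply holo_pow. now apply holo_weaken. }
  destruct (HT'0 (eps / 2)) as [d1 [Hd1 D1]]; [lra|].
  destruct (HQ (eps / 2)) as [d2 [Hd2 D2]]; [lra|].
  exists (Rmin d1 d2); split; [now apply Rmin_pos|]. intros h Hh.
  specialize (D1 h (Rlt_le_trans _ _ _ Hh (Rmin_l _ _))).
  specialize (D2 h (Rlt_le_trans _ _ _ Hh (Rmin_r _ _))).
  rewrite Cplus_0_l in D1, D2. unfold S.
  replace (T' h - / 2 * T h ^ 2 - (T' 0 - / 2 * T 0 ^ 2))%C
    with ((T' h - T' 0) + - (/ 2 * T h ^ 2 - / 2 * T 0 ^ 2))%C by ring.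
  eapply Rle_lt_trans; [apply Cmod_triangle|]. rewrite Cmod_opp. lra. }
rewrite Cmod_0. replace ((1 - 0 ^ 2) ^ 2) with 1 by ring. rewrite Rmult_1_l.
apply le_epsilon. intros eta Heta.
pose proof (Cmod_ge_0 (S 0%C)) as PS.
(* Because [(1 - h^2)^2 >= 1 - 2 h] and [h <= e / 2], the total loss is at most
   [2 h |S 0| + e <= e (1 + |S 0|)], which is at most [eta]. *)
set (e := eta / (1 + 2 * Cmod (S 0%C))).
assert (He : 0 < e) by (apply Rdiv_lt_0_compat; lra).
assert (He' : e * (1 + 2 * Cmod (S 0%C)) = eta) by (unfold e; field; lra).
destruct (HS e He) as [d [Hd D]].
set (h := Rmin (Rmin d e) (1 / 2) / 2).
pose proof (Rmin_l (Rmin d e) (1 / 2)). pose proof (Rmin_r (Rmin d e) (1 / 2)).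
pose proof (Rmin_l d e). pose proof (Rmin_r d e).
assert (Hh : 0 < h). { unfold h. apply Rdiv_lt_0_compat; [|lra]. apply Rmin_pos; [now apply Rmin_pos | lra]. }
assert (Mh : Cmod h = h) by (rewrite Cmod_R; apply Rabs_pos_eq; lra).
specialize (D h). rewrite Mh in D. specialize (D ltac:(unfold h in *; lra)).
pose proof (schwarzian_bound_nonzero alpha T T' Ha HT HT' HN HA h) as K. rewrite Mh in K.
specialize (K ltac:(unfold unit_disk; rewrite Mh; unfold h in *; lra)).
specialize (K ltac:(intros E; apply RtoC_inj in E; lra)). fold (S h) in K.
pose proof (Cmod_minus_rev (S 0%C) (S h)) as B. rewrite (Cmod_minus_sym (S 0%C)) in B.
pose proof (Cmod_ge_0 (S h)) as PSh.
assert (Hh1 : h <= e / 2) by (unfold h in *; lra).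
assert (Hh2 : h <= 1 / 4) by (unfold h in *; lra).
assert (K2 : (1 - 2 * h) * Cmod (S h) <= 2 * alpha).
{ eapply Rle_trans; [|exact K]. apply Rmult_le_compat_r; [easy|]. nra. }
assert (K3 : (1 - 2 * h) * (Cmod (S 0%C) - e) <= 2 * alpha).
{ eapply Rle_trans; [|exact K2]. apply Rmult_le_compat_l; lra. }
assert (h * Cmod (S 0%C) <= e / 2 * Cmod (S 0%C)) by (apply Rmult_le_compat_r; lra).
nra.
Qed.

(** * Complex power series *)

(** Coordinatewise convergence makes the real theorems on comparison, shifts and Cauchy products
    available; [is_series_C] ties it to the convergence in [is_pseries]. *)
Definition is_cseries (c : nat -> C) (l : C) : Prop :=
  is_series (fun n => Re (c n)) (Re l) /\ is_series (fun n => Im (c n)) (Im l).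

Lemma sum_n_C (c : nat -> C) (n : nat) :
  sum_n (G := C_AbelianGroup) c n = (sum_n (fun k => Re (c k)) n, sum_n (fun k => Im (c k)) n).
Proof.
induction n as [|n IH].
- rewrite !sum_O. now destruct (c 0%nat).
- rewrite !sum_Sn, IH. reflexivity.
Qed.

Lemma is_series_C (c : nat -> C) (l : C) :
  @is_series C_AbsRing C_NormedModule c l <-> is_cseries c l.
Proof.
unfold is_cseries, is_series.
rewrite !(filterlim_locally (U := R_UniformSpace)).
rewrite (filterlim_locally (U := C_UniformSpace)).
assert (E : forall n (e : posreal), ball (M := C_UniformSpace) l e (sum_n (G := C_AbelianGroup) c n) <->
  ball (Re l) e (sum_n (fun k => Re (c k)) n) /\ ball (Im l) e (sum_n (fun k => Im (c k)) n)).
{ intros n e. rewrite sum_n_C. reflexivity. }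
split.
- intros H. split; intros e; destruct (H e) as [N HN]; exists N; intros n Hn;
    specialize (HN n Hn); apply (E n e) in HN; apply HN.
- intros [H1 H2] e. destruct (H1 e) as [N1 HN1], (H2 e) as [N2 HN2].
  exists (N1 + N2)%nat. intros n Hn. apply (E n e). split; [apply HN1 | apply HN2]; lia.
Qed.

Lemma is_cseries_ext (c c' : nat -> C) (l : C) :
  (forall n, c n = c' n) -> is_cseries c l -> is_cseries c' l.
Proof.
intros E [H1 H2]. split.
- apply is_series_ext with (2 := H1). intros n. now rewrite E.
- apply is_series_ext with (2 := H2). intros n. now rewrite E.
Qed.

Lemma is_cseries_unique (c : nat -> C) (l l' : C) : is_cseries c l -> is_cseries c l' -> l = l'.
Proof.
intros [H1 H2] [H3 H4]. apply is_series_unique in H1, H2, H3, H4.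
destruct l, l'. simpl in *. congruence.
Qed.

Lemma is_cseries_plus (c c' : nat -> C) (l l' : C) :
  is_cseries c l -> is_cseries c' l' -> is_cseries (fun n => c n + c' n)%C (l + l')%C.
Proof.
intros [H1 H2] [H3 H4]. split.
- exact (is_series_plus _ _ _ _ H1 H3).
- exact (is_series_plus _ _ _ _ H2 H4).
Qed.

Lemma is_cseries_scal (k : C) (c : nat -> C) (l : C) :
  is_cseries c l -> is_cseries (fun n => k * c n)%C (k * l)%C.
Proof.
intros [H1 H2]. split.
- exact (is_series_minus _ _ _ _ (is_series_scal_l (Re k) _ _ H1) (is_series_scal_l (Im k) _ _ H2)).
- exact (is_series_plus _ _ _ _ (is_series_scal_l (Re k) _ _ H2) (is_series_scal_l (Im k) _ _ H1)).
Qed.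

Lemma is_cseries_minus (c c' : nat -> C) (l l' : C) :
  is_cseries c l -> is_cseries c' l' -> is_cseries (fun n => c n - c' n)%C (l - l')%C.
Proof.
intros [H1 H2] [H3 H4]. split.
- exact (is_series_minus _ _ _ _ H1 H3).
- exact (is_series_minus _ _ _ _ H2 H4).
Qed.

Lemma is_series_cons (u : nat -> R) (l : R) :
  is_series (fun n => u (S n)) l -> is_series u (u 0%nat + l).
Proof.
intros H. apply is_series_decr_1.
change (is_series (fun n => u (S n)) ((u 0%nat + l) + - u 0%nat)).
replace ((u 0%nat + l) + - u 0%nat) with l by ring. exact H.
Qed.

Lemma is_cseries_cons (c : nat -> C) (l : C) :
  is_cseries (fun n => c (S n)) l -> is_cseries c (c 0%nat + l)%C.
Proof.
intros [H1 H2]. split.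
- rewrite re_plus. exact (is_series_cons (fun n => Re (c n)) _ H1).
- rewrite im_plus. exact (is_series_cons (fun n => Im (c n)) _ H2).
Qed.

Lemma is_series_zero (u : nat -> R) : (forall n, u n = 0) -> is_series u 0.
Proof.
intros H. change (is_lim_seq (sum_n u) 0).
apply is_lim_seq_ext with (fun _ => 0); [|apply is_lim_seq_const].
intros n. induction n as [|n IH]; [now rewrite sum_O, H|].
rewrite sum_Sn, <- IH, H. unfold plus; simpl. ring.
Qed.

Lemma is_series_le_limit (u b : nat -> R) (p m : R) :
  (forall n, u n <= b n) -> is_series u p -> is_series b m -> p <= m.
Proof.
intros H Hu Hb.
change (Rbar_le p m). apply is_lim_seq_le with (sum_n u) (sum_n b); [|exact Hu | exact Hb].
intros n. now apply sum_n_m_le.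
Qed.

(** Working by coordinates would cost a constant. Testing against [conj l] instead gives
    [|l|^2 = sum Re (conj l * c n) <= |l| m]. *)
Lemma is_cseries_le (c : nat -> C) (b : nat -> R) (l : C) (m : R) :
  (forall n, Cmod (c n) <= b n) -> is_cseries c l -> is_series b m -> Cmod l <= m.
Proof.
intros H [H1 H2] Hb.
pose proof (is_series_plus _ _ _ _ (is_series_scal_l (Re l) _ _ H1) (is_series_scal_l (Im l) _ _ H2)) as K.
pose proof (is_series_scal_l (Cmod l) _ _ Hb) as K'.
pose proof (Cmod_ge_0 l) as P.
assert (B : Re l * Re l + Im l * Im l <= Cmod l * m).
{ eapply is_series_le_limit; [|exact K | exact K'].
  intros n. change (Re l * Re (c n) + Im l * Im (c n) <= Cmod l * b n).
  replace (Re l * Re (c n) + Im l * Im (c n)) with (Re (Cconj l * c n))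
    by (destruct l, (c n); simpl; ring).
  eapply Rle_trans; [apply Re_le_Cmod|]. rewrite Cmod_mult, Cmod_conj.
  apply Rmult_le_compat_l; auto. }
assert (E : Cmod l ^ 2 = Re l ^ 2 + Im l ^ 2) by apply Cmod2_alt.
destruct (Rle_lt_or_eq_dec _ _ P) as [P' | P'].
- apply Rmult_le_reg_l with (Cmod l); [easy|]. nra.
- rewrite <- P'. eapply is_series_le_limit with (2 := is_series_zero (fun _ => 0) (fun _ => eq_refl)) (3 := Hb).
  intros n. eapply Rle_trans; [apply Cmod_ge_0 | apply H].
Qed.

(** * Majorants and differentiation of power series *)

Definition CPSeries (a : nat -> C) (z : C) : C :=
  (Series (fun n => Re (z ^ n * a n)%C), Series (fun n => Im (z ^ n * a n)%C)).

Definition Cabs (a : nat -> C) (n : nat) : R := Cmod (a n).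

(** The radius is that of the series of moduli, so the real function [PSeries (Cabs a)] is a
    majorant wherever this holds. *)
Definition in_radius (a : nat -> C) (x : R) : Prop := Rbar_lt (Rabs x) (CV_radius (Cabs a)).

Lemma Cmod_pow_mult (z a : C) (n : nat) : Cmod (z ^ n * a) = Cmod a * Cmod z ^ n.
Proof. rewrite Cmod_mult, Cmod_pow. ring. Qed.

Lemma in_radius_le (a : nat -> C) (x y : R) : Rabs x <= Rabs y -> in_radius a y -> in_radius a x.
Proof. intros H. unfold in_radius. apply Rbar_le_lt_trans. exact H. Qed.

Lemma PSeries_is_series (a : nat -> R) (x : R) : Rbar_lt (Rabs x) (CV_radius a) ->
  is_series (fun n => a n * x ^ n) (PSeries a x).
Proof.
intros H. apply (proj1 (is_pseries_R a x (PSeries a x))).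
apply PSeries_correct. now apply CV_radius_inside.
Qed.

Lemma CPSeries_correct (a : nat -> C) (z : C) : in_radius a (Cmod z) ->
  is_cseries (fun n => z ^ n * a n)%C (CPSeries a z).
Proof.
intros H. apply PSeries_is_series in H.
split; apply Series_correct; eapply (ex_series_le (V := R_CompleteNormedModule));
  try (eexists; exact H); intros n; cbv beta; unfold Cabs; rewrite <- Cmod_pow_mult.
- exact (re_le_Cmod (z ^ n * a n)).
- exact (Im_le_Cmod (z ^ n * a n)).
Qed.

Lemma CPSeries_unique (a : nat -> C) (z l : C) :
  is_cseries (fun n => z ^ n * a n)%C l -> CPSeries a z = l.
Proof.
intros [H1 H2]. unfold CPSeries. apply is_series_unique in H1, H2. rewrite H1, H2. now destruct l.
Qed.

Lemma CPSeries_le (a : nat -> C) (z : C) : in_radius a (Cmod z) ->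
  Cmod (CPSeries a z) <= PSeries (Cabs a) (Cmod z).
Proof.
intros H. eapply is_cseries_le; [|now apply CPSeries_correct | now apply PSeries_is_series].
intros n. cbv beta. rewrite Cmod_pow_mult. apply Rle_refl.
Qed.

Lemma is_cseries_at_0 (a : nat -> C) : is_cseries (fun n => 0 ^ n * a n)%C (a 0%nat).
Proof.
assert (E : forall u : nat -> R, (forall n, u (S n) = 0) -> is_series u (u 0%nat)).
{ intros u Hu. rewrite <- (Rplus_0_r (u 0%nat)). apply is_series_cons. now apply is_series_zero. }
split.
- replace (Re (a 0%nat)) with (Re (0 ^ 0 * a 0%nat)%C) by (f_equal; simpl; ring).
  apply (E (fun n => Re (0 ^ n * a n)%C)). intros n. rewrite Cpow_S, !Cmult_0_l. reflexivity.
- replace (Im (a 0%nat)) with (Im (0 ^ 0 * a 0%nat)%C) by (f_equal; simpl; ring).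
  apply (E (fun n => Im (0 ^ n * a n)%C)). intros n. rewrite Cpow_S, !Cmult_0_l. reflexivity.
Qed.

Lemma CPSeries_0 (a : nat -> C) : CPSeries a 0%C = a 0%nat.
Proof. apply CPSeries_unique, is_cseries_at_0. Qed.

Definition CPS_derive (a : nat -> C) (n : nat) : C := (INR (S n) * a (S n))%C.

Lemma Cabs_derive (a : nat -> C) (n : nat) : Cabs (CPS_derive a) n = PS_derive (Cabs a) n.
Proof.
unfold Cabs, CPS_derive, PS_derive. rewrite Cmod_mult, Cmod_R, Rabs_pos_eq; [easy | apply pos_INR].
Qed.

Lemma in_radius_derive (a : nat -> C) (x : R) : in_radius (CPS_derive a) x <-> in_radius a x.
Proof.
unfold in_radius. rewrite (CV_radius_ext _ _ (Cabs_derive a)), CV_radius_derive. reflexivity.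
Qed.

(* The binomial remainder [(z+h)^n - z^n - n h z^(n-1)] is a polynomial with nonnegative coefficients. *)
Lemma pow_remainder_le (z h : C) (n : nat) :
  Cmod ((z + h) ^ n - z ^ n)%C <= (Cmod z + Cmod h) ^ n - Cmod z ^ n /\
  Cmod ((z + h) ^ S n - z ^ S n - h * (INR (S n) * z ^ n))%C <=
    (Cmod z + Cmod h) ^ S n - Cmod z ^ S n - Cmod h * (INR (S n) * Cmod z ^ n).
Proof.
pose proof (Cmod_ge_0 z) as Pz. pose proof (Cmod_ge_0 h) as Ph.
induction n as [|n [IH1 IH2]].
- split.
  + simpl. replace (1 - 1)%C with (RtoC 0) by ring. rewrite Cmod_0. lra.
  + simpl. replace ((z + h) * 1 - z * 1 - h * (1 * 1))%C with (RtoC 0) by ring. rewrite Cmod_0. lra.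
- assert (D : Cmod ((z + h) ^ S n - z ^ S n)%C <= (Cmod z + Cmod h) ^ S n - Cmod z ^ S n).
  { rewrite !Cpow_S.
    replace ((z + h) * (z + h) ^ n - z * z ^ n)%C with ((z + h) * ((z + h) ^ n - z ^ n) + h * z ^ n)%C by ring.
    eapply Rle_trans; [apply Cmod_triangle|]. rewrite !Cmod_mult, (Cmod_pow z).
    pose proof (Cmod_triangle z h) as T. pose proof (Cmod_ge_0 ((z + h) ^ n - z ^ n)) as P.
    assert (Cmod (z + h) * Cmod ((z + h) ^ n - z ^ n) <=
      (Cmod z + Cmod h) * ((Cmod z + Cmod h) ^ n - Cmod z ^ n))
      by (apply Rmult_le_compat; try easy; apply Cmod_ge_0).
    simpl. lra. }
  split; [exact D|].
  rewrite (S_INR (S n)), RtoC_plus.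
  replace ((z + h) ^ S (S n) - z ^ S (S n) - h * ((INR (S n) + 1) * z ^ S n))%C
    with (z * ((z + h) ^ S n - z ^ S n - h * (INR (S n) * z ^ n)) + h * ((z + h) ^ S n - z ^ S n))%C
    by (rewrite !(Cpow_S _ (S n)), !(Cpow_S z n); ring).
  eapply Rle_trans; [apply Cmod_triangle|]. rewrite !Cmod_mult.
  apply Rmult_le_compat_l with (r := Cmod z) in IH2; [|easy].
  apply Rmult_le_compat_l with (r := Cmod h) in D; [|easy].
  simpl pow in *. lra.
Qed.

(** The first-order remainder is dominated, term by term, by that of the real majorant; complex
    differentiability then follows from the real differentiability of [PSeries]. *)
Lemma CPSeries_remainder_le (a : nat -> C) (z h : C) : in_radius a (Cmod z + Cmod h) ->
  Cmod (CPSeries a (z + h) - CPSeries a z - h * CPSeries (CPS_derive a) z) <=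
  PSeries (Cabs a) (Cmod z + Cmod h) - PSeries (Cabs a) (Cmod z)
    - Cmod h * PSeries (PS_derive (Cabs a)) (Cmod z).
Proof.
intros H. pose proof (Cmod_ge_0 z) as Pz. pose proof (Cmod_ge_0 h) as Ph.
assert (Hz : in_radius a (Cmod z)) by (apply in_radius_le with (2 := H); rewrite !Rabs_pos_eq; lra).
assert (Hzh : in_radius a (Cmod (z + h))).
{ apply in_radius_le with (2 := H). pose proof (Cmod_triangle z h). pose proof (Cmod_ge_0 (z + h)).
  rewrite !Rabs_pos_eq; lra. }
assert (Hd : Rbar_lt (Rabs (Cmod z)) (CV_radius (PS_derive (Cabs a)))).
{ rewrite CV_radius_derive. exact Hz. }
(* The differentiated series is shifted by one, with a leading 0, so that all the series pair the
   same coefficient [a n] at index [n]. *)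
set (dt := fun n => match n with O => RtoC 0 | S m => (z ^ m * CPS_derive a m)%C end).
set (dr := fun n => match n with O => 0 | S m => PS_derive (Cabs a) m * Cmod z ^ m end).
assert (D1 : is_cseries dt (CPSeries (CPS_derive a) z)).
{ replace (CPSeries (CPS_derive a) z) with (dt 0%nat + CPSeries (CPS_derive a) z)%C by (simpl; ring).
  apply is_cseries_cons. apply CPSeries_correct. now apply in_radius_derive. }
assert (D2 : is_series dr (PSeries (PS_derive (Cabs a)) (Cmod z))).
{ rewrite <- (Rplus_0_l (PSeries _ _)). apply (is_series_cons dr).
  now apply PSeries_is_series. }
eapply is_cseries_le.
2:{ apply is_cseries_minus; [apply is_cseries_minus|apply is_cseries_scal; exact D1].
    - apply CPSeries_correct. exact Hzh.
    - apply CPSeries_correct. exact Hz. }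
2:{ exact (is_series_minus _ _ _ _ (is_series_minus _ _ _ _ (PSeries_is_series _ _ H)
      (PSeries_is_series _ _ Hz)) (is_series_scal_l (Cmod h) _ _ D2)). }
intros n.
change (Cmod ((z + h) ^ n * a n - z ^ n * a n - h * dt n) <=
  Cabs a n * (Cmod z + Cmod h) ^ n - Cabs a n * Cmod z ^ n - Cmod h * dr n).
destruct n as [|n].
- simpl. replace (1 * a 0%nat - 1 * a 0%nat - h * 0)%C with (RtoC 0) by ring. rewrite Cmod_0. lra.
- unfold dt, dr, CPS_derive, PS_derive, Cabs.
  replace ((z + h) ^ S n * a (S n) - z ^ S n * a (S n) - h * (z ^ n * (INR (S n) * a (S n))))%C
    with (((z + h) ^ S n - z ^ S n - h * (INR (S n) * z ^ n)) * a (S n))%C by ring.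
  rewrite Cmod_mult.
  pose proof (proj2 (pow_remainder_le z h n)) as B.
  apply Rmult_le_compat_r with (r := Cmod (a (S n))) in B; [|apply Cmod_ge_0].
  lra.
Qed.

Lemma in_radius_extend (a : nat -> C) (x : R) : 0 <= x -> in_radius a x ->
  exists d, 0 < d /\ in_radius a (x + d).
Proof.
unfold in_radius. intros Hx. rewrite Rabs_pos_eq by easy.
destruct (CV_radius (Cabs a)) as [r | | ]; simpl; intros H.
- exists ((r - x) / 2). split; [lra|]. rewrite Rabs_pos_eq; lra.
- exists 1. split; [lra | easy].
- easy.
Qed.

Lemma cderive_CPSeries (a : nat -> C) (z : C) : in_radius a (Cmod z) ->
  is_cderive (CPSeries a) z (CPSeries (CPS_derive a) z).
Proof.
intros H. pose proof (Cmod_ge_0 z) as Pz.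
pose proof (is_derive_PSeries _ _ H) as D. rewrite is_deriveP in D.
destruct (in_radius_extend a _ Pz H) as [e [He He']].
rewrite is_cderiveP. intros eps Heps. destruct (D eps Heps) as [d [Hd K]].
exists (Rmin d e); split; [now apply Rmin_pos|]. intros h Hh.
pose proof (Cmod_ge_0 h) as Ph.
assert (Hh1 := Rlt_le_trans _ _ _ Hh (Rmin_l _ _)).
assert (Hh2 := Rlt_le_trans _ _ _ Hh (Rmin_r _ _)).
eapply Rle_trans.
- apply CPSeries_remainder_le. apply in_radius_le with (2 := He'). rewrite !Rabs_pos_eq; lra.
- specialize (K (Cmod h)). rewrite Rabs_pos_eq in K by easy. specialize (K Hh1).
  apply Rabs_le_between in K. lra.
Qed.

Lemma Cpow_pow_n (z : C) (n : nat) : @pow_n C_Ring z n = (z ^ n)%C.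
Proof. induction n as [|n IH]; [easy|]. simpl. rewrite IH. reflexivity. Qed.

Lemma is_pseries_C (a : nat -> C) (z l : C) :
  @is_pseries C_AbsRing C_NormedModule a z l <-> is_cseries (fun n => z ^ n * a n)%C l.
Proof.
rewrite <- is_series_C. unfold is_pseries. split; apply is_series_ext; intros n.
- exact (f_equal (fun w => w * a n)%C (Cpow_pow_n z n)).
- exact (eq_sym (f_equal (fun w => w * a n)%C (Cpow_pow_n z n))).
Qed.

Lemma bounded_of_lim_0 (u : nat -> R) : is_lim_seq u 0 -> exists M, forall n, Rabs (u n) <= M.
Proof.
intros H. apply is_lim_seq_spec in H. destruct (H (mkposreal 1 Rlt_0_1)) as [N HN]. simpl in HN.
assert (B : forall m, exists M, forall n, (n < m)%nat -> Rabs (u n) <= M).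
{ induction m as [|m [M HM]]; [exists 0; lia|].
  exists (Rmax M (Rabs (u m))). intros n Hn.
  destruct (Nat.eq_dec n m) as [-> | Ne]; [apply Rmax_r|].
  eapply Rle_trans; [apply HM; lia | apply Rmax_l]. }
destruct (B N) as [M HM]. exists (Rmax M 1). intros n.
destruct (Nat.lt_ge_cases n N) as [L | L].
- eapply Rle_trans; [apply HM, L | apply Rmax_l].
- specialize (HN n L). rewrite Rminus_0_r in HN. eapply Rle_trans; [|apply Rmax_r]. lra.
Qed.

(** Abel's argument: at a real point [y] strictly between [x] and [r] the terms tend to 0, hence are
    bounded, and the radius of the moduli is at least [y]. *)
Lemma in_radius_of_converges (a : nat -> C) (r x : R) : 0 <= x < r ->
  (forall h : C, Cmod h < r -> exists l, is_cseries (fun n => h ^ n * a n)%C l) -> in_radius a x.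
Proof.
intros Hx H. unfold in_radius. rewrite Rabs_pos_eq by lra.
set (y := (x + r) / 2).
assert (My : Cmod y = y) by (rewrite Cmod_R; apply Rabs_pos_eq; unfold y; lra).
destruct (H y) as [l [H1 H2]]; [rewrite My; unfold y; lra|].
destruct (bounded_of_lim_0 (fun n => Re (y ^ n * a n)%C)) as [M1 B1].
{ apply ex_series_lim_0. eexists. exact H1. }
destruct (bounded_of_lim_0 (fun n => Im (y ^ n * a n)%C)) as [M2 B2].
{ apply ex_series_lim_0. eexists. exact H2. }
apply Rbar_lt_le_trans with y; [simpl; unfold y; lra|].
apply (CV_radius_bounded (Cabs a)). exists (M1 + M2). intros n.
rewrite Rabs_pos_eq.
2:{ apply Rmult_le_pos; [apply Cmod_ge_0 | apply pow_le; unfold y; lra]. }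
replace (Cabs a n * y ^ n) with (Cmod (y ^ n * a n)%C) by (rewrite Cmod_pow_mult, My; reflexivity).
eapply Rle_trans; [apply Cmod_le_Rabs|]. specialize (B1 n). specialize (B2 n). lra.
Qed.

(** The expansion about [z0] is differentiated at every point of its disk, so [CPS_derive a] with
    the same centre and radius represents the derivative. *)
Lemma analytic_on_derive (D : C -> Prop) (f : C -> C) : analytic_on D f ->
  (forall z, D z -> is_cderive f z (C_derive f z)) /\ analytic_on D (C_derive f).
Proof.
intros Hf.
assert (K : forall z0, D z0 -> exists (r : R) (a : nat -> C), 0 < r /\
  forall z, Cmod (z - z0) < r -> in_radius a (Cmod (z - z0)) /\
    is_cderive f z (CPSeries (CPS_derive a) (z - z0)%C)).
{ intros z0 Hz0. destruct (Hf z0 Hz0) as (r & a & Hr & Ha). exists r, a. split; [easy|].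
  assert (Hrad : forall h : C, Cmod h < r -> in_radius a (Cmod h)).
  { intros h Hh. apply in_radius_of_converges with r; [split; [apply Cmod_ge_0 | easy]|].
    intros k Hk. exists (f (z0 + k)%C). apply is_pseries_C.
    replace k with (z0 + k - z0)%C by ring. replace (z0 + (z0 + k - z0))%C with (z0 + k)%C by ring.
    apply Ha. now replace (z0 + k - z0)%C with k by ring. }
  intros z Hz. split; [now apply Hrad|].
  apply (cderive_ext_loc (fun w => CPSeries a (w - z0)%C) f z _ (r - Cmod (z - z0))); [lra | |].
  - intros w Hw. apply CPSeries_unique, is_pseries_C, Ha.
    replace (w - z0)%C with ((w - z) + (z - z0))%C by ring.
    eapply Rle_lt_trans; [apply Cmod_triangle|]. lra.
  - eapply cderive_eq.
    + apply (cderive_comp (CPSeries a) (fun w => w - z0)%C); [apply cderive_CPSeries; auto|].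
      apply cderive_minus; [apply cderive_id | apply cderive_const].
    + ring. }
split.
- intros z Hz. destruct (K z Hz) as (r & a & Hr & Ha).
  destruct (Ha z) as [_ Hd].
  { replace (z - z)%C with (RtoC 0) by ring. now rewrite Cmod_0. }
  now rewrite (is_C_derive_unique _ _ _ Hd).
- intros z0 Hz0. destruct (K z0 Hz0) as (r & a & Hr & Ha).
  exists r, (CPS_derive a). split; [easy|]. intros z Hz.
  destruct (Ha z Hz) as [Hrad Hd].
  rewrite (is_C_derive_unique _ _ _ Hd).
  apply is_pseries_C, CPSeries_correct. now apply in_radius_derive.
Qed.

Lemma analytic_on_holo (n : nat) (D : C -> Prop) (f : C -> C) : analytic_on D f -> holo n D f.
Proof.
revert f. induction n as [|n IH]; [easy|]. intros f Hf.
destruct (analytic_on_derive D f Hf) as [H1 H2].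
exists (C_derive f); split; auto.
Qed.

(** * Re-expansion of power series *)

(** Partial sum with [n] terms, hence of degree below [n]: [sum_n] up to [n] corresponds to
    [cpoly u (S n)]. *)
Fixpoint cpoly (u : nat -> C) (n : nat) (h : C) : C :=
  match n with O => 0%C | S m => (cpoly u m h + h ^ m * u m)%C end.

Fixpoint rpoly (u : nat -> R) (n : nat) (h : R) : R :=
  match n with O => 0 | S m => rpoly u m h + h ^ m * u m end.

Lemma cderive_pow (n : nat) (z : C) : is_cderive (fun w => w ^ S n)%C z (INR (S n) * z ^ n)%C.
Proof.
induction n as [|n IH].
- eapply cderive_ext with (fun w => w); [intros w; symmetry; apply Cpow_1_r|].
  eapply cderive_eq; [apply cderive_id|]. simpl. ring.
- eapply cderive_eq.
  + apply (cderive_mult (fun w => w) (fun w => w ^ S n)%C); [apply cderive_id | exact IH].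
  + rewrite (S_INR (S n)), RtoC_plus, !Cpow_S. ring.
Qed.

Lemma cderive_cpoly (u : nat -> C) (n : nat) (h : C) :
  is_cderive (cpoly u (S n)) h (cpoly (fun k => INR (S k) * u (S k))%C n h).
Proof.
induction n as [|n IH].
- apply cderive_ext with (fun _ => u 0%nat); [intros w; simpl; ring | apply cderive_const].
- change (is_cderive (fun w => cpoly u (S n) w + w ^ S n * u (S n))%C h
   (cpoly (fun k => INR (S k) * u (S k)) n h + h ^ n * (INR (S n) * u (S n)))%C).
  apply cderive_plus; [exact IH|].
  eapply cderive_eq.
  + apply (cderive_mult (fun w => w ^ S n)%C (fun _ => u (S n))); [apply cderive_pow | apply cderive_const].
  + cbv beta. ring.
Qed.

Lemma is_derive_rpoly (u : nat -> R) (n : nat) (h : R) :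
  is_derive (rpoly u (S n)) h (rpoly (fun k => INR (S k) * u (S k)) n h).
Proof.
induction n as [|n IH].
- apply is_derive_ext with (fun _ => u 0%nat); [intros w; simpl; ring|].
  apply (is_derive_const (V := R_NormedModule)).
- change (is_derive (fun w => rpoly u (S n) w + w ^ S n * u (S n)) h
   (rpoly (fun k => INR (S k) * u (S k)) n h + h ^ n * (INR (S n) * u (S n)))).
  apply (is_derive_plus (V := R_NormedModule)); [exact IH|].
  eapply is_derive_eq.
  + apply is_derive_prod; [apply is_derive_pow, is_derive_id | apply (is_derive_const (V := R_NormedModule))].
  + change (INR (S n) * 1 * h ^ n * u (S n) + h ^ S n * 0 = h ^ n * (INR (S n) * u (S n))). ring.
Qed.

Lemma cpoly_0 (u : nat -> C) (n : nat) : cpoly u (S n) 0%C = u 0%nat.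
Proof.
induction n as [|n IH]; [simpl; ring|].
change (cpoly u (S n) 0 + 0 ^ S n * u (S n) = u 0%nat)%C. rewrite IH, Cpow_S. ring.
Qed.

Lemma rpoly_0 (u : nat -> R) (n : nat) : rpoly u (S n) 0 = u 0%nat.
Proof.
induction n as [|n IH]; [simpl; ring|].
change (rpoly u (S n) 0 + 0 ^ S n * u (S n) = u 0%nat). rewrite IH. simpl. ring.
Qed.

(** The [k]-th derivative over [k!], computed by differentiating first: in this form the derivative
    of a Taylor polynomial is the Taylor polynomial of the derived series. *)
Fixpoint taylor_coef (k : nat) (a : nat -> C) (z : C) : C :=
  match k with
  | O => CPSeries a z
  | S j => (taylor_coef j (CPS_derive a) z / INR (S j))%C
  end.

Fixpoint taylor_coef_R (k : nat) (b : nat -> R) (x : R) : R :=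
  match k with
  | O => PSeries b x
  | S j => taylor_coef_R j (PS_derive b) x / INR (S j)
  end.

Lemma INR_S_C_neq_0 (n : nat) : RtoC (INR (S n)) <> 0%C.
Proof. intros E. apply RtoC_inj in E. now apply (not_0_INR (S n)) in E. Qed.

(** Induction on the order: the derivative of a remainder is the remainder of the derived series
    with one term less, and the mean value inequality integrates its majorant. Convergence of the
    re-expansion becomes a question about a real series with nonnegative coefficients. *)
Lemma taylor_remainder_le (n : nat) (a : nat -> C) (z h : C) : in_radius a (Cmod z + Cmod h) ->
  Cmod (CPSeries a (z + h) - cpoly (fun k => taylor_coef k a z) n h) <=
  PSeries (Cabs a) (Cmod z + Cmod h) - rpoly (fun k => taylor_coef_R k (Cabs a) (Cmod z)) n (Cmod h).
Proof.
revert a h. induction n as [|n IH]; intros a h Ha;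
  pose proof (Cmod_ge_0 z) as Pz; pose proof (Cmod_ge_0 h) as Ph.
- simpl. rewrite Rminus_0_r. unfold Cminus. rewrite Copp_0, Cplus_0_r.
  assert (Hzh : Rabs (Cmod (z + h)) <= Rabs (Cmod z + Cmod h)).
  { pose proof (Cmod_triangle z h). pose proof (Cmod_ge_0 (z + h)). rewrite !Rabs_pos_eq; lra. }
  pose proof (in_radius_le a _ _ Hzh Ha) as Hzh'.
  eapply Rle_trans; [apply CPSeries_le; exact Hzh'|].
  eapply is_series_le_limit; [|exact (PSeries_is_series _ _ Hzh') | exact (PSeries_is_series _ _ Ha)].
  intros k. cbv beta. apply Rmult_le_compat_l; [apply Cmod_ge_0|].
  apply pow_incr. split; [apply Cmod_ge_0 | apply Cmod_triangle].
- assert (Ed : PS_derive (Cabs a) = Cabs (CPS_derive a)).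
  { apply functional_extensionality. intros k. now rewrite Cabs_derive. }
  pose proof (mean_value_inequality
    (fun w => CPSeries a w - cpoly (fun k => taylor_coef k a z) (S n) (w - z))%C
    (fun w => CPSeries (CPS_derive a) w - cpoly (fun k => taylor_coef k (CPS_derive a) z) n (w - z))%C
    (fun t => PSeries (Cabs a) (Cmod z + Cmod h * t)
       - rpoly (fun k => taylor_coef_R k (Cabs a) (Cmod z)) (S n) (Cmod h * t))
    (fun t => Cmod h * (PSeries (Cabs (CPS_derive a)) (Cmod z + Cmod h * t)
       - rpoly (fun k => taylor_coef_R k (Cabs (CPS_derive a)) (Cmod z)) n (Cmod h * t)))
    z h) as K. cbv beta in K.
  replace (z + h - z)%C with h in K by ring. replace (z - z)%C with (RtoC 0) in K by ring.
  rewrite !Rmult_1_r, !Rmult_0_r, Rplus_0_r, cpoly_0, rpoly_0 in K.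
  change (taylor_coef 0 a z) with (CPSeries a z) in K.
  change (taylor_coef_R 0 (Cabs a) (Cmod z)) with (PSeries (Cabs a) (Cmod z)) in K.
  replace (CPSeries a z - CPSeries a z)%C with (RtoC 0) in K by ring.
  rewrite Rminus_diag, Rminus_0_r in K.
  replace (CPSeries a (z + h) - cpoly (fun k => taylor_coef k a z) (S n) h - 0)%C
    with (CPSeries a (z + h) - cpoly (fun k => taylor_coef k a z) (S n) h)%C in K by ring.
  apply K; intros t Ht.
  + apply cderive_minus.
    * apply cderive_CPSeries. apply in_radius_le with (2 := Ha).
      pose proof (Cmod_triangle z (t * h)) as T. pose proof (Cmod_ge_0 (z + t * h)).
      rewrite Cmod_mult, Cmod_R, (Rabs_pos_eq t) in T by easy. rewrite !Rabs_pos_eq by nra. nra.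
    * eapply cderive_eq.
      -- apply (cderive_comp (cpoly (fun k => taylor_coef k a z) (S n)) (fun w => w - z)%C);
           [apply cderive_cpoly|]. apply cderive_minus; [apply cderive_id | apply cderive_const].
      -- cbv beta. replace (fun k : nat => (INR (S k) * taylor_coef (S k) a z)%C)
           with (fun k : nat => taylor_coef k (CPS_derive a) z); [cbv beta; ring|].
         apply functional_extensionality. intros k. cbn [taylor_coef]. field. apply INR_S_C_neq_0.
  + assert (Hr : Rbar_lt (Rabs (Cmod z + Cmod h * t)) (CV_radius (Cabs a))).
    { apply (in_radius_le a) with (2 := Ha). rewrite !Rabs_pos_eq by nra. nra. }
    rewrite Rmult_minus_distr_l.
    apply (is_derive_minus (V := R_NormedModule)).
    * apply (is_derive_comp (PSeries (Cabs a)) (fun s => Cmod z + Cmod h * s)).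
      -- rewrite <- Ed. now apply is_derive_PSeries.
      -- auto_derive; [easy | ring].
    * apply (is_derive_comp (rpoly (fun k => taylor_coef_R k (Cabs a) (Cmod z)) (S n))
        (fun s => Cmod h * s)).
      -- rewrite <- Ed.
         replace (fun k : nat => taylor_coef_R k (PS_derive (Cabs a)) (Cmod z))
           with (fun k : nat => INR (S k) * taylor_coef_R (S k) (Cabs a) (Cmod z)); [apply is_derive_rpoly|].
         apply functional_extensionality. intros k. cbn [taylor_coef_R]. field.
         apply not_0_INR. lia.
      -- auto_derive; [easy | ring].
  + rewrite Cmod_mult, Rmult_comm. apply Rmult_le_compat_l; [easy|].
    replace (z + t * h - z)%C with (t * h)%C by ring.
    assert (Mt : Cmod (t * h) = Cmod h * t).
    { rewrite Cmod_mult, Cmod_R, Rabs_pos_eq by easy. ring. }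
    rewrite <- Mt. apply IH. apply in_radius_derive. apply in_radius_le with (2 := Ha).
    rewrite Mt, !Rabs_pos_eq by nra. nra.
Qed.

Lemma taylor_coef_R_eq (k : nat) (b : nat -> R) (x : R) :
  taylor_coef_R k b x = PSeries (PS_derive_n k b) x / INR (fact k).
Proof.
revert b. induction k as [|k IH]; intros b.
- simpl. rewrite Rdiv_1_r. apply PSeries_ext. intros n. unfold PS_derive_n.
  rewrite Nat.add_0_r. field. apply INR_fact_neq_0.
- cbn [taylor_coef_R]. rewrite IH, fact_simpl, mult_INR.
  replace (PSeries (PS_derive_n k (PS_derive b)) x) with (PSeries (PS_derive_n (S k) b) x).
  { field. split; [apply INR_fact_neq_0 | apply not_0_INR; lia]. }
  apply PSeries_ext. intros n. unfold PS_derive_n, PS_derive.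
  rewrite Nat.add_succ_r, fact_simpl, mult_INR. field. apply INR_fact_neq_0.
Qed.

Lemma PSeries_nonneg_mono (b : nat -> R) (x y : R) : (forall n, 0 <= b n) -> 0 <= x <= y ->
  Rbar_lt (Rabs y) (CV_radius b) -> 0 <= PSeries b x <= PSeries b y.
Proof.
intros Hb Hxy Hy.
assert (Hx : Rbar_lt (Rabs x) (CV_radius b)).
{ eapply Rbar_le_lt_trans; [|exact Hy]. simpl. rewrite !Rabs_pos_eq; lra. }
split.
- eapply is_series_le_limit; [|exact (is_series_zero _ (fun _ => eq_refl)) | exact (PSeries_is_series _ _ Hx)].
  intros n. apply Rmult_le_pos; [easy | apply pow_le; lra].
- eapply is_series_le_limit; [|exact (PSeries_is_series _ _ Hx) | exact (PSeries_is_series _ _ Hy)].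
  intros n. apply Rmult_le_compat_l; [easy | apply pow_incr; lra].
Qed.

Lemma rpoly_taylor (b : nat -> R) (n : nat) (x y : R) : Rbar_lt (Rabs x) (CV_radius b) ->
  rpoly (fun k => taylor_coef_R k b x) (S n) y =
  sum_f_R0 (fun m => y ^ m / INR (fact m) * Derive_n (PSeries b) m x) n.
Proof.
intros Hx.
assert (E : forall k, y ^ k * taylor_coef_R k b x = y ^ k / INR (fact k) * Derive_n (PSeries b) k x).
{ intros k. rewrite taylor_coef_R_eq, Derive_n_PSeries by easy. field. apply INR_fact_neq_0. }
induction n as [|n IH].
- change (0 + y ^ 0 * taylor_coef_R 0 b x = y ^ 0 / INR (fact 0) * Derive_n (PSeries b) 0 x).
  rewrite Rplus_0_l. apply E.
- change (rpoly (fun k => taylor_coef_R k b x) (S n) y + y ^ S n * taylor_coef_R (S n) b x =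
   sum_f_R0 (fun m => y ^ m / INR (fact m) * Derive_n (PSeries b) m x) n +
   y ^ S n / INR (fact (S n)) * Derive_n (PSeries b) (S n) x).
  now rewrite IH, E.
Qed.

(* Bernstein's argument: all derivatives are nonnegative, so the Lagrange remainder on [x, x+y] is
   at most [2^-(n+1)] times a term of the expansion at [x+y] evaluated at [x+3y]. *)
Lemma taylor_remainder_R (b : nat -> R) (n : nat) (x y : R) : (forall n, 0 <= b n) ->
  0 <= x -> 0 < y -> Rbar_lt (Rabs (x + 3 * y)) (CV_radius b) ->
  PSeries b (x + y) - rpoly (fun k => taylor_coef_R k b x) (S n) y <= PSeries b (x + 3 * y) / 2 ^ S n.
Proof.
intros Hb Hx Hy HR.
assert (Hrad : forall t, 0 <= t <= x + 3 * y -> Rbar_lt (Rabs t) (CV_radius b)).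
{ intros t Ht. eapply Rbar_le_lt_trans; [|exact HR]. simpl. rewrite !Rabs_pos_eq; lra. }
assert (Hder : forall k t, 0 <= t <= x + 3 * y ->
  Derive_n (PSeries b) k t = PSeries (PS_derive_n k b) t).
{ intros k t Ht. apply Derive_n_PSeries. now apply Hrad. }
assert (Hbn : forall k m, 0 <= PS_derive_n k b m).
{ intros k m. unfold PS_derive_n. apply Rmult_le_pos; [|easy].
  apply Rdiv_le_0_compat; [apply pos_INR | apply INR_fact_lt_0]. }
assert (Hmono : forall k t u, 0 <= t <= u -> u <= x + 3 * y ->
  0 <= Derive_n (PSeries b) k t <= Derive_n (PSeries b) k u).
{ intros k t u Ht Hu. rewrite !Hder by lra. apply PSeries_nonneg_mono; [apply Hbn | easy |].
  rewrite CV_radius_derive_n. apply Hrad. lra. }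
rewrite rpoly_taylor by (apply Hrad; lra).
destruct (Taylor_Lagrange (PSeries b) n x (x + y)) as [zeta [Hz E]]; [lra| |].
{ intros t Ht k _. apply ex_derive_n_PSeries, Hrad. lra. }
destruct (Taylor_Lagrange (PSeries b) (S n) (x + y) (x + 3 * y)) as [eta [He E']]; [lra| |].
{ intros t Ht k _. apply ex_derive_n_PSeries, Hrad. lra. }
replace (x + y - x) with y in E by ring.
replace (x + 3 * y - (x + y)) with (2 * y) in E' by ring.
rewrite E. set (s := sum_f_R0 _ n). replace (s + y ^ S n / INR (fact (S n)) * Derive_n (PSeries b) (S n) zeta - s)
  with (y ^ S n / INR (fact (S n)) * Derive_n (PSeries b) (S n) zeta) by ring.
assert (Hf : forall m, 0 < INR (fact m)) by apply INR_fact_lt_0.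
assert (T : (2 * y) ^ S n / INR (fact (S n)) * Derive_n (PSeries b) (S n) (x + y) <= PSeries b (x + 3 * y)).
{ rewrite E'.
  change (sum_f_R0 (fun m => (2 * y) ^ m / INR (fact m) * Derive_n (PSeries b) m (x + y)) (S n))
   with (sum_f_R0 (fun m => (2 * y) ^ m / INR (fact m) * Derive_n (PSeries b) m (x + y)) n +
     (2 * y) ^ S n / INR (fact (S n)) * Derive_n (PSeries b) (S n) (x + y)).
  assert (0 <= sum_f_R0 (fun m => (2 * y) ^ m / INR (fact m) * Derive_n (PSeries b) m (x + y)) n).
  { apply cond_pos_sum. intros m. apply Rmult_le_pos.
    - apply Rdiv_le_0_compat; [apply pow_le; lra | apply Hf].
    - apply (Hmono m (x + y) (x + y)); lra. }
  assert (0 <= (2 * y) ^ S (S n) / INR (fact (S (S n))) * Derive_n (PSeries b) (S (S n)) eta).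
  { apply Rmult_le_pos.
    - apply Rdiv_le_0_compat; [apply pow_le; lra | apply Hf].
    - apply (Hmono _ eta eta); lra. }
  lra. }
apply Rle_trans with (y ^ S n / INR (fact (S n)) * Derive_n (PSeries b) (S n) (x + y)).
- apply Rmult_le_compat_l; [apply Rdiv_le_0_compat; [apply pow_le; lra | apply Hf]|].
  apply Hmono; lra.
- assert (P2 : 0 < 2 ^ S n) by (apply pow_lt; lra).
  apply (Rle_div_r _ _ (2 ^ S n)); [easy|]. rewrite Rpow_mult_distr in T.
  eapply Rle_trans; [|exact T]. right. field. apply INR_fact_neq_0.
Qed.

Lemma cpoly_sum_n (u : nat -> C) (n : nat) (h : C) :
  cpoly u (S n) h = (sum_n (fun k => Re (h ^ k * u k)%C) n, sum_n (fun k => Im (h ^ k * u k)%C) n).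
Proof.
induction n as [|n IH].
- rewrite !sum_O. change (cpoly u 1 h) with (0 + h ^ 0 * u 0%nat)%C. rewrite Cplus_0_l.
  apply surjective_pairing.
- rewrite !sum_Sn. change (cpoly u (S (S n)) h) with (cpoly u (S n) h + h ^ S n * u (S n))%C.
  rewrite IH. reflexivity.
Qed.

Lemma analytic_CPSeries (a : nat -> C) : (forall x, Rabs x < 1 -> in_radius a x) ->
  analytic_on unit_disk (CPSeries a).
Proof.
unfold unit_disk. intros Ha z0 Hz0. pose proof (Cmod_ge_0 z0) as P0.
(* The third comes from [taylor_remainder_R], which needs [|z0| + 3 |h| < 1]. It also needs
   [|h| > 0], so [h = 0] is treated apart. *)
exists ((1 - Cmod z0) / 3), (fun k => taylor_coef k a z0). split; [lra|].
intros z Hz. apply is_pseries_C. set (h := (z - z0)%C) in *.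
replace z with (z0 + h)%C by (unfold h; ring).
pose proof (Cmod_ge_0 h) as Ph.
destruct (Req_dec (Cmod h) 0) as [E0 | N0].
{ apply Cmod_eq_0 in E0. rewrite E0, Cplus_0_r.
  exact (is_cseries_at_0 (fun k => taylor_coef k a z0)). }
assert (Hrad : in_radius a (Cmod z0 + 3 * Cmod h)) by (apply Ha; rewrite Rabs_pos_eq; lra).
set (M := PSeries (Cabs a) (Cmod z0 + 3 * Cmod h)).
assert (B : forall n, Cmod (CPSeries a (z0 + h) - cpoly (fun k => taylor_coef k a z0) (S n) h) <= M / 2 ^ S n).
{ intros n. eapply Rle_trans.
  - apply taylor_remainder_le. apply Ha. rewrite Rabs_pos_eq; lra.
  - apply taylor_remainder_R; [intros k; apply Cmod_ge_0 | easy | lra | exact Hrad]. }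
assert (L : is_lim_seq (fun n => M / 2 ^ S n) 0).
{ apply is_lim_seq_ext with (fun n => M / 2 * (1 / 2) ^ n).
  - intros n. simpl. rewrite Rdiv_1_l, pow_inv. field. apply pow_nonzero. lra.
  - replace (Finite 0) with (Rbar_mult (M / 2) 0) by (simpl; f_equal; ring).
    apply is_lim_seq_scal_l. apply is_lim_seq_geom. rewrite Rabs_pos_eq; lra. }
assert (Q : forall (p : nat -> R) (l : R), (forall n, Rabs (l - p n) <= M / 2 ^ S n) -> is_lim_seq p l).
{ intros p l H. apply is_lim_seq_le_le with (fun n => l - M / 2 ^ S n) (fun n => l + M / 2 ^ S n).
  - intros n. specialize (H n). apply Rabs_le_between in H. lra.
  - replace (Finite l) with (Rbar_minus l 0) by (simpl; f_equal; ring).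
    apply is_lim_seq_minus'; [apply is_lim_seq_const | exact L].
  - replace (Finite l) with (Rbar_plus l 0) by (simpl; f_equal; ring).
    apply is_lim_seq_plus'; [apply is_lim_seq_const | exact L]. }
split; apply Q; intros n; specialize (B n); rewrite cpoly_sum_n in B.
- eapply Rle_trans; [|exact B]. exact (re_le_Cmod (CPSeries a (z0 + h) - (_, _))).
- eapply Rle_trans; [|exact B]. exact (Im_le_Cmod (CPSeries a (z0 + h) - (_, _))).
Qed.

(** * The extremal function *)

Lemma is_cseries_tail (c : nat -> C) (l : C) :
  is_cseries c l -> is_cseries (fun n => c (S n)) (l - c 0%nat)%C.
Proof.
intros [H1 H2]. split.
- apply (is_series_incr_1 (fun n => Re (c n))). change (is_series (fun n => Re (c n)) ((Re l + - Re (c 0%nat)) + Re (c 0%nat))).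
  replace ((Re l + - Re (c 0%nat)) + Re (c 0%nat)) with (Re l) by ring. exact H1.
- apply (is_series_incr_1 (fun n => Im (c n))). change (is_series (fun n => Im (c n)) ((Im l + - Im (c 0%nat)) + Im (c 0%nat))).
  replace ((Im l + - Im (c 0%nat)) + Im (c 0%nat)) with (Im l) by ring. exact H2.
Qed.

(** Four real Cauchy products of the coordinates. The terms [c n] are described through their
    coordinates because [sum_f_R0] is a real sum. *)
Lemma is_cseries_mult (a b c : nat -> C) (la lb : C) :
  is_cseries a la -> is_cseries b lb ->
  ex_series (fun n => Cmod (a n)) -> ex_series (fun n => Cmod (b n)) ->
  (forall n, Re (c n) = sum_f_R0 (fun k => Re (a k * b (n - k)%nat)) n) ->
  (forall n, Im (c n) = sum_f_R0 (fun k => Im (a k * b (n - k)%nat)) n) ->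
  is_cseries c (la * lb)%C.
Proof.
intros [A1 A2] [B1 B2] Ha Hb HR HI.
assert (Abs : forall u : nat -> C, ex_series (fun n => Cmod (u n)) ->
  ex_series (fun n => Rabs (Re (u n))) /\ ex_series (fun n => Rabs (Im (u n)))).
{ intros u Hu. split; apply (ex_series_le (V := R_CompleteNormedModule)) with (2 := Hu); intros n.
  - change (Rabs (Rabs (Re (u n))) <= Cmod (u n)). rewrite Rabs_Rabsolu. apply re_le_Cmod.
  - change (Rabs (Rabs (Im (u n))) <= Cmod (u n)). rewrite Rabs_Rabsolu. apply Im_le_Cmod. }
destruct (Abs a Ha) as [aR aI], (Abs b Hb) as [bR bI].
split.
- apply is_series_ext with (2 := is_series_minus _ _ _ _
    (is_series_mult _ _ _ _ A1 B1 aR bR) (is_series_mult _ _ _ _ A2 B2 aI bI)).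
  intros n. rewrite HR. symmetry.
  erewrite sum_eq; [|intros k _; apply re_mult]. apply (minus_sum _ _ n).
- apply is_series_ext with (2 := is_series_plus _ _ _ _
    (is_series_mult _ _ _ _ A1 B2 aR bI) (is_series_mult _ _ _ _ A2 B1 aI bR)).
  intros n. rewrite HI. symmetry.
  erewrite sum_eq; [|intros k _; apply im_mult]. apply (plus_sum _ _ n).
Qed.

Lemma in_radius_bounded (a : nat -> C) (M x : R) :
  (forall n, Cmod (a n) <= M) -> Rabs x < 1 -> in_radius a x.
Proof.
intros HM Hx. pose proof (Rabs_pos x) as Px.
apply Rbar_lt_le_trans with ((Rabs x + 1) / 2); [change (Rabs x < (Rabs x + 1) / 2); lra|].
apply (CV_radius_bounded (Cabs a)). exists M. intros n.
assert (P : 0 <= ((Rabs x + 1) / 2) ^ n <= 1).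
{ split; [apply pow_le; lra|]. apply Rle_trans with (1 ^ n); [apply pow_incr; lra | rewrite pow1; lra]. }
pose proof (Cmod_ge_0 (a n)) as Pa. specialize (HM n).
rewrite Rabs_pos_eq; unfold Cabs; nra.
Qed.

(* Row [n] holds the coefficients of [exp (int tau)] up to degree [n]; tabulating the rows makes the
   course-of-values recursion structural. *)
Fixpoint power_table (tau : nat -> R) (n k : nat) : R :=
  match n with
  | O => 1
  | S m => if Nat.leb k m then power_table tau m k
           else sum_f_R0 (fun i => tau i * power_table tau m (m - i)) m / INR (S m)
  end.

Lemma exp_primitive_coefs (tau : nat -> R) : exists d : nat -> R, d 0%nat = 1 /\
  forall n, INR (S n) * d (S n) = sum_f_R0 (fun k => tau k * d (n - k)%nat) n.
Proof.
exists (fun n => power_table tau n n). split; [reflexivity|].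
assert (K : forall n k, (k <= n)%nat -> power_table tau n k = power_table tau k k).
{ induction n as [|n IH]; intros k Hk.
  - now replace k with 0%nat by lia.
  - destruct (Nat.eq_dec k (S n)) as [-> | Ne]; [easy|].
    cbn [power_table]. rewrite (proj2 (Nat.leb_le k n)) by lia. apply IH. lia. }
intros n. cbn [power_table]. rewrite (proj2 (Nat.leb_gt (S n) n)) by lia.
rewrite (sum_eq _ (fun k => tau k * power_table tau (n - k) (n - k))).
- field. apply not_0_INR. lia.
- intros i Hi. rewrite K by lia. reflexivity.
Qed.

Lemma sum_INR_S_rev (n : nat) :
  2 * sum_f_R0 (fun k => INR (S (n - k))) n = INR (S n) * INR (S (S n)).
Proof.
induction n as [|n IH]; [simpl; ring|].
rewrite decomp_sum by lia. rewrite Nat.pred_succ, Nat.sub_0_r.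
rewrite (sum_eq _ (fun k => INR (S (n - k)))) by (intros k _; reflexivity).
rewrite Rmult_plus_distr_l, IH, !S_INR. ring.
Qed.

(** Comparison with the extreme case [tau = 2]: there the primitive is [- 2 log (1 - z)], and its
    exponential [1 / (1 - z)^2] has the coefficients [n + 1]. *)
Lemma exp_primitive_coefs_bound (tau d : nat -> R) :
  (forall k, 0 <= tau k <= 2) -> d 0%nat = 1 ->
  (forall n, INR (S n) * d (S n) = sum_f_R0 (fun k => tau k * d (n - k)%nat) n) ->
  forall n, 0 <= d n <= INR (S n).
Proof.
intros Ht H0 Hd n. induction n as [n IH] using (well_founded_induction Wf_nat.lt_wf).
destruct n as [|n]; [rewrite H0; simpl; lra|].
assert (P : 0 < INR (S n)) by (apply lt_0_INR; lia).
assert (B1 : 0 <= INR (S n) * d (S n)).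
{ rewrite Hd. rewrite <- (sum_eq_R0 (fun _ => 0) n) by easy. apply sum_Rle. intros k Hk.
  apply Rmult_le_pos; [apply Ht | apply IH; lia]. }
assert (B2 : INR (S n) * d (S n) <= INR (S n) * INR (S (S n))).
{ rewrite Hd, <- sum_INR_S_rev, scal_sum.
  apply sum_Rle. intros k Hk.
  rewrite Rmult_comm. apply Rmult_le_compat; try apply IH; try apply Ht; lia. }
split.
- apply Rmult_le_reg_l with (INR (S n)); [easy|]. lra.
- apply Rmult_le_reg_l with (INR (S n)); easy.
Qed.

Definition real_seq (u : nat -> R) (n : nat) : C := RtoC (u n).

Definition primitive (tau : nat -> R) (n : nat) : R :=
  match n with O => 0 | S m => tau m / INR (S m) end.

Lemma CPS_derive_primitive (tau : nat -> R) : CPS_derive (real_seq (primitive tau)) = real_seq tau.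
Proof.
apply functional_extensionality. intros n. unfold CPS_derive, real_seq, primitive.
rewrite <- RtoC_mult. f_equal. field. apply not_0_INR. lia.
Qed.

Lemma cderive_primitive (tau : nat -> R) (z : C) : in_radius (real_seq tau) (Cmod z) ->
  is_cderive (CPSeries (real_seq (primitive tau))) z (CPSeries (real_seq tau) z).
Proof.
intros H. pose proof (cderive_CPSeries (real_seq (primitive tau)) z) as K.
rewrite CPS_derive_primitive in K. apply K.
apply (proj1 (in_radius_derive (real_seq (primitive tau)) (Cmod z))).
rewrite CPS_derive_primitive. exact H.
Qed.

Lemma Cmod_CR_le (u : nat -> R) (M : R) :
  (forall n, 0 <= u n <= M) -> forall n, Cmod (real_seq u n) <= M.
Proof. intros H n. unfold real_seq. rewrite Cmod_R, Rabs_pos_eq; apply H. Qed.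

Lemma ex_series_Cmod (a : nat -> C) (z : C) : in_radius a (Cmod z) ->
  ex_series (fun n => Cmod (z ^ n * a n)).
Proof.
intros H. eexists. eapply is_series_ext; [|exact (PSeries_is_series _ _ H)].
intros n. cbv beta. now rewrite Cmod_pow_mult.
Qed.

Lemma exp_primitive_ode (tau d : nat -> R) (z : C) :
  (forall n, INR (S n) * d (S n) = sum_f_R0 (fun k => tau k * d (n - k)%nat) n) ->
  in_radius (real_seq tau) (Cmod z) -> in_radius (real_seq d) (Cmod z) ->
  CPSeries (CPS_derive (real_seq d)) z = (CPSeries (real_seq tau) z * CPSeries (real_seq d) z)%C.
Proof.
intros Hd Ht Hr. apply CPSeries_unique.
assert (Ep : forall n k, (k <= n)%nat ->
  (z ^ k * real_seq tau k * (z ^ (n - k) * real_seq d (n - k)))%C = (z ^ n * (tau k * d (n - k)%nat)%R)%C).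
{ intros n k Hk. replace n with (k + (n - k))%nat at 3 by lia.
  rewrite Cpow_add_r, RtoC_mult. unfold real_seq. ring. }
assert (E : forall n, (z ^ n * CPS_derive (real_seq d) n)%C =
   (z ^ n * (sum_f_R0 (fun k => tau k * d (n - k)%nat) n)%R)%C).
{ intros n. rewrite <- Hd, RtoC_mult. reflexivity. }
apply (is_cseries_mult (fun n => z ^ n * real_seq tau n)%C (fun n => z ^ n * real_seq d n)%C).
- now apply CPSeries_correct.
- now apply CPSeries_correct.
- now apply ex_series_Cmod.
- now apply ex_series_Cmod.
- intros n. rewrite E, re_scal_r, scal_sum. apply sum_eq. intros k Hk.
  rewrite Ep, re_scal_r by easy. ring.
- intros n. rewrite E, im_scal_r, scal_sum. apply sum_eq. intros k Hk.
  rewrite Ep, im_scal_r by easy. ring.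
Qed.

Lemma cderive_comp_cexp (F : C -> C) (z l : C) : is_cderive F z l ->
  is_cderive (fun w => cexp (F w)) z (l * cexp (F z))%C.
Proof. intros H. apply cderive_comp; [apply cderive_cexp | exact H]. Qed.

(* [E = exp U] because [E exp (-U)] has zero derivative. *)
Lemma exp_of_ode (E U T : C -> C) (z : C) :
  (forall w, unit_disk w -> is_cderive E w (T w * E w)%C) ->
  (forall w, unit_disk w -> is_cderive U w (T w)) -> unit_disk z ->
  E 0%C = cexp (U 0%C) -> E z = cexp (U z).
Proof.
intros HE HU Hz H0.
assert (K : (E (0 + z) * cexp (- U (0 + z)))%C = (E 0 * cexp (- U 0))%C).
{ apply (cderive_zero_const (fun w => E w * cexp (- U w))%C). intros t Ht.
  assert (Hw : unit_disk (0 + t * z)%C).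
  { unfold unit_disk in *. rewrite Cplus_0_l, Cmod_mult, Cmod_R, Rabs_pos_eq by easy.
    pose proof (Cmod_ge_0 z). nra. }
  eapply cderive_eq.
  - apply cderive_mult; [now apply HE|].
    apply (cderive_comp_cexp (fun w => - U w)%C). apply cderive_opp. now apply HU.
  - cbv beta. ring. }
rewrite Cplus_0_l, H0, !cexp_opp in K.
replace (cexp (U 0%C) * / cexp (U 0%C))%C with (RtoC 1) in K by (field; apply cexp_neq_0).
replace (E z) with (E z * / cexp (U z) * cexp (U z))%C by (field; apply cexp_neq_0).
rewrite K. ring.
Qed.

(* Taylor coefficients of [((1+z^2)/(1-z^2))^alpha], from [(1-z^4) P' = 4 alpha z P]. *)
Fixpoint sector_state (alpha : R) (n : nat) : R * R * R * R :=
  match n with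
  | O => (1, 0, 2 * alpha, 0)
  | S m => let '(a, b, c, d) := sector_state alpha m in
           (b, c, d, (4 * alpha * c + INR m * a) / (INR m + 4))
  end.

Definition sector_coef (alpha : R) (n : nat) : R :=
  let '(a, _, _, _) := sector_state alpha n in a.

(** The recurrence reaches back four steps, so the state is a window of four consecutive
    coefficients. *)
Lemma sector_state_eq (alpha : R) (n : nat) : sector_state alpha n =
  (sector_coef alpha n, sector_coef alpha (S n), sector_coef alpha (2 + n), sector_coef alpha (3 + n)).
Proof.
unfold sector_coef. cbn [sector_state Nat.add].
now destruct (sector_state alpha n) as [[[a b] c] d].
Qed.

Lemma sector_coef_rec (alpha : R) (n : nat) :
  INR (4 + n) * sector_coef alpha (4 + n) =
  4 * alpha * sector_coef alpha (2 + n) + INR n * sector_coef alpha n.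
Proof.
pose proof (sector_state_eq alpha (S n)) as E. cbn [sector_state] in E.
rewrite sector_state_eq in E.
assert (E' : sector_coef alpha (4 + n) =
  (4 * alpha * sector_coef alpha (2 + n) + INR n * sector_coef alpha n) / (INR n + 4))
  by exact (eq_sym (f_equal snd E)).
rewrite E', plus_INR. simpl (INR 4). pose proof (pos_INR n). field. lra.
Qed.

(** The bound 2 is stable under the recurrence because [4 alpha * 2 + n * 2 <= (n + 4) * 2]; the
    induction carries the whole window. *)
Lemma sector_coef_bound (alpha : R) : 0 < alpha < 1 -> forall n, 0 <= sector_coef alpha n <= 2.
Proof.
intros Ha n.
assert (K : (0 <= sector_coef alpha n <= 2) /\ (0 <= sector_coef alpha (S n) <= 2) /\
  (0 <= sector_coef alpha (2 + n) <= 2) /\ (0 <= sector_coef alpha (3 + n) <= 2)); [|easy].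
induction n as [|n IH]; [unfold sector_coef; simpl; repeat split; lra|].
destruct IH as (H0 & H1 & H2 & H3). repeat split; try apply H1; try apply H2; try apply H3.
all: change (3 + S n)%nat with (4 + n)%nat.
all: pose proof (sector_coef_rec alpha n) as E; rewrite plus_INR in E; simpl (INR 4) in E;
  pose proof (pos_INR n).
- apply Rmult_le_reg_l with (1 + 1 + 1 + 1 + INR n); [lra|]. rewrite E.
  assert (0 <= 4 * alpha * sector_coef alpha (2 + n)) by (apply Rmult_le_pos; lra).
  assert (0 <= INR n * sector_coef alpha n) by (apply Rmult_le_pos; lra). lra.
- apply Rmult_le_reg_l with (1 + 1 + 1 + 1 + INR n); [lra|]. rewrite E.
  assert (4 * alpha * sector_coef alpha (2 + n) <= 4 * 2) by (apply Rmult_le_compat; lra).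
  assert (INR n * sector_coef alpha n <= INR n * 2) by (apply Rmult_le_compat_l; lra). lra.
Qed.

Lemma unit_disk_sqr (z : C) : unit_disk z -> unit_disk (z * z)%C.
Proof. unfold unit_disk. intros H. rewrite Cmod_mult. pose proof (Cmod_ge_0 z). nra. Qed.

Lemma sector_series_radius (alpha : R) (z : C) : 0 < alpha < 1 -> unit_disk z ->
  in_radius (real_seq (sector_coef alpha)) (Cmod z).
Proof.
intros Ha Hz. apply (in_radius_bounded _ 2).
- apply Cmod_CR_le. now apply sector_coef_bound.
- rewrite Rabs_pos_eq by apply Cmod_ge_0. exact Hz.
Qed.

(** The equation is multiplied by [z] because [z P'] has the coefficients [n c_n], without a shift.
    Removing four terms from [z P'] and two from [P] aligns both sides with the recurrence; the
    removed terms match since [2 c_2 = 4 alpha c_0] and [c_1 = c_3 = 0]. *)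
Lemma sector_series_ode (alpha : R) (z : C) : 0 < alpha < 1 -> unit_disk z ->
  (z * CPSeries (CPS_derive (real_seq (sector_coef alpha))) z * (1 - z ^ 4))%C =
  (4 * alpha * z ^ 2 * CPSeries (real_seq (sector_coef alpha)) z)%C.
Proof.
intros Ha Hz. set (e := sector_coef alpha). pose proof (sector_series_radius alpha z Ha Hz) as Hr.
fold e in Hr.
set (P := CPSeries (real_seq e) z). set (Q := (z * CPSeries (CPS_derive (real_seq e)) z)%C).
assert (HP : is_cseries (fun n => z ^ n * real_seq e n)%C P) by now apply CPSeries_correct.
assert (HQ : is_cseries (fun n => z ^ n * (INR n * e n)%R)%C Q).
{ replace Q with (z ^ 0 * (INR 0 * e 0%nat)%R + Q)%C.
  2:{ change (INR 0) with 0. rewrite Rmult_0_l. ring. }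
  apply (is_cseries_cons (fun n => z ^ n * (INR n * e n)%R)%C).
  apply is_cseries_ext with (fun n => z * (z ^ n * CPS_derive (real_seq e) n))%C.
  - intros n. unfold CPS_derive, real_seq. rewrite RtoC_mult, Cpow_S. ring.
  - apply is_cseries_scal, CPSeries_correct. now apply in_radius_derive. }
pose proof (is_cseries_tail _ _ (is_cseries_tail _ _ HP)) as HP2. cbv beta in HP2.
pose proof (is_cseries_tail _ _ (is_cseries_tail _ _ (is_cseries_tail _ _ (is_cseries_tail _ _ HQ)))) as HQ4.
cbv beta in HQ4.
pose proof (is_cseries_plus _ _ _ _ (is_cseries_scal (z ^ 4) _ _ HQ)
  (is_cseries_scal (4 * alpha * z ^ 2) _ _ HP2)) as HS. cbv beta in HS.
apply is_cseries_ext with (c' := fun n => (z ^ S (S (S (S n))) *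
  (INR (S (S (S (S n)))) * e (S (S (S (S n)))))%R)%C) in HS.
2:{ intros n. cbv beta.
    change (S (S (S (S n)))) with (4 + n)%nat. change (S (S n)) with (2 + n)%nat.
    unfold real_seq, e. rewrite sector_coef_rec, RtoC_plus, !RtoC_mult, !Cpow_add_r. ring. }
pose proof (is_cseries_unique _ _ _ HQ4 HS) as E.
change (INR 0) with 0 in E.
change (e 0%nat) with 1 in E. change (e 1%nat) with 0 in E. change (e 2%nat) with (2 * alpha) in E.
change (e 3%nat) with 0 in E. change (real_seq e 0%nat) with (RtoC 1) in E. change (real_seq e 1%nat) with (RtoC 0) in E.
rewrite !Rmult_0_l, !Rmult_0_r in E. simpl (INR 2) in E. rewrite !RtoC_mult, RtoC_plus in E.
apply Ceq_minus. apply Ceq_minus in E. rewrite <- E. ring.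
Qed.

Lemma sector_series_eq (alpha : R) (z : C) : 0 < alpha < 1 -> unit_disk z ->
  CPSeries (real_seq (sector_coef alpha)) z = cexp (alpha * clog ((1 + z * z) / (1 - z * z))).
Proof.
intros Ha Hz.
set (L' := fun w => (alpha * ((w + w) * (2 / (1 - w * w * (w * w)))))%C).
assert (Hn : forall w, unit_disk w -> (1 - w * w * (w * w))%C <> 0%C).
{ intros w Hw E. pose proof (unit_disk_sqr _ (unit_disk_sqr _ Hw)) as B. unfold unit_disk in B.
  replace (w * w * (w * w))%C with (1 - (1 - w * w * (w * w)))%C in B by ring.
  rewrite E in B. replace (1 - 0)%C with (RtoC 1) in B by ring. rewrite Cmod_1 in B. lra. }
apply (exp_of_ode (CPSeries (real_seq (sector_coef alpha)))
  (fun w => alpha * clog ((1 + w * w) / (1 - w * w)))%C L' z); [| | easy |].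
- intros w Hw. eapply cderive_eq; [apply cderive_CPSeries; now apply sector_series_radius|].
  (* The equation carries a factor [w], so at the origin it says nothing and the derivative is read
     off from the coefficient [c_1 = 0]. *)
  destruct (Ceq_dec w 0%C) as [-> | Nw].
  + rewrite !CPSeries_0. unfold L', CPS_derive, real_seq. change (sector_coef alpha 1) with 0.
    rewrite !Cplus_0_r, !Cmult_0_l, !Cmult_0_r, Cmult_0_l. reflexivity.
  + pose proof (sector_series_ode alpha w Ha Hw) as E. specialize (Hn w Hw).
    set (D := CPSeries (CPS_derive _) w) in *. set (P := CPSeries _ w) in *.
    unfold L'.
    replace D with (w * D * (1 - w ^ 4) / (w * (1 - w * w * (w * w))))%C by (simpl; field; split; easy).
    rewrite E. simpl. field. split; easy.
- intros w Hw. eapply cderive_eq.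
  + apply (cderive_mult (fun _ => RtoC alpha) (fun w => clog ((1 + w * w) / (1 - w * w)))); [apply cderive_const|].
    apply (cderive_comp (fun v => clog ((1 + v) / (1 - v))) (fun w => w * w)%C).
    * apply cderive_clog_cayley. now apply unit_disk_sqr.
    * apply cderive_mult; apply cderive_id.
  + unfold L'. cbv beta. ring.
- rewrite CPSeries_0, Cmult_0_l.
  replace ((1 + 0) / (1 - 0))%C with (RtoC 1) by (field; intros E; apply RtoC_inj in E; lra).
  rewrite clog_1, Cmult_0_r, cexp_0. reflexivity.
Qed.

Lemma Arg_sector_series (alpha : R) (z : C) : 0 < alpha < 1 -> unit_disk z ->
  Rabs (Arg (CPSeries (real_seq (sector_coef alpha)) z)) < PI * alpha / 2.
Proof.
intros Ha Hz. rewrite sector_series_eq by easy.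
set (l := clog ((1 + z * z) / (1 - z * z))).
pose proof PI_RGT_0.
assert (B : - PI / 2 < Im l < PI / 2).
{ apply Arg_bound, Re_cayley_pos. now apply unit_disk_sqr. }
change (Arg (cexp (alpha * l))) with (Im (clog (cexp (alpha * l)))).
rewrite clog_cexp; rewrite im_scal_l.
- apply Rabs_def1; nra.
- nra.
Qed.

Lemma sector_series_split (alpha : R) (z : C) : 0 < alpha < 1 -> unit_disk z ->
  CPSeries (real_seq (sector_coef alpha)) z =
  (1 + z * CPSeries (real_seq (fun n => sector_coef alpha (S n))) z)%C.
Proof.
intros Ha Hz. apply CPSeries_unique.
replace (RtoC 1) with (z ^ 0 * real_seq (sector_coef alpha) 0)%C.
2:{ change (real_seq (sector_coef alpha) 0) with (RtoC 1). simpl. ring. }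
apply (is_cseries_cons (fun n => z ^ n * real_seq (sector_coef alpha) n)%C).
apply is_cseries_ext with (fun n => z * (z ^ n * real_seq (fun n => sector_coef alpha (S n)) n))%C.
- intros n. unfold real_seq. rewrite Cpow_S. ring.
- apply is_cseries_scal, CPSeries_correct.
  apply (in_radius_bounded _ 2).
  + apply Cmod_CR_le. intros n. now apply sector_coef_bound.
  + rewrite Rabs_pos_eq by apply Cmod_ge_0. exact Hz.
Qed.

(** With [P] the sector series and [T = (P - 1) / z], the solution [E] of [E' = T E] is taken as
    [f']; it has no zeros since it is an exponential. The value at 0 is
    [T' - T^2 / 2 = c_2 - c_1^2 / 2 = 2 alpha]. The square in [(1 + z^2) / (1 - z^2)] is what makes
    [c_1 = 0]: with [z] in its place the value would be [2 alpha^2 - (2 alpha)^2 / 2 = 0]. *)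
Lemma extremal_function (alpha : R) : 0 < alpha < 1 ->
  exists f : C -> C, strongly_convex alpha f /\ schwarzian f 0%C = RtoC (2 * alpha).
Proof.
intros Ha. set (tau := fun n => sector_coef alpha (S n)).
assert (Bt : forall n, 0 <= tau n <= 2) by (intros n; now apply sector_coef_bound).
destruct (exp_primitive_coefs tau) as [d [Hd0 Hd]].
pose proof (exp_primitive_coefs_bound tau d Bt Hd0 Hd) as Bd.
(* Since [d n <= n + 1], the coefficients [d n / (n + 1)] of [f] are at most 1. *)
assert (Rf : forall x, Rabs x < 1 -> in_radius (real_seq (primitive d)) x).
{ intros x. apply (in_radius_bounded _ 1). apply Cmod_CR_le. intros [|n]; [simpl; lra|].
  change (primitive d (S n)) with (d n / INR (S n)). specialize (Bd n). assert (0 < INR (S n)) by (apply lt_0_INR; lia).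
  split; [apply Rdiv_le_0_compat; easy | apply Rle_div_l; lra]. }
assert (Rd : forall x, Rabs x < 1 -> in_radius (real_seq d) x).
{ intros x Hx. rewrite <- CPS_derive_primitive. apply in_radius_derive. auto. }
assert (Rt : forall x, Rabs x < 1 -> in_radius (real_seq tau) x).
{ intros x. apply (in_radius_bounded _ 2). now apply Cmod_CR_le. }
assert (Dk : forall z, unit_disk z -> Rabs (Cmod z) < 1).
{ intros z Hz. rewrite Rabs_pos_eq by apply Cmod_ge_0. exact Hz. }
set (f := CPSeries (real_seq (primitive d))). set (E := CPSeries (real_seq d)). set (T := CPSeries (real_seq tau)).
assert (F1 : forall z, unit_disk z -> C_derive f z = E z).
{ intros z Hz. apply is_C_derive_unique, cderive_primitive. auto. }
assert (DE : forall z, unit_disk z -> is_cderive E z (T z * E z)%C).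
{ intros z Hz. unfold T, E. rewrite <- exp_primitive_ode by auto.
  apply cderive_CPSeries. auto. }
assert (Loc : forall z w, unit_disk z -> Cmod (w - z) < 1 - Cmod z -> unit_disk w).
{ intros z w Hz Hw. unfold unit_disk in *. pose proof (Cmod_minus_rev w z). lra. }
assert (F2 : forall z, unit_disk z -> C_derive (C_derive f) z = (T z * E z)%C).
{ intros z Hz. apply is_C_derive_unique.
  apply (cderive_ext_loc E _ z _ (1 - Cmod z)); [unfold unit_disk in Hz; lra | | auto].
  intros w Hw. symmetry. apply F1. now apply Loc with z. }
assert (NE : forall z, unit_disk z -> E z <> 0%C).
{ intros z Hz. rewrite (exp_of_ode E (CPSeries (real_seq (primitive tau))) T z); auto.
  - apply cexp_neq_0.
  - intros w Hw. apply cderive_primitive. auto.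
  - unfold E. rewrite !CPSeries_0. unfold real_seq. simpl primitive. now rewrite Hd0, cexp_0. }
assert (PS : forall z, unit_disk z -> pre_schwarzian f z = T z).
{ intros z Hz. unfold pre_schwarzian. rewrite F1, F2 by easy. field. auto. }
assert (D0 : unit_disk 0%C) by (unfold unit_disk; rewrite Cmod_0; lra).
exists f. split; [split; [split; [|split]|]|].
- now apply analytic_CPSeries.
- unfold f. now rewrite CPSeries_0.
- rewrite F1 by easy. unfold E. rewrite CPSeries_0. unfold real_seq. now rewrite Hd0.
- intros z Hz. rewrite F1, PS by easy. unfold T, tau. rewrite <- sector_series_split by easy.
  repeat split; [auto | | now apply Arg_sector_series].
  rewrite sector_series_eq by easy. apply cexp_neq_0.
- unfold schwarzian. rewrite PS by easy.
  replace (C_derive (pre_schwarzian f) 0) with (CPSeries (CPS_derive (real_seq tau)) 0%C).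
  2:{ symmetry. apply is_C_derive_unique.
      apply (cderive_ext_loc T _ 0%C _ 1); [lra | |].
      - intros w Hw. symmetry. apply PS. unfold unit_disk. now replace (w - 0)%C with w in Hw by ring.
      - apply cderive_CPSeries. auto. }
  unfold T. rewrite !CPSeries_0. unfold CPS_derive, real_seq, tau.
  change (sector_coef alpha 1) with 0. change (sector_coef alpha 2) with (2 * alpha).
  simpl. ring.
Qed.

Theorem theorem1p5 (alpha : R) (halpha : 0 < alpha < 1) :
  (forall f : C -> C, strongly_convex alpha f ->
     Rbar_le (schwarzian_norm f) (2 * alpha)) /\
  (forall M : R,
     (forall f : C -> C, strongly_convex alpha f ->
        Rbar_le (schwarzian_norm f) M) ->
     2 * alpha <= M).
Proof.
split.
- intros f [[Hf _] Hs]. apply Lub_Rbar_correct. intros x [z [Hz ->]].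
  pose proof (analytic_on_derive _ _ Hf) as [_ Hf1].
  pose proof (analytic_on_derive _ _ Hf1) as [_ Hf2].
  set (T := pre_schwarzian f).
  assert (HT : holo 3 unit_disk T).
  { apply (holo_div 3 unit_disk (C_derive (C_derive f)) (C_derive f)).
    - intros w Hw. now apply Hs.
    - now apply analytic_on_holo.
    - now apply analytic_on_holo. }
  pose proof HT as [T1 [HT1 HT2]].
  assert (EqT : forall w, unit_disk w -> C_derive T w = T1 w).
  { intros w Hw. now apply is_C_derive_unique, HT1. }
  unfold schwarzian. fold T. rewrite EqT by easy.
  apply (schwarzian_bound alpha T T1); try easy.
  + now apply holo_weaken.
  + apply (holo_cont unit_disk); [now apply holo_weaken|]. unfold unit_disk. rewrite Cmod_0. lra.
  + intros w Hw. now apply Hs.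
  + intros w Hw. now apply Hs.
- intros M HM. destruct (extremal_function alpha halpha) as [f [Hf H0]].
  specialize (HM f Hf).
  (* At the origin the weight [(1 - |z|^2)^2] is 1, so the norm is at least [|S_f(0)|]. *)
  assert (K : Rbar_le (2 * alpha) (schwarzian_norm f)).
  { apply Lub_Rbar_correct. exists 0%C. split; [unfold unit_disk; rewrite Cmod_0; lra|].
    rewrite H0, Cmod_0, Cmod_R, Rabs_pos_eq by lra. ring. }
  exact (Rbar_le_trans _ _ _ K HM).
Qed.
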